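(* Let $G$ be a countable sofic group acting by measure-preserving transformations on a standard probability space $(X,\mu)$, and let $\Sigma=\{\sigma_i:G\to\mathrm{Sym}(d_i)\}_{i=1}^\infty$ be a sofic approximation sequence for $G$. Suppose that there is a generating (countable) measurable partition $\mathcal P$ of $X$ with $H_\mu(\mathcal P)<+\infty$. Then $$h_{\Sigma,\mu}(X,G)=h'_{\Sigma,\mu}(X,G).$$
   Context: **Sofic approximations.** $\mathrm{Sym}(d)$ is the permutation group of $\{1,\dots,d\}$. A sofic approximation sequence for a countable discrete group $G$ (identity $e$) is a sequence of maps (not necessarily homomorphisms) $\sigma_i:G\to\mathrm{Sym}(d_i)$, $s\mapsto\sigma_{i,s}$, with $\lim_i d_i=\infty$, $\lim_i \frac1{d_i}|\{k:\sigma_{i,st}(k)=\sigma_{i,s}\sigma_{i,t}(k)\}|=1$ for all $s,t\in G$, and $\lim_i\frac1{d_i}|\{k:\sigma_{i,s}(k)\ne\sigma_{i,t}(k)\}|=1$ for all distinct $s,t\in G$. $G$ is sofic if maps with the last two properties exist. For a map $\sigma:G\to\mathrm{Sym}(d)$, $s\in G$ and $f\in\mathbb C^d\cong C(\{1,\dots,d\})$ put $\sigma_s(f)=f\circ\sigma_s^{-1}$. $\zeta$ is the uniform probability measure on $\{1,\dots,d\}$, also viewed as the functional $\zeta(f)=\frac1d\sum_k f(k)$; on $\mathbb C^d$, $\|f\|_2=(\frac1d\sum_k|f(k)|^2)^{1/2}$. For a pseudometric space $(Y,\rho)$ and $\varepsilon\ge0$, $N_\varepsilon(Y,\rho)$ is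 the maximal cardinality of a finite $\varepsilon$-separated subset of $Y$ (pairwise distances $>\varepsilon$). Convention: $\log 0=-\infty$. **Measure setting.** For $f\in L^\infty(X,\mu)$, $\alpha_s(f)(x)=f(s^{-1}x)$. A subset of $L^\infty(X,\mu)$ (or a sequence, via its image) is dynamically generating if it is not contained in any proper $G$-invariant von Neumann subalgebra of $L^\infty(X,\mu)$. A measurable partition is identified with the set of characteristic functions of its atoms; it is generating if this set is dynamically generating. $H_\mu(\mathcal P)=-\sum_{p\in\mathcal P}\mu(p)\log\mu(p)$. **The entropy $h_{\Sigma,\mu}(X,G)$.** Let $\mathcal S=\{p_n\}_{n\in\mathbb N}$ be a sequence in the unit ball (for the $L^\infty$-norm) of $L^\infty_{\mathbb R}(X,\mu)$ (real-valued functions). For nonempty finite $F\subseteq G$ and $m\in\mathbb N$, $\mathcal S_{F,m}$ is the set of all products $\alpha_{s_1}(f_1)\cdots\alpha_{s_j}(f_j)$ with $1\le j\le m$, $f_1,\dots,f_j\in\{p_1,\dots,p_m\}$, $s_1,\dots,s_j\in F$. Put $\rho_{\mathcal S}(\varphi,\psi)=\sum_{n=1}^\infty 2^{-n}\|\varphi(p_n)-\psi(p_n)\|_2$. For $\delta>0$ and $\sigma:G\to\mathrm{Sym}(d)$, $\mathrm{UP}_\mu(\mathcal S,F,m,\delta,\sigma)$ is the set of unital positive linear maps $\varphi:L^\infty(X,\mu)\to\mathbb C^d$ such that (i) $\|\varphi(\alpha_{s_1}(f_1)\cdots\alpha_{s_j}(f_j))-\varphi(\alpha_{s_1}(f_1))\cdots\varphi(\alpha_{s_j}(f_j))\|_2<\delta$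 for all $1\le j\le m$, $f_1,\dots,f_j\in\{p_1,\dots,p_m\}$, $s_1,\dots,s_j\in F$; (ii) $|\zeta\circ\varphi(f)-\mu(f)|<\delta$ for all $f\in\mathcal S_{F,m}$; (iii) $\|\varphi\circ\alpha_s(f)-\sigma_s\circ\varphi(f)\|_2<\delta$ for all $s\in F$, $f\in\{p_1,\dots,p_m\}$. Define $h_{\Sigma,\mu}(\mathcal S)=\sup_{\varepsilon>0}\inf_F\inf_{m}\inf_{\delta>0}\limsup_{i\to\infty}\frac1{d_i}\log N_\varepsilon(\mathrm{UP}_\mu(\mathcal S,F,m,\delta,\sigma_i),\rho_{\mathcal S})$, $F$ ranging over nonempty finite subsets of $G$. The measure entropy $h_{\Sigma,\mu}(X,G)$ is the common value of $h_{\Sigma,\mu}(\mathcal S)$ over all dynamically generating sequences $\mathcal S$ in the unit ball of $L^\infty_{\mathbb R}(X,\mu)$ (this value does not depend on $\mathcal S$). **Bowen's entropy $h'_{\Sigma,\mu}(X,G)$.** For a finite ordered measurable partition $\mathcal P=(p_1,\dots,p_n)$ of $X$, nonempty finite $F\subseteq G$, $\delta>0$ and $\sigma:G\to\mathrm{Sym}(d)$, $\mathrm{AP}(\mathcal P,F,\delta,\sigma)$ is the set of ordered partitions $(q_1,\dots,q_n)$ of $\{1,\dots,d\}$ (empty atoms allowed) with $\sum_{\gamma:F\to\{1,\dots,n\}}|\mu(\bigcap_{s\in F}s\,p_{\gamma(s)})-\zeta(\bigcap_{s\in F}\sigma_s(q_{\gamma(s)}))|\le\delta$. Put $h'_{\Sigma,\mu}(\mathcal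 P,F,\delta)=\limsup_i\frac1{d_i}\log|\mathrm{AP}(\mathcal P,F,\delta,\sigma_i)|$, $h'_{\Sigma,\mu}(\mathcal P,F)=\inf_{\delta>0}h'_{\Sigma,\mu}(\mathcal P,F,\delta)$ and $h'_{\Sigma,\mu}(\mathcal P)=\inf_F h'_{\Sigma,\mu}(\mathcal P,F)$. For a countable measurable partition $\mathcal P=\{p_1,p_2,\dots\}$ with $H_\mu(\mathcal P)<\infty$, $h'_{\Sigma,\mu}(\mathcal P)=\inf_F\lim_{n\to\infty}h'_{\Sigma,\mu}(\mathcal P_n,F)$, where $\mathcal P_n=\{p_1,\dots,p_{n-1},\bigcup_{k\ge n}p_k\}$ and $F$ ranges over nonempty finite subsets of $G$. Bowen proved that $h'_{\Sigma,\mu}(\mathcal P)$ has a common value over all generating measurable partitions $\mathcal P$ with $H_\mu(\mathcal P)<\infty$; when such a partition exists, $h'_{\Sigma,\mu}(X,G)$ denotes this common value. *)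

(* Defs.v *)
From HB Require Import structures.
From mathcomp Require Import all_boot all_order all_algebra all_fingroup finmap.
From mathcomp Require Import all_classical all_reals all_analysis.
From mathcomp.real_closed Require Import complex.

Set Implicit Arguments.
Unset Strict Implicit.
Unset Printing Implicit Defensive.

Import Order.TTheory GRing.Theory Num.Theory.
Import numFieldNormedType.Exports.
Local Open Scope classical_set_scope.
Local Open Scope ring_scope.

Section SoficApproximation.
Context (R : realType) (G : groupType).

(* [sigma i s k] is sigma_{i,s}(k).  The composite sigma_s sigma_t is written as
   an iterated application because the product of {perm T} composes in the
   opposite order. *)
Definition asymptotically_multiplicative (d : nat -> nat)
    (sigma : forall i, G -> 'S_(d i)) : Prop :=
  forall s t : G,
    (fun i => #|[set k : 'I_(d i) | sigma i (s * t)%g k == sigma i s (sigma i t k)]%SET|%:R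
              / (d i)%:R : R) @ \oo --> (1 : R).

Definition asymptotically_free (d : nat -> nat)
    (sigma : forall i, G -> 'S_(d i)) : Prop :=
  forall s t : G, s <> t ->
    (fun i => #|[set k : 'I_(d i) | sigma i s k != sigma i t k]%SET|%:R
              / (d i)%:R : R) @ \oo --> (1 : R).

Definition sofic : Prop :=
  exists (d : nat -> nat) (sigma : forall i, G -> 'S_(d i)),
    asymptotically_multiplicative sigma /\ asymptotically_free sigma.

Definition sofic_approximation (d : nat -> nat)
    (sigma : forall i, G -> 'S_(d i)) : Prop :=
  [/\ d @ \oo --> \oo,
      asymptotically_multiplicative sigma &
      asymptotically_free sigma].

End SoficApproximation.

(* Polish-ness is expressed through a complete separable metric space [Y]
   to which [X] is Borel isomorphic. *)
Definition standard_borel (R : realType) (dX : measure_display)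
    (X : measurableType dX) : Prop :=
  exists (Y : metricType R) (f : X -> Y),
    [/\ bijective f,
        exists2 D : set Y, countable D & dense D,
        forall u : nat -> Y, cauchy (u @ \oo) -> exists l : Y, u @ \oo --> l &
        forall A : set X, measurable A <-> <<s (@open Y) >> (f @` A)].

Section FiniteDimensional.
Context (R : realType) (d : nat).

Definition zeta (f : 'I_d -> R[i]) : R[i] := (d%:R)^-1 * \sum_(k < d) f k.

Definition norm2 (f : 'I_d -> R[i]) : R :=
  Num.sqrt ((d%:R)^-1 * \sum_(k < d) Normc.normc (f k) ^+ 2).

Definition perm_shift (s : 'S_d) (f : 'I_d -> R[i]) : 'I_d -> R[i] :=
  fun k => f ((s^-1)%g k).

End FiniteDimensional.

(* A family indexed by 'I_n with pairwise distances > eps >= 0 is injective, so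
   it is the same as a finite eps-separated set of cardinality n. *)
Definition separated_card (R : realType) (T : Type) (eps : R) (Y : set T)
    (rho : T -> T -> \bar R) : \bar R :=
  ereal_sup [set (n%:R)%:E | n in [set n : nat | exists y : 'I_n -> T,
    (forall i, Y (y i)) /\ (forall i j, i != j -> (eps%:E < rho (y i) (y j))%E)]].

Section MeasureEntropy.
Context (R : realType) (G : groupType) (dX : measure_display)
  (X : measurableType dX) (mu : probability X R) (act : G -> X -> X).

Definition pmp_action : Prop :=
  [/\ forall x, act 1%g x = x,
      forall s t x, act (s * t)%g x = act s (act t x),
      forall s, measurable_fun setT (act s) &
      forall s (A : set X), measurable A -> mu (act s @^-1` A) = mu A].

(* Elements of the complex spaces L^oo(X,mu) and L^1(X,mu) are handled through
   their representatives; sets of, and maps on, classes are sets and maps on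
   representatives that are invariant under almost everywhere equality. *)
Definition Linfty : set (X -> R[i]) :=
  [set f : X -> R[i] | @complex.Re R \o f \in Lfun mu +oo%E /\
                       @complex.Im R \o f \in Lfun mu +oo%E].

Definition Lone : set (X -> R[i]) :=
  [set f : X -> R[i] | @complex.Re R \o f \in Lfun mu 1%E /\
                       @complex.Im R \o f \in Lfun mu 1%E].

Definition cintegral (f : X -> R[i]) : R[i] :=
  Complex (\int[mu]_(x in setT) complex.Re (f x)) (\int[mu]_(x in setT) complex.Im (f x)).

Definition cplx (f : X -> R) : X -> R[i] := fun x => real_complex R (f x).

Definition alpha (s : G) (f : X -> R[i]) : X -> R[i] := fun x => f (act (s^-1)%g x).

Definition weakstar_closed (A : set (X -> R[i])) : Prop :=
  forall f, Linfty f ->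
    (forall (n : nat) (g : 'I_n -> X -> R[i]) (eps : R),
       (forall i, Lone (g i)) -> 0 < eps ->
       exists2 a, A a &
         forall i, Normc.normc (cintegral (fun x => (f x - a x) * g i x)) < eps) ->
    A f.

(* Unital *-subalgebras closed for the weak operator topology of the
   multiplication representation on L^2(X,mu), which on L^oo(X,mu) is the
   weak* topology given by L^1(X,mu). *)
Definition von_neumann_subalgebra (A : set (X -> R[i])) : Prop :=
  [/\ A `<=` Linfty,
      forall f g, A f -> Linfty g -> {ae mu, forall x, f x = g x} -> A g,
      A (fun=> 1) &
      [/\ forall (c : R[i]) f g, A f -> A g -> A (fun x => c * f x + g x),
          forall f g, A f -> A g -> A (fun x => f x * g x),
          forall f, A f -> A (fun x => (f x)^*%C) &
          weakstar_closed A]].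

Definition invariant (A : set (X -> R[i])) : Prop :=
  forall s f, A f -> A (alpha s f).

Definition dynamically_generating (S : set (X -> R[i])) : Prop :=
  forall A : set (X -> R[i]), von_neumann_subalgebra A -> invariant A ->
    S `<=` A -> A = Linfty.

Definition unital_positive_map (d : nat)
    (phi : (X -> R[i]) -> 'I_d -> R[i]) : Prop :=
  [/\ forall f g, Linfty f -> Linfty g -> {ae mu, forall x, f x = g x} ->
        phi f = phi g,
      forall (c : R[i]) f g, Linfty f -> Linfty g ->
        phi (fun x => c * f x + g x) = (fun k => c * phi f k + phi g k),
      phi (fun=> 1) = (fun=> 1) &
      forall f, Linfty f -> {ae mu, forall x, 0 <= f x} -> forall k, 0 <= phi f k].

(* Sequences are indexed from 0: the function p_n of a sequence p_1, p_2, ... is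
   [S n.-1], and {p_1, ..., p_m} is the set of all [S n] with n < m. *)
Definition unit_ball_sequence (S : nat -> X -> R) : Prop :=
  forall n, S n \in Lfun mu +oo%E /\ ('N[mu]_+oo[EFin \o S n] <= 1)%E.

Definition translate_product (S : nat -> X -> R) (j : nat) (s : 'I_j -> G)
    (a : 'I_j -> nat) : X -> R[i] :=
  fun x => \prod_(l < j) alpha (s l) (cplx (S (a l))) x.

Definition products (S : nat -> X -> R) (F : {fset G}) (m : nat) : set (X -> R[i]) :=
  [set f | exists (j : nat) (s : 'I_j -> G) (a : 'I_j -> nat),
     [/\ (0 < j <= m)%N, forall l, s l \in F, forall l, (a l < m)%N &
         f = translate_product S s a]].

Definition rhoS (S : nat -> X -> R) (d : nat)
    (phi psi : (X -> R[i]) -> 'I_d -> R[i]) : \bar R :=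
  (\sum_(0 <= n <oo)
     (2^-1 ^+ n.+1 * norm2 (fun k => phi (cplx (S n)) k - psi (cplx (S n)) k))%:E)%E.

Definition UP (S : nat -> X -> R) (F : {fset G}) (m : nat) (delta : R)
    (d : nat) (sigma : G -> 'S_d) : set ((X -> R[i]) -> 'I_d -> R[i]) :=
  [set phi | [/\ unital_positive_map phi,
     forall (j : nat) (s : 'I_j -> G) (a : 'I_j -> nat),
       (0 < j <= m)%N -> (forall l, s l \in F) -> (forall l, (a l < m)%N) ->
       norm2 (fun k => phi (translate_product S s a) k
                       - \prod_(l < j) phi (alpha (s l) (cplx (S (a l)))) k) < delta,
     forall f, products S F m f -> Normc.normc (zeta (phi f) - cintegral f) < delta &
     forall s n, s \in F -> (n < m)%N ->
       norm2 (fun k => phi (alpha s (cplx (S n))) k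
                       - perm_shift (sigma s) (phi (cplx (S n))) k) < delta]].

Definition sequence_entropy (d : nat -> nat) (sigma : forall i, G -> 'S_(d i))
    (S : nat -> X -> R) : \bar R :=
  ereal_sup [set ereal_inf [set ereal_inf [set ereal_inf [set
    limn_esup (fun i => (((d i)%:R^-1)%:E
      * lne (separated_card eps (UP S F m delta (sigma i)) (@rhoS S (d i))))%E)
    | delta in [set delta : R | 0 < delta]]
    | m in [set m : nat | (0 < m)%N]]
    | F in [set F : {fset G} | F != fset0]]
    | eps in [set eps : R | 0 < eps]].

Definition generating_sequence (S : nat -> X -> R) : Prop :=
  unit_ball_sequence S /\ dynamically_generating (range (fun n => cplx (S n))).

(* [v] is h_{Sigma,mu}(X,G), the common value over all generating sequences. *)
Definition is_measure_entropy (d : nat -> nat) (sigma : forall i, G -> 'S_(d i))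
    (v : \bar R) : Prop :=
  (exists S, generating_sequence S) /\
  (forall S, generating_sequence S -> sequence_entropy sigma S = v).

(* Countable partitions are sequences in which empty atoms may occur; finite
   partitions are padded with empty atoms. *)
Definition measurable_partition (P : nat -> set X) : Prop :=
  [/\ forall n, measurable (P n), trivIset setT P & \bigcup_n P n = setT].

Definition generating_partition (P : nat -> set X) : Prop :=
  measurable_partition P /\
  dynamically_generating (range (fun n => cplx (\1_(P n)))).

Definition partition_entropy (P : nat -> set X) : \bar R :=
  (\sum_(0 <= n <oo) (- (fine (mu (P n)) * ln (fine (mu (P n)))))%:E)%E.

Definition ordered_partition (d n : nat) (q : {ffun 'I_n -> {set 'I_d}}) : bool :=
  [forall i, forall j, (i != j) ==> [disjoint q i & q j]]
  && ((\bigcup_i q i)%SET == [set: 'I_d]%SET).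

Definition partition_defect (n : nat) (P : 'I_n -> set X) (F : {fset G}) (d : nat)
    (sigma : G -> 'S_d) (q : {ffun 'I_n -> {set 'I_d}}) : R :=
  \sum_(g : {ffun F -> 'I_n})
     `| fine (mu (\bigcap_(s in [set: F]) (act (val s) @` P (g s))))
        - #|(\bigcap_(s : F) (sigma (val s) @: q (g s)))%SET|%:R / d%:R |.

Definition AP (n : nat) (P : 'I_n -> set X) (F : {fset G}) (delta : R)
    (d : nat) (sigma : G -> 'S_d) : {set {ffun 'I_n -> {set 'I_d}}} :=
  [set q | ordered_partition q & partition_defect P F sigma q <= delta]%SET.

Definition bowen_finite (d : nat -> nat) (sigma : forall i, G -> 'S_(d i))
    (n : nat) (P : 'I_n -> set X) (F : {fset G}) : \bar R :=
  ereal_inf [set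
    limn_esup (fun i => (((d i)%:R^-1)%:E
                         * lne (#|AP P F delta (sigma i)|%:R)%:E)%E)
    | delta in [set delta : R | 0 < delta]].

(* P_n = {p_1, ..., p_{n-1}, p_n \cup p_{n+1} \cup ...}, with atoms indexed from 0. *)
Definition truncate_partition (P : nat -> set X) (n : nat) : 'I_n -> set X :=
  fun i => if i.+1 == n then \bigcup_(k in [set k : nat | (i <= k)%N]) P k else P i.

(* For sigma a sofic approximation and H_mu(P) < +oo the limit over n exists. *)
Definition bowen_partition (d : nat -> nat) (sigma : forall i, G -> 'S_(d i))
    (P : nat -> set X) : \bar R :=
  ereal_inf [set limn (fun n => bowen_finite sigma (@truncate_partition P n) F)
             | F in [set F : {fset G} | F != fset0]].

(* [v] is h'_{Sigma,mu}(X,G). *)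
Definition is_bowen_entropy (d : nat -> nat) (sigma : forall i, G -> 'S_(d i))
    (v : \bar R) : Prop :=
  (exists P, generating_partition P /\ (partition_entropy P < +oo)%E) /\
  (forall P, generating_partition P -> (partition_entropy P < +oo)%E ->
     bowen_partition sigma P = v).

End MeasureEntropy.

(* Main.v *)
From mathcomp Require Import all_boot all_order all_algebra all_fingroup finmap.
From mathcomp Require Import all_classical all_reals all_analysis.
From mathcomp.real_closed Require Import complex.
From mathcomp Require Import zify ring lra measurable_realfun ess_sup_inf.
Require Import Defs.

(** Both entropies count finite models of the action: [bowen_partition] counts the
    labellings of {1, ..., d} whose names have almost the right statistics, and
    [sequence_entropy] the eps-separated positive maps into functions on
    {1, ..., d} that are almost multiplicative, measure-preserving and
    equivariant.  Labellings and maps are translated into each other, at a cost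
    that is negligible on the exponential scale, for an arbitrary generating
    sequence S and an arbitrary generating partition P of finite entropy.  This
    gives [entropy_eq].  Since the indicators of the atoms of P form a generating
    sequence, all the values on both sides then coincide.

    A positive map on complex functions is real on real functions, and L^1 and
    L^2 norms are comparable on bounded functions.  By [UP_rUP] and [rUP_UP] one
    may therefore work with real positive maps and L^1 norms.

    The link between labellings and maps is density.  If P is generating, every
    bounded function is L^1 close to a function of the name of a point, i.e. of
    the labels of finitely many of its translates, where the labels from some N
    on are merged ([name_approx]).  If S is generating, every indicator is L^1
    close to a polynomial in the translates of S with values in [0, 1]
    ([unit_limit_measurable]).  In both cases the reason is [approximable_vN]:
    the functions that are approximable by functions of finitely many bits form
    a von Neumann algebra, the weak closure being handled by a conditional
    expectation ([projection]).

    Upper bound on [sequence_entropy].  Take polynomials that approximate the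
    indicators of the labels.  An almost multiplicative map sends them to
    functions that are almost idempotent and almost add up to one, which can be
    rounded to a labelling.  Its names have the right statistics and determine
    the values of the map at S ([encode_rUP]).  Hence eps-separated maps give
    different labellings.

    Lower bound.  A labelling with good statistics defines the map that averages
    f over the points of X with the name of k; it is almost multiplicative and
    equivariant ([decode_rUP]).  The values of this map at S determine the
    labelling, with the labels from n on merged, at most places ([separation]).
    As P has finite entropy, the labels from n on carry little information, so
    that at most exp (kappa d) labellings with good statistics have nearly the
    same coarse part ([count_close]).  Passing to a maximal separated set thus
    costs a factor exp (kappa d).  The same count bounds the fibers of the
    merging of labels; it shows that the finite entropies of the truncations of
    P are almost nonincreasing, so that their limit exists ([bowen_cvg]). *)

Set Implicit Arguments.
Unset Strict Implicit.
Unset Printing Implicit Defensive.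

Import Order.TTheory GRing.Theory Num.Theory.
Import numFieldNormedType.Exports.
Local Open Scope classical_set_scope.
Local Open Scope ring_scope.

(** * Bounded functions and their integrals *)

Section BoundedFunctions.
Context (R : realType) (dX : measure_display) (X : measurableType dX)
  (mu : probability X R).
Implicit Types f g h : X -> R.

(** Bounded everywhere, and not merely almost everywhere: sums and products
    can then be fed to positive maps with no null sets to carry along. *)
Definition bdd f := measurable_fun setT f /\ exists M, forall x, `|f x| <= M.

Definition Ex f : R := \int[mu]_x f x.

Lemma bdd_cst c : bdd (fun=> c).
Proof. by split; [exact: measurable_cst|exists `|c|]. Qed.

Lemma bddD f g : bdd f -> bdd g -> bdd (fun x => f x + g x).
Proof.
move=> [mf [M fM]] [mg [N gN]]; split; first exact: measurable_funD.
by exists (M + N) => x; rewrite (le_trans (ler_normD _ _))// lerD.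
Qed.

Lemma bddM f g : bdd f -> bdd g -> bdd (fun x => f x * g x).
Proof.
move=> [mf [M fM]] [mg [N gN]]; split; first exact: measurable_funM.
by exists (M * N) => x; rewrite normrM ler_pM.
Qed.

Lemma bddZ c f : bdd f -> bdd (fun x => c * f x).
Proof. exact/bddM/bdd_cst. Qed.

Lemma bddN f : bdd f -> bdd (fun x => - f x).
Proof.
move=> /(bddZ (-1)); congr bdd.
by apply/funext => x; rewrite mulN1r.
Qed.

Lemma bddB f g : bdd f -> bdd g -> bdd (fun x => f x - g x).
Proof. by move=> bf /bddN; exact: bddD. Qed.

Lemma bdd_norm f : bdd f -> bdd (fun x => `|f x|).
Proof.
move=> [mf [M fM]]; split; first exact: measurableT_comp.
by exists M => x; rewrite normr_id.
Qed.

Lemma bdd_sqr f : bdd f -> bdd (fun x => f x ^+ 2).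
Proof. by move=> bf; exact: bddM. Qed.

Lemma bdd_sum (I : Type) (r : seq I) (P : pred I) (F : I -> X -> R) :
  (forall i, P i -> bdd (F i)) -> bdd (fun x => \sum_(i <- r | P i) F i x).
Proof.
move=> bF; elim: r => [|i r ih].
  by under [X in bdd X]eq_fun do rewrite big_nil; exact: bdd_cst.
under [X in bdd X]eq_fun do rewrite big_cons.
by case Pi: (P i) => //; apply: bddD => //; exact: bF.
Qed.

Lemma bdd_prod (I : Type) (r : seq I) (P : pred I) (F : I -> X -> R) :
  (forall i, P i -> bdd (F i)) -> bdd (fun x => \prod_(i <- r | P i) F i x).
Proof.
move=> bF; elim: r => [|i r ih].
  by under [X in bdd X]eq_fun do rewrite big_nil; exact: bdd_cst.
under [X in bdd X]eq_fun do rewrite big_cons.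
by case Pi: (P i) => //; apply: bddM => //; exact: bF.
Qed.

Lemma bdd_bool (b : X -> bool) : measurable [set x | b x] ->
  bdd (fun x => (b x)%:R).
Proof.
move=> mb; rewrite (_ : (fun _ => _) = \1_[set x | b x]).
  split; first exact: measurable_indic.
  exists 1 => x; rewrite indicE; case: (_ \in _); rewrite ?normr1 ?normr0//.
apply/funext => x; rewrite indicE; congr (_%:R); congr nat_of_bool.
by apply/idP/idP; rewrite inE.
Qed.

Lemma bdd_integrable f : bdd f -> mu.-integrable setT (EFin \o f).
Proof.
move=> [mf [M fM]]; apply: measurable_bounded_integrable => //.
  by rewrite (le_lt_trans (probability_le1 _ _)) ?ltry.
exists M; split; first exact: num_real.
by move=> y My x _ /=; rewrite (le_trans (fM x))// ltW.
Qed.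

Lemma eq_Ex f g : f =1 g -> Ex f = Ex g.
Proof. by move=> fg; congr Ex; apply/funext. Qed.

Lemma ExD f g : bdd f -> bdd g -> Ex (fun x => f x + g x) = Ex f + Ex g.
Proof. by move=> /bdd_integrable bf /bdd_integrable bg; rewrite /Ex RintegralD. Qed.

Lemma ExB f g : bdd f -> bdd g -> Ex (fun x => f x - g x) = Ex f - Ex g.
Proof. by move=> /bdd_integrable bf /bdd_integrable bg; rewrite /Ex RintegralB. Qed.

Lemma ExZ c f : bdd f -> Ex (fun x => c * f x) = c * Ex f.
Proof. by move=> /bdd_integrable bf; rewrite /Ex RintegralZl. Qed.

Lemma Ex_cst c : Ex (fun=> c) = c.
Proof.
rewrite /Ex Rintegral_cst//.
rewrite [X in _ * fine X](_ : _ = 1%E) ?mulr1//.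
exact: probability_setT.
Qed.

Lemma Ex_sum (I : Type) (r : seq I) (P : pred I) (F : I -> X -> R) :
  (forall i, P i -> bdd (F i)) ->
  Ex (fun x => \sum_(i <- r | P i) F i x) = \sum_(i <- r | P i) Ex (F i).
Proof.
move=> bF; elim: r => [|i r ih].
  by rewrite big_nil; under eq_Ex do rewrite big_nil; exact: Ex_cst.
rewrite big_cons; under eq_Ex do rewrite big_cons.
case Pi: (P i) => //; rewrite ExD ?ih//; first exact: bF.
exact: bdd_sum.
Qed.

Lemma le_Ex f g : bdd f -> bdd g -> (forall x, f x <= g x) -> Ex f <= Ex g.
Proof.
by move=> /bdd_integrable bf /bdd_integrable bg fg; apply: le_Rintegral.
Qed.

Lemma Ex_ge0 f : (forall x, 0 <= f x) -> 0 <= Ex f.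
Proof. by move=> f0; apply: Rintegral_ge0. Qed.

Lemma le_norm_Ex f : bdd f -> `|Ex f| <= Ex (fun x => `|f x|).
Proof. by move=> /bdd_integrable bf; apply: le_normr_Rintegral. Qed.

Lemma Ex_ae f g : bdd f -> bdd g -> {ae mu, forall x, f x = g x} -> Ex f = Ex g.
Proof.
move=> [mf _] [mg _] fg; congr fine; apply: ae_eq_integral => //.
- exact/measurable_EFinP.
- exact/measurable_EFinP.
- by apply: filterS fg => x /= ->.
Qed.

Lemma Ex_cvg (f_ : nat -> X -> R) f (M : R) : (forall n, measurable_fun setT (f_ n)) ->
  measurable_fun setT f -> (forall n x, `|f_ n x| <= M) ->
  {ae mu, forall x, f_ n x @[n --> \oo] --> f x} ->
  Ex (fun x => `|f_ n x - f x|) @[n --> \oo] --> (0 : R).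
Proof.
move=> mf_ mf fM ff.
have [] := @dominated_convergence _ _ _ mu setT measurableT
  (fun n => EFin \o f_ n) (EFin \o f) (fun=> M%:E).
- by move=> n; exact/measurable_EFinP.
- exact/measurable_EFinP.
- by apply: filterS ff => x fx _; apply: cvg_EFin => //; exact: nearW.
- by apply: bdd_integrable; exact: bdd_cst.
- by apply: aeW => x n _; rewrite /= lee_fin.
- by move=> _ + _ => /fine_cvg; exact.
Qed.

End BoundedFunctions.

(** * Finite labellings, conditional averages, approximation by bits *)

Section Labels.
Context (R : realType) (dX : measure_display) (X : measurableType dX)
  (mu : probability X R).
Implicit Types f g h : X -> R.
Local Notation Ex := (Ex mu).

Definition mlab (T : finType) (lab : X -> T) :=
  forall t, measurable [set x | lab x == t].

Lemma mlab_bool (T : finType) (lab : X -> T) (b : T -> bool) :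
  mlab lab -> measurable [set x | b (lab x)].
Proof.
move=> ml; rewrite (_ : [set _ | _] = \bigcup_(t in [set t | b t]) [set x | lab x == t]).
  by apply: fin_bigcup_measurable => // t _; exact: finite_finset.
apply/seteqP; split => [x /= bx|x [t /= bt /eqP xt]]; first by exists (lab x); rewrite //= eqxx.
by rewrite /= xt.
Qed.

Lemma mlab_ffun (I T : finType) (lab : I -> X -> T) :
  (forall i, mlab (lab i)) -> mlab (fun x => [ffun i => lab i x]).
Proof.
move=> ml t.
rewrite (_ : [set _ | _] = \bigcap_(i in [set: I]) [set x | lab i x == t i]).
  by apply: fin_bigcap_measurable => // i _; exact: ml.
apply/seteqP; split => [x /= /eqP <- i _ /=|x H /=]; first by rewrite ffunE.
by apply/eqP/ffunP => i; rewrite ffunE; apply/eqP; exact: H.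
Qed.

Lemma bdd_ind (T : finType) (lab : X -> T) (b : T -> bool) : mlab lab ->
  bdd (fun x => (b (lab x))%:R : R).
Proof. by move=> ml; apply: bdd_bool; exact: mlab_bool. Qed.

Lemma sum_ind (T : finType) (c : T -> R) (t : T) :
  c t = \sum_(u : T) c u * (t == u)%:R.
Proof.
rewrite (bigD1 t)//= eqxx mulr1 big1 ?addr0// => u.
by rewrite eq_sym => /negbTE ->; rewrite mulr0.
Qed.

Lemma bdd_lab (T : finType) (lab : X -> T) (c : T -> R) : mlab lab ->
  bdd (fun x => c (lab x)).
Proof.
move=> ml; under [X in bdd X]eq_fun do rewrite sum_ind.
by apply: bdd_sum => t _; apply: bddZ; exact: (bdd_ind (fun u => u == t)).
Qed.

Lemma Ex_lab (T : finType) (lab : X -> T) f (c : T -> R) : mlab lab -> bdd f ->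
  Ex (fun x => f x * c (lab x)) =
  \sum_(t : T) c t * Ex (fun x => f x * (lab x == t)%:R).
Proof.
move=> ml bf.
under eq_Ex do rewrite [X in _ * X]sum_ind mulr_sumr.
rewrite Ex_sum; last first.
  move=> t _; apply: bddM => //; apply: bddZ.
  exact: (bdd_ind (fun u => u == t)).
apply: eq_bigr => t _; rewrite -ExZ.
  by apply: eq_Ex => x; rewrite mulrCA.
by apply: bddM => //; exact: (bdd_ind (fun u => u == t)).
Qed.

Definition prob (T : finType) (lab : X -> T) (t : T) : R :=
  Ex (fun x => (lab x == t)%:R).

(** The average of [f] over the atom [lab = t].  At an atom of measure zero the
    value is [0], division by zero being [0]. *)
Definition cexp (T : finType) (lab : X -> T) f (t : T) : R :=
  Ex (fun x => f x * (lab x == t)%:R) / prob lab t.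

Lemma prob_ge0 (T : finType) (lab : X -> T) t : 0 <= prob lab t.
Proof. by apply: Ex_ge0 => x; rewrite ler0n. Qed.

Lemma norm_Ex_ind (T : finType) (lab : X -> T) f (M : R) t : mlab lab -> bdd f ->
  (forall x, `|f x| <= M) ->
  `|Ex (fun x => f x * (lab x == t)%:R)| <= M * prob lab t.
Proof.
move=> ml bf fM; have bt : bdd (fun x => (lab x == t)%:R : R).
  exact: (bdd_ind (fun u => u == t)).
rewrite (le_trans (le_norm_Ex _ _))//; first exact: bddM.
rewrite -ExZ//; apply: le_Ex; [by apply: bdd_norm; exact: bddM|exact: bddZ|].
by move=> x; rewrite normrM ler_pM// normr_nat.
Qed.

Lemma cexpM (T : finType) (lab : X -> T) f t : mlab lab -> bdd f ->
  cexp lab f t * prob lab t = Ex (fun x => f x * (lab x == t)%:R).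
Proof.
move=> ml bf; have [p0|p0] := eqVneq (prob lab t) 0; last by rewrite divfK.
have [M fM] := bf.2.
have := norm_Ex_ind t ml bf fM; rewrite p0 !mulr0 normr_le0 => /eqP ->.
by [].
Qed.

Lemma norm_cexp (T : finType) (lab : X -> T) f (M : R) t : mlab lab -> bdd f ->
  (forall x, `|f x| <= M) -> 0 <= M -> `|cexp lab f t| <= M.
Proof.
move=> ml bf fM M0; have [p0|p0] := eqVneq (prob lab t) 0.
  by rewrite /cexp p0 invr0 mulr0 normr0.
have {}p0 : 0 < prob lab t by rewrite lt0r p0 prob_ge0.
by rewrite normrM normfV (gtr0_norm p0) ler_pdivrMr// norm_Ex_ind.
Qed.

Lemma Ex_cexp (T : finType) (lab : X -> T) f (c : T -> R) : mlab lab -> bdd f ->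
  Ex (fun x => cexp lab f (lab x) * c (lab x)) = Ex (fun x => f x * c (lab x)).
Proof.
move=> ml bf; rewrite [RHS]Ex_lab//.
transitivity (Ex (fun x => 1 * (cexp lab f (lab x) * c (lab x)))).
  by apply: eq_Ex => x; rewrite mul1r.
rewrite (Ex_lab (fun t => cexp lab f t * c t))//; last exact: bdd_cst.
apply: eq_bigr => t _; rewrite -(cexpM _ ml bf) mulrAC mulrC; congr (_ * (_ * _)).
by apply: eq_Ex => x; rewrite mul1r.
Qed.

Lemma sqr_Ex f : bdd f -> (Ex f) ^+ 2 <= Ex (fun x => f x ^+ 2).
Proof.
move=> bf; have : 0 <= Ex (fun x => (f x - Ex f) ^+ 2).
  by apply: Ex_ge0 => x; rewrite sqr_ge0.
rewrite (@eq_Ex _ _ _ _ _ (fun x => f x ^+ 2 + (- (2 * Ex f) * f x + Ex f ^+ 2))).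
  rewrite ExD; [|exact: bdd_sqr|by apply: bddD; [exact: bddZ|exact: bdd_cst]].
  by rewrite ExD; [|exact: bddZ|exact: bdd_cst]; rewrite ExZ// Ex_cst; lra.
by move=> x; ring.
Qed.

Lemma Ex_norm_le f (e : R) : bdd f -> 0 <= e -> Ex (fun x => f x ^+ 2) <= e ^+ 2 ->
  Ex (fun x => `|f x|) <= e.
Proof.
move=> bf e0 fe; rewrite -(@ler_pXn2r _ 2)// ?nnegrE//; last first.
  by apply: Ex_ge0.
rewrite (le_trans (sqr_Ex (bdd_norm bf)))//.
by under eq_Ex do rewrite real_normK ?num_real//.
Qed.

Section Bits.
Context (b : nat -> X -> bool).
Hypothesis mb : forall n, measurable [set x | b n x].

Definition bitcode n x : {ffun 'I_n -> bool} := [ffun i : 'I_n => b i x].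

Lemma mlab_bitcode n : mlab (bitcode n).
Proof.
apply: mlab_ffun => i t; case: t.
  rewrite (_ : [set _ | _] = [set x | b i x])//.
  by apply/seteqP; split => x /=; rewrite eqb_id.
rewrite (_ : [set _ | _] = ~` [set x | b i x]); first exact: measurableC.
by apply/seteqP; split => x /=; rewrite eqbF_neg => /negP.
Qed.

Lemma bdd_bitcode n (c : {ffun 'I_n -> bool} -> R) : bdd (fun x => c (bitcode n x)).
Proof. exact/bdd_lab/mlab_bitcode. Qed.

Definition proj n m (nm : (n <= m)%N) (t : {ffun 'I_m -> bool}) : {ffun 'I_n -> bool} :=
  [ffun i => t (widen_ord nm i)].

Lemma proj_bitcode n m (nm : (n <= m)%N) x : proj nm (bitcode m x) = bitcode n x.
Proof. by apply/ffunP => i; rewrite !ffunE. Qed.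

(** Membership in the L^1 closure of the functions of finitely many bits.  For
    bounded functions this is measurability, up to null sets, with respect to
    the sigma-algebra generated by the bits, with no sigma-algebra to handle. *)
Definition approximable f :=
  forall e : R, 0 < e -> exists n (c : {ffun 'I_n -> bool} -> R),
    Ex (fun x => `|f x - c (bitcode n x)|) < e.

Lemma le_Ex_dist f g h : bdd f -> bdd g -> bdd h ->
  Ex (fun x => `|f x - h x|) <= Ex (fun x => `|f x - g x|) + Ex (fun x => `|g x - h x|).
Proof.
move=> bf bg bh; rewrite -ExD; try by apply: bdd_norm; exact: bddB.
apply: le_Ex; first by apply: bdd_norm; exact: bddB.
  by apply: bddD; apply: bdd_norm; exact: bddB.
by move=> x; rewrite -(subrKA (g x)) ler_normD.
Qed.

Lemma approximable_closed f : bdd f ->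
  (forall e : R, 0 < e -> exists g, [/\ bdd g, approximable g & Ex (fun x => `|f x - g x|) < e]) ->
  approximable f.
Proof.
move=> bf H e e0; have e20 : 0 < e / 2 by rewrite divr_gt0.
have [g [bg ag fg]] := H _ e20.
have [n [c gc]] := ag _ e20; exists n, c.
rewrite (le_lt_trans (le_Ex_dist bf bg (bdd_bitcode c)))//.
by rewrite [ltRHS]splitr ltrD.
Qed.

Lemma approximable_bitcode n c : approximable (fun x => c (bitcode n x)).
Proof.
move=> e e0; exists n, c; under eq_Ex do rewrite subrr normr0.
by rewrite Ex_cst.
Qed.

Lemma approximable_ae f g : bdd f -> bdd g -> {ae mu, forall x, f x = g x} ->
  approximable f -> approximable g.
Proof.
move=> bf bg fg af; apply: approximable_closed => // e e0; exists f; split => //.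
rewrite (@Ex_ae _ _ _ _ _ (fun=> 0)) ?Ex_cst//.
- by apply: bdd_norm; exact: bddB.
- exact: bdd_cst.
- by apply: filterS fg => x ->; rewrite subrr normr0.
Qed.

Lemma bitcode_pair n m (c1 : {ffun 'I_n -> bool} -> R) (c2 : {ffun 'I_m -> bool} -> R)
   (op : R -> R -> R) : exists c : {ffun 'I_(maxn n m) -> bool} -> R,
   forall x, op (c1 (bitcode n x)) (c2 (bitcode m x)) = c (bitcode _ x).
Proof.
exists (fun t => op (c1 (proj (leq_maxl n m) t)) (c2 (proj (leq_maxr n m) t))) => x.
by rewrite !proj_bitcode.
Qed.

Lemma approximableD f g : bdd f -> bdd g -> approximable f -> approximable g ->
  approximable (fun x => f x + g x).
Proof.
move=> bf bg af ag e e0; have e20 : 0 < e / 2 by rewrite divr_gt0.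
have [n [c1 fc]] := af _ e20; have [m [c2 gc]] := ag _ e20.
have [c cE] := bitcode_pair c1 c2 +%R.
exists (maxn n m), c; under eq_Ex do rewrite -cE.
rewrite [ltRHS]splitr (le_lt_trans _ (ltrD fc gc))// -ExD;
  try by apply: bdd_norm; apply: bddB => //; exact: bdd_bitcode.
apply: le_Ex; first by apply: bdd_norm; apply: bddB; apply: bddD => //; exact: bdd_bitcode.
  by apply: bddD; apply: bdd_norm; apply: bddB => //; exact: bdd_bitcode.
by move=> x; rewrite opprD addrACA ler_normD.
Qed.

Lemma approximableZ k f : bdd f -> approximable f -> approximable (fun x => k * f x).
Proof.
move=> bf af e e0; have k0 : 0 < `|k| + 1 by rewrite ltr_wpDl.
have [n [c fc]] := af _ (divr_gt0 e0 k0).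
exists n, (fun t => k * c t).
under eq_Ex do rewrite -mulrBr normrM.
rewrite ExZ; last by apply: bdd_norm; apply: bddB => //; exact: bdd_bitcode.
rewrite (@le_lt_trans _ _ ((`|k| + 1) * Ex (fun x => `|f x - c (bitcode n x)|)))//.
  by rewrite ler_wpM2r ?lerDl// Ex_ge0.
by rewrite mulrC -ltr_pdivlMr.
Qed.

Lemma norm_small_eq0 (r : R) : (forall e, 0 < e -> `|r| < e) -> r = 0.
Proof.
move=> H; apply/eqP; rewrite -normr_eq0 eq_le normr_ge0 andbT.
by apply/ler_addgt0Pl => e e0; rewrite addr0 ltW// H.
Qed.

Definition clip (M y : R) : R := Num.max (- M) (Num.min M y).

Lemma clip_dist (M y z : R) : `|y| <= M -> `|y - clip M z| <= `|y - z|.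
Proof.
rewrite /clip ler_norml => /andP[y1 y2].
rewrite /Num.max /Num.min /Order.max /Order.min.
case: (ltP M z) => Mz; case: ltP => Mz'; rewrite ?ler_norml; try lra.
all: have [|] := lerP 0 (y - z) => yz; rewrite ?(ger0_norm yz) ?(ltr0_norm yz); apply/andP; split; lra.
Qed.

Lemma norm_clip (M z : R) : 0 <= M -> `|clip M z| <= M.
Proof.
move=> M0; rewrite /clip ler_norml /Num.max /Num.min /Order.max /Order.min.
by case: (ltP M z) => Mz; case: ltP => Mz'; apply/andP; split; lra.
Qed.

(** Clipping an approximant to a range that contains the values of [f] only
    brings it closer to [f]. *)
Lemma approximable_clip f (M : R) : bdd f -> (forall x, `|f x| <= M) -> 0 <= M -> approximable f ->
  forall e : R, 0 < e -> exists n (c : {ffun 'I_n -> bool} -> R),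
    (forall t, `|c t| <= M) /\ Ex (fun x => `|f x - c (bitcode n x)|) < e.
Proof.
move=> bf fM M0 af e e0; have [n [c fc]] := af e e0.
exists n, (fun t => clip M (c t)); split; first by move=> t; exact: norm_clip.
rewrite (le_lt_trans _ fc)//; apply: le_Ex.
- by apply: bdd_norm; apply: bddB => //; exact: (bdd_bitcode (fun t => clip M (c t))).
- by apply: bdd_norm; apply: bddB => //; exact: bdd_bitcode.
by move=> x; exact: clip_dist.
Qed.

Lemma bddP f : bdd f -> exists2 M : R, 0 < M & forall x, `|f x| <= M.
Proof.
move=> [_ [M fM]]; exists (`|M| + 1); first by rewrite ltr_wpDl.
by move=> x; rewrite (le_trans (fM x))// (le_trans (ler_norm _))// lerDl.
Qed.

(** L^1 closeness does not pass to products in general; it does when one of the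
    approximants is bounded, hence the clipping of [c1]. *)
Lemma approximableM f g : bdd f -> bdd g -> approximable f -> approximable g ->
  approximable (fun x => f x * g x).
Proof.
move=> bf bg af ag e e0.
have [M M0 fM] := bddP bf; have [N N0 gN] := bddP bg.
have eM0 : 0 < e / 2 / M by rewrite !divr_gt0.
have eN0 : 0 < e / 2 / N by rewrite !divr_gt0.
have [n [c1 [c1M fc]]] := approximable_clip bf fM (ltW M0) af eN0.
have [m [c2 gc]] := ag _ eM0.
have [c cE] := bitcode_pair c1 c2 *%R.
exists (maxn n m), c; under eq_Ex do rewrite -cE.
have bfc : bdd (fun x => `|f x - c1 (bitcode n x)|).
  by apply: bdd_norm; apply: bddB => //; exact: bdd_bitcode.
have bgc : bdd (fun x => `|g x - c2 (bitcode m x)|).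
  by apply: bdd_norm; apply: bddB => //; exact: bdd_bitcode.
apply: (@le_lt_trans _ _ (N * Ex (fun x => `|f x - c1 (bitcode n x)|) +
                          M * Ex (fun x => `|g x - c2 (bitcode m x)|))); last first.
  rewrite [ltRHS]splitr ltrD//.
    by rewrite mulrC -ltr_pdivlMr.
  by rewrite mulrC -ltr_pdivlMr.
rewrite -!ExZ// -ExD; try exact: bddZ.
apply: le_Ex.
- by apply: bdd_norm; apply: bddB; apply: bddM => //; exact: bdd_bitcode.
- by apply: bddD; exact: bddZ.
move=> x; rewrite (_ : _ - _ = g x * (f x - c1 (bitcode n x)) + c1 (bitcode n x) * (g x - c2 (bitcode m x))); last ring.
by rewrite (le_trans (ler_normD _ _))// !normrM lerD// ler_wpM2r.
Qed.

End Bits.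
End Labels.

(** * Conditional expectation by martingale convergence *)

Section Martingale.
Context (R : realType) (dX : measure_display) (X : measurableType dX)
  (mu : probability X R).
Implicit Types f g h : X -> R.
Local Notation Ex := (Ex mu).

Lemma limn_sup_itv (u : nat -> R) (k : nat) (a c M : R) : (forall n, `|u n| <= M) ->
  (forall n, (k <= n)%N -> a <= u n <= c) -> a <= limn_sup u <= c.
Proof.
move=> uM uac.
have ub : has_ubound (range u) by exists M => _ [n _ <-]; have := uM n; rewrite ler_norml => /andP[].
have lb : has_lbound (range u) by exists (- M) => _ [n _ <-]; have := uM n; rewrite ler_norml => /andP[].
have -> : limn_sup u = inf (range (sups u)) by apply/cvg_lim => //; exact: cvg_sups_inf.
apply/andP; split.
  apply: lb_le_inf; first by exists (sups u 0), 0%N.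
  move=> _ [n _ <-]; have /andP[+ _] := uac (maxn n k) (leq_maxr _ _).
  move/le_trans; apply; apply: ub_le_sup; first exact: has_ubound_sdrop.
  by exists (maxn n k) => //=; rewrite leq_maxl.
apply: (@le_trans _ _ (sups u k)).
  apply: ge_inf; last by exists k.
  exists (- M) => _ [n _ <-]; apply: (@le_trans _ _ (u n)).
    by have := uM n; rewrite ler_norml => /andP[].
  by apply: ub_le_sup; [exact: has_ubound_sdrop|exists n => /=].
apply: ge_sup; first by exists (u k), k => /=.
by move=> _ [n /= kn <-]; have /andP[] := uac n kn.
Qed.

(** The limit is taken to be the pointwise upper limit, which exists and is
    bounded by [M] even where the sequence diverges.  The series of the
    increments bounds its distance to [u k], and integrates to a geometric
    series. *)
Lemma L1_limit (u : nat -> X -> R) (M : R) : (forall k, bdd (u k)) ->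
  (forall k x, `|u k x| <= M) ->
  (forall k, Ex (fun x => `|u k.+1 x - u k x|) <= 2^-1 ^+ k) ->
  exists g, [/\ bdd g, forall x, `|g x| <= M &
    forall k, Ex (fun x => `|g x - u k x|) <= 2 * 2^-1 ^+ k].
Proof.
move=> bu uM udist.
pose g x : R := limn_sup (u ^~ x).
have gM x : `|g x| <= M.
  rewrite ler_norml; apply: (@limn_sup_itv _ 0 _ _ M) => // n _.
  by rewrite -ler_norml.
have mg : measurable_fun setT g.
  apply: measurable_fun_limn_sup.
  - by move=> x _; exists M => _ [n _ <-]; have := uM n x; rewrite ler_norml => /andP[].
  - by move=> x _; exists (- M) => _ [n _ <-]; have := uM n x; rewrite ler_norml => /andP[].
  - by move=> n; have [] := bu n.
have bg : bdd g by split=> //; exists M.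
exists g; split=> // k.
(* the increments from [k] on *)
pose D j x : R := `|u (k + j).+1 x - u (k + j)%N x|.
have bD j : bdd (D j) by apply/bdd_norm/bddB.
have D0 j x : (0%E <= (D j x)%:E)%E by rewrite lee_fin /D normr_ge0.
have key x : ((`|g x - u k x|)%:E <= \sum_(0 <= j <oo) (D j x)%:E)%E.
  have [->|fin] := eqVneq (\sum_(0 <= j <oo) (D j x)%:E)%E +oo%E.
    by rewrite leey.
  set S := (\sum_(0 <= j <oo) (D j x)%:E)%E in fin *.
  have S0 : (0%E <= S)%E by apply: nneseries_ge0.
  have SE : S = (fine S)%:E by rewrite fineK// ge0_fin_numE// lt_neqAle fin leey.
  have H n : (k <= n)%N -> `|u n x - u k x| <= fine S.
    move=> kn; rewrite -lee_fin -SE.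
    apply: le_trans (@nneseries_lim_ge R (fun j => (D j x)%:E) xpredT 0 (n - k)%N (fun _ _ _ => D0 _ x)).
    rewrite sumEFin lee_fin -(telescope_sumr (u ^~ x) kn).
    rewrite -{1}(add0n k) big_addn (le_trans (ler_norm_sum _ _ _))//.
    by apply: ler_sum => i _; rewrite [(i + k)%N]addnC.
  rewrite SE lee_fin ler_distl; apply: (@limn_sup_itv _ k _ _ M) => // n kn.
  by rewrite -ler_distl H.
have step : ((Ex (fun x => `|g x - u k x|))%:E <= \sum_(0 <= j <oo) (Ex (D j))%:E)%E.
  rewrite /Ex /Rintegral fineK; last first.
    by apply: integrable_fin_num => //; apply: bdd_integrable; exact/bdd_norm/bddB.
  under eq_eseriesr => j _.
    rewrite fineK; last by apply: integrable_fin_num => //; exact: bdd_integrable.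
    over.
  rewrite -(@integral_nneseries _ _ _ mu setT measurableT (fun j x => (D j x)%:E))//; last first.
    by move=> n; apply/measurable_EFinP; have [] := bD n.
  apply: ge0_le_integral => //.
  - by apply/measurable_EFinP; have [] := bdd_norm (bddB bg (bu k)).
  - apply: ge0_emeasurable_sum => // n _.
    by apply/measurable_EFinP; have [] := bD n.
rewrite -lee_fin; apply: (le_trans step).
apply: (@le_trans _ _ (\sum_(0 <= j <oo) (2 * 2^-1 ^+ k / (2 ^ (j + 1))%:R : R)%:E)%E).
  apply: lee_nneseries => [j _ _|j _]; first by rewrite lee_fin Ex_ge0// => x; rewrite /D normr_ge0.
  rewrite lee_fin (le_trans (udist _))// exprD natrX addn1 exprS invfM mulrA.
  by rewrite [2 * _ / 2]mulrAC divff// mul1r !exprVn.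
have := @cvg_geometric_eseries_half R (2 * 2^-1 ^+ k) 0.
rewrite expr0 divr1 => /cvg_lim H.
by rewrite le_eqVlt; apply/orP; left; apply/eqP; exact: H.
Qed.

Section Projection.
Context (b : nat -> X -> bool).
Hypothesis mb : forall n, measurable [set x | b n x].
Variables (f : X -> R).
Hypothesis bf : bdd f.

Let fn n x : R := cexp mu (bitcode b n) f (bitcode b n x).
Let a n := Ex (fun x => fn n x ^+ 2).

Let bfn n : bdd (fn n).
Proof. exact: (bdd_bitcode mb (cexp mu (bitcode b n) f)). Qed.

Let Ex_fnM n m (c : {ffun 'I_n -> bool} -> R) : (n <= m)%N ->
  Ex (fun x => fn m x * c (bitcode b n x)) = Ex (fun x => f x * c (bitcode b n x)).
Proof.
move=> nm.
under eq_Ex do rewrite -(proj_bitcode _ nm).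
under [RHS]eq_Ex do rewrite -(proj_bitcode _ nm).
exact: (Ex_cexp mu (fun t => c (proj nm t)) (mlab_bitcode mb (n:=m)) bf).
Qed.

Let fn_sqr n m : (n <= m)%N ->
  Ex (fun x => (fn m x - fn n x) ^+ 2) = a m - a n.
Proof.
move=> nm.
have H1 : Ex (fun x => fn m x * fn n x) = a n.
  by rewrite (Ex_fnM (cexp mu (bitcode b n) f) nm) -(Ex_fnM _ (leqnn n)).
rewrite (@eq_Ex _ _ _ _ _ (fun x => fn m x ^+ 2 + (- 2 * (fn m x * fn n x) + fn n x ^+ 2))); last by move=> x; ring.
rewrite ExD; [|exact: bdd_sqr|by apply: bddD; [apply: bddZ; exact: bddM|exact: bdd_sqr]].
rewrite ExD; [|by apply: bddZ; exact: bddM|exact: bdd_sqr].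
rewrite ExZ; last exact: bddM.
by rewrite H1 -/(a n) -/(a m); move: (a n) (a m) => p q; ring.
Qed.

Let a_nd n m : (n <= m)%N -> a n <= a m.
Proof.
by move=> nm; rewrite -subr_ge0 -fn_sqr//; apply: Ex_ge0 => x; rewrite sqr_ge0.
Qed.

Let a_cauchy (e : R) : 0 < e -> exists n, forall m, (n <= m)%N -> a m - a n <= e.
Proof.
move=> e0; have [M M0 fM] := bddP bf.
have aM n : a n <= M ^+ 2.
  rewrite -(Ex_cst mu (M ^+ 2)); apply: le_Ex; [exact: bdd_sqr|exact: bdd_cst|].
  move=> x; rewrite -real_normK ?num_real// lerXn2r ?nnegrE//; last first.
    by apply: norm_cexp => //; [exact: mlab_bitcode|exact: ltW].
  exact: ltW.
have ca : cvgn a.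
  apply: nondecreasing_is_cvgn; first by move=> n m; exact: a_nd.
  by exists (M ^+ 2) => _ [n _ <-].
have /cvgrPdist_le/(_ _ e0) [n _ Hn] := ca.
exists n => m nm.
have am : a m <= limn a by apply: nondecreasing_cvgn_le => // i j; exact: a_nd.
have := Hn n (leqnn n) => /=; rewrite ger0_norm.
  by apply: le_trans; rewrite lerD2r.
by rewrite subr_ge0; apply: nondecreasing_cvgn_le => // i j; exact: a_nd.
Qed.

(** Conditional expectation on the sigma-algebra generated by the bits.  The
    averages [fn n] over the cells of the first [n] bits form a martingale:
    [fn_sqr] is Pythagoras, and [a] is nondecreasing and bounded.  A fast
    subsequence then converges by [L1_limit], and orthogonality to functions of
    finitely many bits passes to the limit. *)
Lemma projection : exists g, [/\ bdd g, approximable mu b g &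
  forall h, bdd h -> approximable mu b h -> Ex (fun x => (f x - g x) * h x) = 0].
Proof.
have [M M0 fM] := bddP bf.
(* along [N] the increments are at most [2^-1 ^+ k] in L^2, hence in L^1 *)
have /choice[N0 N0P] : forall k, exists n, forall m, (n <= m)%N -> a m - a n <= (2^-1 ^+ k) ^+ 2.
  by move=> k; apply: a_cauchy; rewrite exprn_gt0// exprn_gt0.
pose N k := (\sum_(j < k.+1) (N0 j).+1)%N.
have NS k : (N k <= N k.+1)%N by rewrite /N [in leqRHS]big_ord_recr leq_addr.
have N0N k : (N0 k <= N k)%N.
  by rewrite /N big_ord_recr/= (leq_trans (leqnSn _))// leq_addl.
have kN k : (k <= N k)%N.
  elim: k => [//|k ih].
  by rewrite /N big_ord_recr/= -/(N k) addnS ltnS (leq_trans ih)// leq_addr.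
have fM' n x : `|fn n x| <= M by apply: norm_cexp => //; [exact: mlab_bitcode|exact: ltW].
have [g [bg gM gd]] : exists g, [/\ bdd g, forall x, `|g x| <= M &
    forall k, Ex (fun x => `|g x - fn (N k) x|) <= 2 * 2^-1 ^+ k].
  apply: L1_limit => // k; apply: Ex_norm_le; [exact: bddB|exact: exprn_ge0|].
  rewrite fn_sqr//; apply: le_trans (N0P k (N k.+1) _).
    by apply: lerB; [exact: lexx|exact: a_nd].
  exact: leq_trans (NS k).
have small (e : R) : 0 < e -> exists k0, forall k, (k0 <= k)%N ->
    Ex (fun x => `|g x - fn (N k) x|) < e.
  move=> e0; have : geometric (2 : R) 2^-1 @ \oo --> (0 : R).
    by apply: cvg_geometric; rewrite ger0_norm// invf_lt1// ltr1n.
  move/cvgrPdist_lt => /(_ _ e0) [k0 _ Hk]; exists k0 => k kk.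
  rewrite (le_lt_trans (gd k))//; have := Hk k kk.
  by rewrite /= sub0r normrN ger0_norm// mulr_ge0.
exists g; split=> //.
  apply: approximable_closed => // e e0; have [k /(_ _ (leqnn _)) Hk] := small e e0.
  by exists (fn (N k)); split => //; exact: approximable_bitcode.
have ortho n (c : {ffun 'I_n -> bool} -> R) : Ex (fun x => (f x - g x) * c (bitcode b n x)) = 0.
  have bc := bdd_bitcode mb c; have [C C0 cC] := bddP bc.
  apply: norm_small_eq0 => e e0.
  have [k0 /(_ (maxn k0 n) (leq_maxl _ _))] := small _ (divr_gt0 e0 C0).
  set k := maxn k0 n => gk.
  have nk : (n <= N k)%N by rewrite (leq_trans _ (kN k))// leq_maxr.
  have -> : Ex (fun x => (f x - g x) * c (bitcode b n x)) =
            Ex (fun x => (fn (N k) x - g x) * c (bitcode b n x)).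
    under eq_Ex do rewrite mulrBl; under [RHS]eq_Ex do rewrite mulrBl.
    by rewrite !ExB; try exact: bddM; rewrite Ex_fnM.
  rewrite (le_lt_trans (le_norm_Ex _ _))//; first by apply: bddM => //; exact: bddB.
  apply: (@le_lt_trans _ _ (C * Ex (fun x => `|g x - fn (N k) x|))).
    rewrite -ExZ; last by apply: bdd_norm; exact: bddB.
    apply: le_Ex; first by apply: bdd_norm; apply: bddM => //; exact: bddB.
      by apply: bddZ; apply: bdd_norm; exact: bddB.
    by move=> x; rewrite normrM distrC mulrC ler_wpM2r.
  by rewrite mulrC -ltr_pdivlMr.
move=> h bh ah; apply: norm_small_eq0 => e e0.
have M20 : 0 < 2 * M by rewrite mulr_gt0.
have [n [c hc]] := ah _ (divr_gt0 e0 M20).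
have bc := bdd_bitcode mb c.
have -> : Ex (fun x => (f x - g x) * h x) = Ex (fun x => (f x - g x) * (h x - c (bitcode b n x))).
  under [RHS]eq_Ex do rewrite mulrBr.
  rewrite ExB; [|by apply: bddM => //; exact: bddB|by apply: bddM => //; exact: bddB].
  by rewrite ortho subr0.
have bfg := bddB bf bg; have bhc := bddB bh bc.
rewrite (le_lt_trans (le_norm_Ex _ _))//; first exact: bddM.
apply: (@le_lt_trans _ _ (2 * M * Ex (fun x => `|h x - c (bitcode b n x)|))).
  rewrite -ExZ; last exact: bdd_norm.
  apply: le_Ex; [by apply: bdd_norm; exact: bddM|by apply: bddZ; exact: bdd_norm|].
  move=> x; rewrite normrM ler_wpM2r// (le_trans (ler_normB _ _))//.
  by rewrite mulr2n mulrDl mul1r lerD.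
by rewrite mulrC -ltr_pdivlMr.
Qed.

End Projection.
End Martingale.

(** * The von Neumann algebra of the functions approximable by bits *)

Section ComplexParts.
Context (R : realType).
Implicit Types z w : R[i].
Local Notation Re := (@complex.Re R).
Local Notation Im := (@complex.Im R).

Lemma complex_eqP z w : Re z = Re w -> Im z = Im w -> z = w.
Proof. by case: z w => a b [c d] /= -> ->. Qed.
Lemma ReD z w : Re (z + w) = Re z + Re w. Proof. by case: z w => a b []. Qed.
Lemma ImD z w : Im (z + w) = Im z + Im w. Proof. by case: z w => a b []. Qed.
Lemma ReN z : Re (- z) = - Re z. Proof. by case: z. Qed.
Lemma ImN z : Im (- z) = - Im z. Proof. by case: z. Qed.
Lemma ReM z w : Re (z * w) = Re z * Re w - Im z * Im w. Proof. by case: z w => a b []. Qed.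
Lemma ImM z w : Im (z * w) = Re z * Im w + Im z * Re w. Proof. by case: z w => a b []. Qed.

Lemma real_complexE (a : R) : real_complex R a = Complex a 0. Proof. by []. Qed.

Lemma Re_le_normc z : `|Re z| <= Normc.normc z.
Proof.
case: z => a b /=; rewrite -sqrtr_sqr ler_wsqrtr// lerDl sqr_ge0//.
Qed.

Lemma Im_le_normc z : `|Im z| <= Normc.normc z.
Proof.
case: z => a b /=; rewrite -sqrtr_sqr ler_wsqrtr// lerDr sqr_ge0//.
Qed.

Lemma normc_real (a : R) : Normc.normc (Complex a 0) = `|a|.
Proof. by rewrite /= expr0n/= addr0 sqrtr_sqr. Qed.

End ComplexParts.

Section Essential.
Context (R : realType) (dX : measure_display) (X : measurableType dX)
  (mu : probability X R).
Local Notation Re := (@complex.Re R).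
Local Notation Im := (@complex.Im R).
Local Notation Ex := (Ex mu).
Implicit Types (f : X -> R) (z : X -> R[i]).

Lemma LfunP f : f \in Lfun mu +oo%E <->
  measurable_fun setT f /\ exists M : R, {ae mu, forall x, `|f x| <= M}.
Proof.
have mu0 : (0 < mu setT)%E by rewrite probability_setT.
split=> [|[mf [M fM]]].
  rewrite inE => /andP[]; rewrite !inE/= => mf.
  rewrite /finite_norm unlock mu0 => fin; split=> //.
  have : (0 <= ess_sup mu (abse \o (EFin \o f)))%E.
    by apply: ess_sup_gee => //; apply: aeW => t; rewrite /= lee_fin.
  move: fin; set s := ess_sup _ _; case sE : s => [r| |]// _ _.
  exists r; have /ess_supP : (ess_sup mu (abse \o (EFin \o f)) <= r%:E)%E by rewrite -/s sE.
  by apply: filterS => x /=; rewrite lee_fin.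
rewrite inE; apply/andP; split; rewrite !inE//= /finite_norm unlock mu0.
apply: (@le_lt_trans _ _ M%:E); last exact: ltry.
by apply/ess_supP; apply: filterS fM => x /=; rewrite lee_fin.
Qed.

Lemma Lnorm_le1 f : ('N[mu]_+oo[EFin \o f] <= 1)%E <-> {ae mu, forall x, `|f x| <= 1}.
Proof.
have mu0 : (0 < mu setT)%E by rewrite probability_setT.
rewrite unlock mu0; split => [/ess_supP|H]; last apply/ess_supP.
  by apply: filterS => x /=; rewrite lee_fin.
by apply: filterS H => x /=; rewrite lee_fin.
Qed.

Lemma bdd_Lfun f : bdd f -> f \in Lfun mu +oo%E.
Proof. by move=> [mf [M fM]]; apply/LfunP; split => //; exists M; apply: aeW. Qed.

Lemma Lfun_bdd f : f \in Lfun mu +oo%E -> exists2 g, bdd g & {ae mu, forall x, f x = g x}.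
Proof.
move=> /LfunP[mf [M fM]].
exists (fun x => clip (`|M|) (f x)).
  split; last by exists `|M| => x; exact: norm_clip.
  by apply: measurable_maxr => //; apply: measurable_minr.
apply: filterS fM => x fM; apply/eqP; rewrite -subr_eq0 -normr_le0.
rewrite (le_trans (clip_dist _ _)) ?subrr ?normr0//.
by rewrite (le_trans fM)// ler_norm.
Qed.

Lemma bdd_Linfty f g : bdd f -> bdd g -> Linfty mu (fun x => Complex (f x) (g x)).
Proof. by move=> bf bg; split; exact: bdd_Lfun. Qed.

Lemma bdd_cplx f : bdd f -> Linfty mu (cplx f).
Proof. by move=> bf; apply: bdd_Linfty => //; exact: bdd_cst. Qed.

Lemma Linfty_bdd z : Linfty mu z ->
  exists f g, [/\ bdd f, bdd g & {ae mu, forall x, z x = Complex (f x) (g x)}].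
Proof.
move=> [/Lfun_bdd[f bf zf] /Lfun_bdd[g bg zg]]; exists f, g; split => //.
by apply: filterS2 zf zg => x /= <- <-; case: (z x).
Qed.

Lemma Linfty_ae z w : Linfty mu z -> measurable_fun setT (Re \o w) ->
  measurable_fun setT (Im \o w) -> {ae mu, forall x, z x = w x} -> Linfty mu w.
Proof.
move=> [/LfunP[_ [M zM]] /LfunP[_ [N zN]]] mr mi zw; split; apply/LfunP; split => //.
  by exists M; apply: filterS2 zM zw => x /= zx <-.
by exists N; apply: filterS2 zN zw => x /= zx <-.
Qed.

Lemma Linfty_meas z : Linfty mu z ->
  measurable_fun setT (Re \o z) /\ measurable_fun setT (Im \o z).
Proof. by move=> [/LfunP[? _] /LfunP[? _]]. Qed.

Lemma bdd_Lone f : bdd f -> Lone mu (cplx f).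
Proof.
move=> bf; split.
  by apply/Lfun1_integrable; exact: bdd_integrable.
by apply/Lfun1_integrable; exact: bdd_integrable (bdd_cst _ _).
Qed.

Lemma Rint_ae f g : measurable_fun setT f -> bdd g -> {ae mu, forall x, f x = g x} ->
  \int[mu]_x f x = Ex g.
Proof.
move=> mf [mg _] fg; congr fine; apply: ae_eq_integral => //.
- exact/measurable_EFinP.
- exact/measurable_EFinP.
- by apply: filterS fg => x /= ->.
Qed.

Section Approximable.
Context (b : nat -> X -> bool).
Hypothesis mb : forall n, measurable [set x | b n x].

Definition approximable_complex : set (X -> R[i]) :=
  [set z | Linfty mu z /\ exists f g, [/\ bdd f, bdd g,
     approximable mu b f, approximable mu b g &
     {ae mu, forall x, z x = Complex (f x) (g x)}]].

Lemma approximable_cst (c : R) : approximable mu b (fun=> c).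
Proof. exact: (approximable_bitcode mu b (n:=0) (fun=> c)). Qed.

Lemma approximableB f g : bdd f -> bdd g -> approximable mu b f -> approximable mu b g ->
  approximable mu b (fun x => f x - g x).
Proof.
move=> bf bg af ag.
have -> : (fun x => f x - g x) = (fun x => f x + (-1) * g x).
  by apply/funext => x; rewrite mulN1r.
by apply: approximableD => //; [exact: bddZ|exact: approximableZ].
Qed.

(** Weak closure adds nothing.  Test against [h := f - g] with [g] the projection
    of [f]: as [f - g] is orthogonal to [a - g], the hypothesis makes
    [Ex (fun x => (f x - g x) ^+ 2)] smaller than any [e]. *)
Lemma approximable_weak f : bdd f ->
  (forall h (e : R), bdd h -> 0 < e -> exists a, [/\ bdd a, approximable mu b a &
    `|Ex (fun x => (f x - a x) * h x)| < e]) -> approximable mu b f.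
Proof.
move=> bf H; have [g [bg ag gP]] := projection mu mb bf.
have bfg := bddB bf bg.
have E0 : Ex (fun x => (f x - g x) ^+ 2) = 0.
  apply: norm_small_eq0 => e e0.
  have [a [ba aa ae]] := H (fun x => f x - g x) e bfg e0.
  rewrite (_ : Ex _ = Ex (fun x => (f x - a x) * (f x - g x))) //.
  rewrite (@eq_Ex _ _ _ _ _ (fun x => (f x - a x) * (f x - g x) +
    (f x - g x) * (a x - g x))); last by move=> x; ring.
  rewrite ExD; [|by apply: bddM => //; exact: bddB|by apply: bddM => //; exact: bddB].
  rewrite gP ?addr0//; first exact: bddB.
  exact: approximableB.
apply: approximable_closed => // e e0; exists g; split=> //.
by apply: (@le_lt_trans _ _ 0) => //; apply: Ex_norm_le => //; rewrite E0 expr0n.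
Qed.

(** The use of approximability: being a von Neumann algebra, the approximable
    functions are all of [Linfty] as soon as they are invariant and contain a
    generating family.  Closedness is [approximable_weak] for the real and
    imaginary parts; the other axioms are the closure lemmas above. *)
Lemma approximable_vN : von_neumann_subalgebra mu approximable_complex.
Proof.
split.
- by move=> z [].
- move=> z w [_ [f [g [bf bg af ag zfg]]]] Lw zw; split=> //; exists f, g; split => //.
  by apply: filterS2 zfg zw => x -> <-.
- split; first exact: (bdd_Linfty (bdd_cst _ 1) (bdd_cst _ 0)).
  exists (fun=> 1), (fun=> 0); split; try exact: bdd_cst; try exact: approximable_cst.
  by apply: aeW.
split.
- move=> c z w [Lz [f [g [bf bg af ag zfg]]]] [Lw [f' [g' [bf' bg' af' ag' wfg]]]].
  pose F x := Re c * f x - Im c * g x + f' x.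
  pose G x := Re c * g x + Im c * f x + g' x.
  have bF : bdd F by apply: bddD => //; apply: bddB; apply: bddZ.
  have bG : bdd G by apply: bddD => //; apply: bddD; apply: bddZ.
  have cwE : {ae mu, forall x, c * z x + w x = Complex (F x) (G x)}.
    apply: filterS2 zfg wfg => x -> ->; apply: complex_eqP.
      by rewrite ReD ReM.
    by rewrite ImD ImM.
  have [mz1 mz2] := Linfty_meas Lz; have [mw1 mw2] := Linfty_meas Lw.
  split.
    apply: (Linfty_ae (bdd_Linfty bF bG)); last by apply: filterS cwE.
      rewrite (_ : _ \o _ = fun x => Re c * (Re \o z) x - Im c * (Im \o z) x + (Re \o w) x).
        apply: measurable_funD => //; apply: measurable_funB; exact: measurable_funM.
      by apply/funext => x /=; rewrite ReD ReM.
    rewrite (_ : _ \o _ = fun x => Re c * (Im \o z) x + Im c * (Re \o z) x + (Im \o w) x).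
      apply: measurable_funD => //; apply: measurable_funD; exact: measurable_funM.
    by apply/funext => x /=; rewrite ImD ImM.
  exists F, G; split=> //.
    apply: approximableD => //; first by apply: bddB; exact: bddZ.
    by apply: approximableB; [exact: bddZ|exact: bddZ|exact: approximableZ|exact: approximableZ].
  apply: approximableD => //; first by apply: bddD; exact: bddZ.
  by apply: approximableD => //; [exact: bddZ|exact: bddZ|exact: approximableZ|exact: approximableZ].
- move=> z w [Lz [f [g [bf bg af ag zfg]]]] [Lw [f' [g' [bf' bg' af' ag' wfg]]]].
  pose F x := f x * f' x - g x * g' x.
  pose G x := f x * g' x + g x * f' x.
  have bF : bdd F by apply: bddB; apply: bddM.
  have bG : bdd G by apply: bddD; apply: bddM.
  have cwE : {ae mu, forall x, z x * w x = Complex (F x) (G x)}.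
    apply: filterS2 zfg wfg => x -> ->; apply: complex_eqP; first by rewrite ReM.
    by rewrite ImM.
  have [mz1 mz2] := Linfty_meas Lz; have [mw1 mw2] := Linfty_meas Lw.
  split.
    apply: (Linfty_ae (bdd_Linfty bF bG)); last by apply: filterS cwE.
      rewrite (_ : _ \o _ = fun x => (Re \o z) x * (Re \o w) x - (Im \o z) x * (Im \o w) x).
        by apply: measurable_funB; exact: measurable_funM.
      by apply/funext => x /=; rewrite ReM.
    rewrite (_ : _ \o _ = fun x => (Re \o z) x * (Im \o w) x + (Im \o z) x * (Re \o w) x).
      by apply: measurable_funD; exact: measurable_funM.
    by apply/funext => x /=; rewrite ImM.
  exists F, G; split=> //.
    by apply: approximableB; [exact: bddM|exact: bddM|exact: approximableM|exact: approximableM].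
  by apply: approximableD => //; [exact: bddM|exact: bddM|exact: approximableM|exact: approximableM].
- move=> z [Lz [f [g [bf bg af ag zfg]]]].
  have [mz1 mz2] := Linfty_meas Lz.
  have zE : {ae mu, forall x, (z x)^*%C = Complex (f x) (-1 * g x)}.
    by apply: filterS zfg => x ->; rewrite /= mulN1r.
  have bg' : bdd (fun x => -1 * g x) by exact: bddZ.
  split.
    apply: (Linfty_ae (bdd_Linfty bf bg')); last by apply: filterS zE.
      by rewrite (_ : _ \o _ = Re \o z)//; apply/funext => x /=; case: (z x).
    rewrite (_ : _ \o _ = fun x => - (Im \o z) x); first exact: measurable_funN.
    by apply/funext => x /=; case: (z x).
  by exists f, (fun x => -1 * g x); split => //; exact: approximableZ.
- move=> z Lz H; split=> //; have [f [g [bf bg zfg]]] := Linfty_bdd Lz.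
  exists f, g; split=> //; apply: approximable_weak => // h e bh e0.
    have [] := H 1%N (fun=> cplx h) e _ e0; first by move=> _; exact: bdd_Lone.
    move=> w [Lw [f' [g' [bf' bg' af' ag' wfg]]]] /(_ ord0) Hw.
    exists f'; split=> //; apply: le_lt_trans Hw.
    apply: le_trans (Re_le_normc _) => /=.
    rewrite (Rint_ae (g := fun x => (f x - f' x) * h x))//.
    + have [mz1 mz2] := Linfty_meas Lz; have [mw1 mw2] := Linfty_meas Lw.
      rewrite (_ : (fun _ => _) = fun x => ((Re \o z) x - (Re \o w) x) * h x).
        by apply: measurable_funM; [exact: measurable_funB|case: bh].
      by apply/funext => x /=; rewrite ReM ReD ReN/= mulr0 subr0.
    + by apply: bddM => //; exact: bddB.
    + apply: filterS2 zfg wfg => x -> ->.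
      by rewrite ReM ReD ReN/= mulr0 subr0.
  have [] := H 1%N (fun=> cplx h) e _ e0; first by move=> _; exact: bdd_Lone.
  move=> w [Lw [f' [g' [bf' bg' af' ag' wfg]]]] /(_ ord0) Hw.
  exists g'; split=> //; apply: le_lt_trans Hw.
  apply: le_trans (Im_le_normc _) => /=.
  rewrite (Rint_ae (g := fun x => (g x - g' x) * h x))//.
  + have [mz1 mz2] := Linfty_meas Lz; have [mw1 mw2] := Linfty_meas Lw.
    rewrite (_ : (fun _ => _) = fun x => ((Im \o z) x - (Im \o w) x) * h x).
      by apply: measurable_funM; [exact: measurable_funB|case: bh].
    by apply/funext => x /=; rewrite ImM ImD ImN/= mulr0 add0r.
  + by apply: bddM => //; exact: bddB.
  + apply: filterS2 zfg wfg => x -> ->.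
    by rewrite ImM ImD ImN/= mulr0 add0r.
Qed.

End Approximable.
End Essential.

(** * Measure-preserving actions and generating families *)

Definition code_pair (j : nat) : nat * nat := odflt (0, 0)%N (@choice.unpickle (nat * nat)%type j).
Definition pair_code (p : nat * nat) : nat := @choice.pickle (nat * nat)%type p.
Lemma pair_codeK : cancel pair_code code_pair.
Proof. by move=> p; rewrite /code_pair /pair_code choice.pickleK. Qed.

Section Action.
Context (R : realType) (G : groupType) (dX : measure_display)
  (X : measurableType dX) (mu : probability X R) (act : G -> X -> X).
Hypothesis act_pmp : pmp_action mu act.
Local Notation Ex := (Ex mu).
Implicit Types (f : X -> R) (z : X -> R[i]).

Lemma act1 x : act 1%g x = x. Proof. by case: act_pmp. Qed.
Lemma actM s t x : act (s * t)%g x = act s (act t x). Proof. by case: act_pmp. Qed.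
Lemma actVM s t x : act (s * t)^-1%g x = act t^-1%g (act s^-1%g x).
Proof. by rewrite invgM actM. Qed.
Lemma measurable_act s : measurable_fun setT (act s). Proof. by case: act_pmp. Qed.

Lemma bdd_act s f : bdd f -> bdd (fun x => f (act s x)).
Proof.
move=> [mf [M fM]]; split; last by exists M.
by apply: (measurableT_comp mf); exact: measurable_act.
Qed.

Lemma Ex_act s f : bdd f -> Ex (fun x => f (act s x)) = Ex f.
Proof.
move=> bf; congr fine.
have ms := measurable_act s.
have := @integral_pushforward _ _ _ _ R (act s) ms mu setT (EFin \o f).
rewrite preimage_setT.
have mf : measurable_fun setT (EFin \o f) by apply/measurable_EFinP; case: bf.
move=> /(_ mf (bdd_integrable _ (bdd_act s bf)) measurableT) <-.
apply: eq_measure_integral => /= A mA _.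
by rewrite /pushforward; case: act_pmp => _ _ _ ->.
Qed.

Lemma ae_act s (P : X -> Prop) : {ae mu, forall x, P x} -> {ae mu, forall x, P (act s x)}.
Proof.
move=> [A [mA A0 PA]]; exists (act s @^-1` A); split.
- by rewrite -[_ @^-1` _]setTI; exact: measurable_act.
- by case: act_pmp => _ _ _ ->.
- by move=> x /= nP; apply: PA.
Qed.

Lemma Linfty_act s z : Linfty mu z -> Linfty mu (fun x => z (act s x)).
Proof.
move=> [/LfunP[mr [M zM]] /LfunP[mi [N zN]]]; split; apply/LfunP; split.
- by apply: (measurableT_comp mr); exact: measurable_act.
- by exists M; exact: ae_act s _ zM.
- by apply: (measurableT_comp mi); exact: measurable_act.
- by exists N; exact: ae_act s _ zN.
Qed.

Section Generation.
Context (b : nat -> X -> bool).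
Hypothesis mb : forall n, measurable [set x | b n x].
Hypothesis b_act : forall s n, exists m, forall x, b n (act s x) = b m x.

Lemma approximable_act s f : bdd f -> approximable mu b f ->
  approximable mu b (fun x => f (act s x)).
Proof.
move=> bf af e e0; have [n [c fc]] := af e e0.
have /choice[m mP] := b_act s.
pose k := (\max_(i < n) m i).+1.
pose c' (t : {ffun 'I_k -> bool}) := c [ffun i : 'I_n => t (inord (m i))].
exists k, c'.
have -> : (fun x => `|f (act s x) - c' (bitcode b k x)|) =
          (fun x => `|f (act s x) - c (bitcode b n (act s x))|).
  apply/funext => x; congr (`|_ - c _|); apply/ffunP => i; rewrite !ffunE mP.
  by rewrite inordK// ltnS (@leq_bigmax _ (fun i : 'I_n => m i)).
rewrite (@Ex_act s (fun x => `|f x - c (bitcode b n x)|))//.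
by apply: bdd_norm; apply: bddB => //; exact: bdd_bitcode.
Qed.

Lemma generating_approximable (S : set (X -> R[i])) :
  dynamically_generating mu act S -> S `<=` approximable_complex mu b ->
  forall f, bdd f -> approximable mu b f.
Proof.
move=> Sgen SA f bf.
have inv : invariant act (approximable_complex mu b).
  move=> s z [Lz [g [h [bg bh ag ah zgh]]]]; split; first exact: Linfty_act.
  exists (fun x => g (act s^-1%g x)), (fun x => h (act s^-1%g x)).
  split; try exact: bdd_act; try exact: approximable_act.
  exact: ae_act s^-1%g _ zgh.
have := bdd_cplx mu bf; rewrite -(Sgen _ (approximable_vN mu mb) inv SA).
move=> [_ [g [h [bg bh ag ah fgh]]]]; apply: approximable_ae ag => //.
by apply: filterS fgh => x [].
Qed.

End Generation.

Section TranslatedBits.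
Context (e : nat -> G) (e_surj : forall s, exists n, e n = s).
Context (b0 : nat -> X -> bool) (mb0 : forall n, measurable [set x | b0 n x]).

(** Bit number [pair_code (i, k)] is [b0 k] after translation by [e i].  Listing
    all translates makes the family of bits invariant under the action. *)
Definition tbit (j : nat) (x : X) : bool :=
  b0 (code_pair j).2 (act (e (code_pair j).1)^-1%g x).

Lemma tbitE i k x : tbit (pair_code (i, k)) x = b0 k (act (e i)^-1%g x).
Proof. by rewrite /tbit pair_codeK. Qed.

Lemma measurable_tbit j : measurable [set x | tbit j x].
Proof.
have := @measurable_act (e (code_pair j).1)^-1%g measurableT _ (mb0 (code_pair j).2).
by rewrite setTI.
Qed.

Lemma tbit_act s j : exists m, forall x, tbit j (act s x) = tbit m x.
Proof.
have [i ei] := e_surj (s^-1 * e (code_pair j).1)%g.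
by exists (pair_code (i, (code_pair j).2)) => x; rewrite tbitE ei actVM invgK.
Qed.

End TranslatedBits.
End Action.

(** * Names of points, and polynomials in the translates of a sequence *)

Section BitHelper.
Context (R : realType) (dX : measure_display) (X : measurableType dX)
  (mu : probability X R) (b : nat -> X -> bool).

Lemma approximable_bit j : approximable mu b (fun x => (b j x)%:R : R).
Proof.
have := @approximable_bitcode R _ X mu b j.+1 (fun t => (t ord_max)%:R).
by congr approximable; apply/funext => x; rewrite ffunE.
Qed.

Lemma approximable_sum (I : Type) (r : seq I) (F : I -> X -> R) :
  (forall n, measurable [set x | b n x]) ->
  (forall i, bdd (F i)) -> (forall i, approximable mu b (F i)) ->
  approximable mu b (fun x => \sum_(i <- r) F i x).
Proof.
move=> mb bF aF; elim: r => [|i r ih].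
  have := @approximable_cst R _ X mu b 0.
  by congr approximable; apply/funext => x; rewrite big_nil.
have bs : bdd (fun x => \sum_(j <- r) F j x) by exact: bdd_sum.
have := @approximableD _ _ _ _ _ mb _ _ (bF i) bs (aF i) ih.
by congr approximable; apply/funext => x; rewrite big_cons.
Qed.

End BitHelper.

Section Names.
Context (R : realType) (G : groupType) (dX : measure_display)
  (X : measurableType dX) (mu : probability X R) (act : G -> X -> X).
Hypothesis act_pmp : pmp_action mu act.
Context (e : nat -> G) (e_surj : forall s, exists n, e n = s).
Context (P : nat -> set X) (genP : generating_partition mu act P).
Context (L : X -> nat) (PL : forall n x, P n x <-> L x = n).
Local Notation Ex := (Ex mu).

(** The label of [x] when the labels from [N] on are merged into one; [inord] is
    applied to a number that is at most [N]. *)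
Definition lab (N : nat) (x : X) : 'I_N.+1 := inord (minn (L x) N).

Lemma labE N x : lab N x = minn (L x) N :> nat.
Proof. by rewrite inordK// ltnS geq_minr. Qed.

Lemma measurable_P n : measurable (P n).
Proof. by case: genP => -[]. Qed.

Lemma mlab_lab N : mlab (lab N).
Proof.
move=> t; rewrite (_ : [set _ | _] =
    \bigcup_(k in [set k | minn k N == t]) P k).
  by apply: bigcup_measurable => k _; exact: measurable_P.
apply/seteqP; split => [x /= /eqP <-|x [k /= /eqP kt /PL Lx]].
  by exists (L x) => /=; [rewrite labE|exact/PL].
by apply/eqP/val_inj; rewrite /= labE Lx kt.
Qed.

Lemma mlab_act (T : finType) (l : X -> T) s : mlab l -> mlab (fun x => l (act s x)).
Proof.
move=> ml t; have := @measurable_act _ _ _ _ _ _ act_pmp s measurableT _ (ml t).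
by rewrite setTI.
Qed.

(** The itinerary of [x] along [F].  With the inverse, the set of the points of
    name [t] is the intersection of the translates [act s @` P (t s)]. *)
Definition name (F : {fset G}) (N : nat) (x : X) : {ffun F -> 'I_N.+1} :=
  [ffun s => lab N (act (val s)^-1%g x)].

Lemma mlab_name F N : mlab (name F N).
Proof. by apply: mlab_ffun => s; apply: mlab_act; exact: mlab_lab. Qed.

Let b0 (n : nat) (x : X) := L x == n.

Let mb0 n : measurable [set x | b0 n x].
Proof.
rewrite (_ : [set _ | _] = P n); first exact: measurable_P.
by apply/seteqP; split => x /=; [move/eqP/PL|move/PL/eqP].
Qed.

Let b := tbit act e b0.

Lemma partition_approximable f : bdd f -> approximable mu b f.
Proof.
have mb := measurable_tbit act_pmp e mb0.
have [i1 ei1] := e_surj 1%g.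
apply: (generating_approximable act_pmp mb (tbit_act act_pmp e_surj b0) genP.2).
move=> _ [n _ <-].
have bn : bdd (fun x => (b (pair_code (i1, n)) x)%:R : R) by exact: bdd_bool.
split.
  apply: bdd_cplx; split; first by apply: measurable_indic; exact: measurable_P.
  by exists 1 => x; rewrite indicE; case: (_ \in _); rewrite ?normr1 ?normr0.
exists (fun x => (b (pair_code (i1, n)) x)%:R), (fun=> 0); split => //.
- exact: bdd_cst.
- exact: approximable_bit.
- exact: approximable_cst.
apply: aeW => x; rewrite /cplx real_complexE /b tbitE ei1 invg1 (act1 act_pmp).
congr Complex; rewrite indicE; congr (nat_of_bool _)%:R; rewrite /b0.
by apply/idP/eqP => [/set_mem /PL //|Lx]; apply/mem_set/PL.
Qed.

(** The finitely many bits that approximate [f] are functions of the name of [x]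
    along [F], once [F] contains the translations that occur in them and [N]
    exceeds the labels that they test. *)
Lemma name_approx f (M : R) (eps : R) : bdd f -> (forall x, `|f x| <= M) -> 0 <= M ->
  0 < eps -> exists (F0 : {fset G}) (N0 : nat), forall (F : {fset G}) N,
    (F0 `<=` F)%fset -> (N0 <= N)%N ->
    exists c : {ffun F -> 'I_N.+1} -> R, (forall t, `|c t| <= M) /\
      Ex (fun x => `|f x - c (name F N x)|) < eps.
Proof.
move=> bf fM M0 eps0.
have [n [c [cM fc]]] := approximable_clip (measurable_tbit act_pmp e mb0) bf fM M0
  (partition_approximable bf) eps0.
pose F0 : {fset G} := [fset s in [seq e (code_pair j).1 | j <- iota 0 n]]%fset.
pose N0 := (\max_(j < n) (code_pair j).2).+1.
exists F0, N0 => F N F0F N0N.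
have inF (j : 'I_n) : e (code_pair j).1 \in F.
  move/fsubsetP: F0F; apply; rewrite inE; apply/mapP; exists (val j) => //.
  by rewrite mem_iota/= add0n.
pose Phi (t : {ffun F -> 'I_N.+1}) : {ffun 'I_n -> bool} :=
  [ffun j : 'I_n => t [` inF j]%fset == (code_pair j).2 :> nat].
exists (fun t => c (Phi t)); split=> //.
rewrite (@eq_Ex _ _ _ mu _ (fun x => `|f x - c (bitcode b n x)|))// => x.
congr (`|_ - c _|); apply/ffunP => j; rewrite !ffunE /b /tbit /b0 labE/=.
have jN : ((code_pair j).2 < N)%N.
  by rewrite (leq_trans _ N0N)// ltnS (@leq_bigmax _ (fun j : 'I_n => (code_pair j).2)).
by rewrite /minn; case: ltnP => // NL; rewrite !gtn_eqF// (leq_trans jN).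
Qed.

End Names.

Section Polynomials.
Context (R : realType) (G : groupType) (dX : measure_display)
  (X : measurableType dX) (mu : probability X R) (act : G -> X -> X).
Hypothesis act_pmp : pmp_action mu act.
Context (S : nat -> X -> R) (mS : forall n, measurable_fun setT (S n))
  (S1 : forall n x, `|S n x| <= 1).
Local Notation Ex := (Ex mu).

(** Formal polynomials in the translates of [S]: a monomial is the list of the
    pairs [(s, n)] of its factors [S n] translated by [s].  Kept formal, the same
    polynomial can be evaluated on [X] and on the finite set ['I_d]. *)
Definition tmono : Type := seq (G * nat).
Definition tpoly : Type := seq (R * tmono).

Definition mev (l : tmono) (x : X) : R := \prod_(p <- l) S p.2 (act p.1^-1%g x).
Definition pev (q : tpoly) (x : X) : R := \sum_(p <- q) p.1 * mev p.2 x.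

Definition pmul (q r : tpoly) : tpoly :=
  [seq (p.1 * p'.1, p.2 ++ p'.2) | p <- q, p' <- r].
Definition pscale (c : R) (q : tpoly) : tpoly := [seq (c * p.1, p.2) | p <- q].
Definition ptrans (s : G) (q : tpoly) : tpoly :=
  [seq (p.1, [seq ((s * g.1)%g, g.2) | g <- p.2]) | p <- q].

Lemma mev_cat l l' x : mev (l ++ l') x = mev l x * mev l' x.
Proof. by rewrite /mev big_cat. Qed.
Lemma pev_add q r x : pev (q ++ r) x = pev q x + pev r x.
Proof. by rewrite /pev big_cat. Qed.
Lemma pev_mul q r x : pev (pmul q r) x = pev q x * pev r x.
Proof.
rewrite /pev /pmul big_flatten big_map mulr_suml; apply: eq_bigr => p _.
rewrite big_map mulr_sumr; apply: eq_bigr => p' _.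
by rewrite mev_cat mulrACA.
Qed.
Lemma pev_scale c q x : pev (pscale c q) x = c * pev q x.
Proof. by rewrite /pev big_map mulr_sumr; apply: eq_bigr => p _; rewrite mulrA. Qed.
Lemma pev_trans s q x : pev (ptrans s q) x = pev q (act s^-1%g x).
Proof.
rewrite /pev big_map; apply: eq_bigr => p _; rewrite /mev big_map/=.
by congr (_ * _); apply: eq_bigr => g _; rewrite /= (actVM act_pmp).
Qed.

Lemma bdd_S n : bdd (S n). Proof. by split => //; exists 1. Qed.
Lemma bdd_mev l : bdd (mev l).
Proof. by apply: bdd_prod => p _; apply: (bdd_act act_pmp) (bdd_S _). Qed.
Lemma bdd_pev q : bdd (pev q).
Proof. by apply: bdd_sum => p _; apply: bddZ; exact: bdd_mev. Qed.
Lemma mev_le1 l x : `|mev l x| <= 1.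
Proof. by rewrite /mev normr_prod prodr_ile1// => p _; rewrite normr_ge0 S1. Qed.

Definition ispoly (f : X -> R) := exists q, forall x, f x = pev q x.

Lemma ispoly_cst c : ispoly (fun=> c).
Proof. by exists [:: (c, [::])] => x; rewrite /pev big_seq1 /mev big_nil mulr1. Qed.
Lemma ispolyD f g : ispoly f -> ispoly g -> ispoly (fun x => f x + g x).
Proof. by move=> [q fq] [r gr]; exists (q ++ r) => x; rewrite pev_add fq gr. Qed.
Lemma ispolyM f g : ispoly f -> ispoly g -> ispoly (fun x => f x * g x).
Proof. by move=> [q fq] [r gr]; exists (pmul q r) => x; rewrite pev_mul fq gr. Qed.
Lemma ispolyB f g : ispoly f -> ispoly g -> ispoly (fun x => f x - g x).
Proof.
move=> pf pg; have := ispolyD pf (ispolyM (ispoly_cst (-1)) pg).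
by congr ispoly; apply/funext => x; rewrite mulN1r.
Qed.
Lemma ispolyX f n : ispoly f -> ispoly (fun x => f x ^+ n).
Proof.
move=> pf; elim: n => [|n ih]; first exact: ispoly_cst.
by have := ispolyM pf ih; congr ispoly; apply/funext => x; rewrite exprS.
Qed.
Lemma ispolyS n s : ispoly (fun x => S n (act s^-1%g x)).
Proof.
exists [:: (1, [:: (s, n)])] => x.
by rewrite /pev big_seq1 /mev big_seq1 mul1r.
Qed.
Lemma ispoly_bdd f : ispoly f -> bdd f.
Proof. by move=> [q fq]; rewrite (_ : f = pev q); [exact: bdd_pev|exact/funext]. Qed.

(** The approximating polynomials have to take values in [0, 1] everywhere, since
    their images under positive maps are going to be rounded to indicators. *)
Definition unit_limit (f : X -> R) := bdd f /\ forall eps : R, 0 < eps ->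
  exists p, [/\ ispoly p, forall x, 0 <= p x <= 1 & Ex (fun x => `|f x - p x|) < eps].

(** For an indicator [b] this glues [f] and [g] along it.  Sums would leave the
    unit interval, convex combinations do not. *)
Lemma unit_limit_mix f g b : (forall x, 0 <= f x <= 1) -> (forall x, 0 <= g x <= 1) ->
  (forall x, 0 <= b x <= 1) -> unit_limit f -> unit_limit g -> unit_limit b ->
  unit_limit (fun x => b x * f x + (1 - b x) * g x).
Proof.
move=> f1 g1 b1 [bf Hf] [bg Hg] [bb Hb]; split.
  by apply: bddD; apply: bddM => //; apply: bddB => //; exact: bdd_cst.
move=> eps eps0; have e3 : 0 < eps / 3 by rewrite divr_gt0.
have [pf [pfP pf1 fpf]] := Hf _ e3; have [pg [pgP pg1 gpg]] := Hg _ e3.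
have [pb [pbP pb1 bpb]] := Hb _ e3.
have bpf := ispoly_bdd pfP; have bpg := ispoly_bdd pgP; have bpb' := ispoly_bdd pbP.
exists (fun x => pb x * pf x + (1 - pb x) * pg x); split.
- apply: ispolyD; first exact: ispolyM.
  by apply: ispolyM => //; apply: ispolyB => //; exact: ispoly_cst.
- move=> x; have /andP[? ?] := pf1 x; have /andP[? ?] := pg1 x; have /andP[? ?] := pb1 x.
  by apply/andP; split; nra.
rewrite (_ : eps = eps / 3 + (eps / 3 + eps / 3)); last by field.
apply: le_lt_trans (ltrD fpf (ltrD gpg bpb)).
rewrite -!ExD//; try (by apply: bdd_norm; exact: bddB);
  last by apply: bddD; apply: bdd_norm; exact: bddB.
apply: le_Ex.
- apply: bdd_norm; apply: bddB; apply: bddD; apply: bddM => //; apply: bddB => //; exact: bdd_cst.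
- by apply: bddD; [|apply: bddD]; apply: bdd_norm; exact: bddB.
move=> x.
have -> : b x * f x + (1 - b x) * g x - (pb x * pf x + (1 - pb x) * pg x) =
  b x * (f x - pf x) + ((1 - b x) * (g x - pg x) + (b x - pb x) * (pf x - pg x)) by ring.
have /andP[? ?] := pf1 x; have /andP[? ?] := pg1 x; have /andP[? ?] := b1 x.
rewrite (le_trans (ler_normD _ _))// lerD//.
  by rewrite normrM ler_piMl// ler_norml; apply/andP; split; lra.
rewrite (le_trans (ler_normD _ _))// lerD// normrM.
  by rewrite ler_piMl// ler_norml; apply/andP; split; lra.
by rewrite ler_piMr// ler_norml; apply/andP; split; lra.
Qed.

(** Induction on the number of bits, gluing along the last one. *)
Lemma unit_limit_code (b : nat -> X -> bool) n (c : {ffun 'I_n -> bool} -> R) :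
  (forall j, unit_limit (fun x => (b j x)%:R)) -> (forall t, 0 <= c t <= 1) ->
  unit_limit (fun x => c (bitcode b n x)).
Proof.
move=> Hb; elim: n c => [|n ih] c c1.
  have t0 x : bitcode b 0 x = [ffun=> false] by apply/ffunP => -[].
  have -> : (fun x => c (bitcode b 0 x)) = fun=> c [ffun=> false].
    by apply/funext => x; rewrite t0.
  split; first exact: bdd_cst.
  move=> eps eps0; exists (fun=> c [ffun=> false]); split => //; first exact: ispoly_cst.
  by under eq_Ex do rewrite subrr normr0; rewrite Ex_cst.
pose ext (u : bool) (t : {ffun 'I_n -> bool}) : {ffun 'I_n.+1 -> bool} :=
  [ffun i => if unlift ord_max i is Some j then t j else u].
have extE x : ext (b n x) (bitcode b n x) = bitcode b n.+1 x.
  apply/ffunP => i; rewrite !ffunE; case: unliftP => [j ->|-> //].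
  by rewrite ffunE lift_max.
have := unit_limit_mix (fun x => c1 (ext true (bitcode b n x)))
  (fun x => c1 (ext false (bitcode b n x))) _ (ih (fun t => c (ext true t)) _)
  (ih (fun t => c (ext false t)) _) (Hb n).
move=> /(_ _ _ _)/wrap[].
- by move=> x; case: (b n x); rewrite ?ler01 ?lexx.
- by move=> t; exact: c1.
- by move=> t; exact: c1.
congr unit_limit; apply/funext => x; rewrite -extE.
by case: (b n x); rewrite ?subrr ?subr0 ?mul1r ?mul0r ?addr0 ?add0r.
Qed.

(** Polynomials that tend to the indicator of [w < 1/2] on [0, 1].  With
    [N = n 4^n] and [x = w^(2n)], the product [N x = n (2w)^(2n)] tends to zero
    or to infinity according to the side of [1/2] on which [w] lies, and
    [(1 - x)^N] accordingly to one or to zero, by the two Bernoulli bounds. *)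
Definition step_poly (n : nat) (w : R) : R := (1 - w ^+ (2 * n)) ^+ (n * 4 ^ n).

Lemma step_poly01 n w : 0 <= w <= 1 -> 0 <= step_poly n w <= 1.
Proof.
move=> /andP[w0 w1]; rewrite /step_poly exprn_ge0/=; last by rewrite subr_ge0 exprn_ile1.
by rewrite exprn_ile1// ?subr_ge0 ?exprn_ile1// lerBlDr lerDl exprn_ge0.
Qed.

Lemma bernoulli (x : R) N : 0 <= x <= 1 -> 1 - N%:R * x <= (1 - x) ^+ N.
Proof.
move=> /andP[x0 x1]; elim: N => [|N ih]; first by rewrite mul0r subr0 expr0.
rewrite exprS; apply: le_trans (_ : (1 - x) * (1 - N%:R * x) <= _).
  rewrite -natr1; have : 0 <= N%:R * x * x by rewrite !mulr_ge0.
  by nra.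
by rewrite ler_wpM2l// subr_ge0.
Qed.

Lemma bernoulli_upper (x : R) N : 0 <= x <= 1 -> (1 - x) ^+ N <= (1 + N%:R * x)^-1.
Proof.
move=> /andP[x0 x1].
have H : 1 + N%:R * x <= (1 + x) ^+ N.
  elim: N => [|N ih]; first by rewrite mul0r addr0 expr0.
  rewrite exprS; apply: le_trans (_ : (1 + x) * (1 + N%:R * x) <= _).
    rewrite -natr1; have : 0 <= N%:R * x * x by rewrite !mulr_ge0.
    by nra.
  by rewrite ler_wpM2l// addr_ge0.
have p0 : 0 < 1 + N%:R * x by rewrite ltr_pwDl// mulr_ge0.
rewrite -[leRHS]mul1r ler_pdivlMr// (le_trans (ler_wpM2l _ H))//.
  by rewrite exprn_ge0// subr_ge0.
rewrite -exprMn exprn_ile1//; first by rewrite mulr_ge0 ?subr_ge0 ?addr_ge0.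
by nra.
Qed.

Lemma step_poly_cvg (w : R) : 0 <= w <= 1 ->
  step_poly n w @[n --> \oo] --> ((w < 2^-1)%R%:R : R).
Proof.
move=> w01; have /andP[w0 w1] := w01; have wn01 n : 0 <= w ^+ (2 * n) <= 1 by rewrite exprn_ge0// exprn_ile1.
have nE n : (n * 4 ^ n)%:R * w ^+ (2 * n) = n%:R * ((2 * w) ^+ n) ^+ 2 :> R.
  rewrite natrM natrX -mulrA exprM -exprMn -exprM mulnC exprM; congr (_ * _ ^+ _).
  by rewrite exprMn; congr (_ * _); rewrite -natrX.
have w2 : 0 <= 2 * w by rewrite mulr_ge0.
have [wlt|wge] := ltP w 2^-1.
  have x0 : 0 < 1 - 2 * w by lra.
  apply: (@squeeze_cvgr _ _ _ _ (fun n => 1 - (1 - 2 * w) ^- 2 * harmonic n) (fun=> 1)).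
  - apply: nearW => n; apply/andP; split; last first.
      by have /andP[] := step_poly01 n w01.
    apply: le_trans (bernoulli _ (wn01 n)); rewrite nE lerD2l lerN2.
    have zn := @bernoulli_upper (1 - 2 * w) n.
    have {}zn : (2 * w) ^+ n <= (1 + n%:R * (1 - 2 * w))^-1.
      by have := zn; rewrite subKr; apply; apply/andP; split; lra.
    apply: (@le_trans _ _ (n%:R * ((n.+1%:R * (1 - 2 * w))^-1) ^+ 2)).
      rewrite ler_wpM2l// lerXn2r ?nnegrE ?exprn_ge0//.
        by rewrite invr_ge0 mulr_ge0// ltW.
      apply: le_trans zn _; rewrite lef_pV2 ?posrE ?mulr_gt0//.
        by rewrite -natr1 mulrDl mul1r addrC lerD2r; lra.
      by rewrite ltr_pwDl// mulr_ge0// ltW.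
    rewrite /harmonic invfM exprMn -[(n.+1%:R^-1) ^+ 2]/(n.+1%:R^-1 * n.+1%:R^-1).
    rewrite exprVn mulrA mulrC ler_wpM2l ?invr_ge0 ?exprn_ge0 ?(ltW x0)//.
    rewrite mulrA ler_piMl ?invr_ge0// ler_pdivrMr// mul1r ler_nat//.
  - have : (1 - (1 - 2 * w) ^- 2 * harmonic n) @[n --> \oo] --> (1 - (1 - 2 * w) ^- 2 * 0).
      by apply: cvgB; [exact: cvg_cst|apply: cvgMr; exact: cvg_harmonic].
    by rewrite mulr0 subr0.
  - exact: cvg_cst.
apply: (@squeeze_cvgr _ _ _ _ (fun=> 0) harmonic).
- apply: nearW => n; have /andP[-> _] /= := step_poly01 n w01.
  apply: le_trans (bernoulli_upper _ (wn01 n)) _; rewrite nE /harmonic.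
  have w21 : 1 <= 2 * w by lra.
  have p0 : 0 < 1 + n%:R * (2 * w) ^+ n ^+ 2 by rewrite ltr_pwDl// mulr_ge0 ?exprn_ge0.
  rewrite lef_pV2 ?posrE//.
  by rewrite -[n.+1%:R]natr1 [1 + _]addrC lerD2r ler_peMr// exprn_ege1// exprn_ege1.
- exact: cvg_cst.
- exact: cvg_harmonic.
Qed.

(** The [minn] keeps the thresholds in [0, 1] whatever the pair [(m, j)] that is
    decoded in [level]. *)
Definition threshold (m j : nat) : R := (minn j m).+1%:R / m.+1%:R.
Definition level (k : nat) (x : X) : bool :=
  let: (a, q) := code_pair k in let: (m, j) := code_pair q in
  (S a x + 1) / 2 < threshold m j.

Lemma measurable_level k : measurable [set x | level k x].
Proof.
rewrite /level; case: code_pair => a q; case: code_pair => m j.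
have mf : measurable_fun setT (fun x => (S a x + 1) / 2).
  by apply: measurable_funM => //; exact: measurable_funD.
rewrite (_ : [set _ | _] = (fun x => (S a x + 1) / 2) @^-1` `]-oo, threshold m j[%classic).
  by rewrite -[_ @^-1` _]setTI; apply: mf => //; exact: measurable_itv.
by apply/seteqP; split => x /=; rewrite in_itv.
Qed.

(** An affine change of variables brings the threshold to [1/2], where
    [step_poly] applies. *)
Lemma unit_limit_level k s : unit_limit (fun x => (level k (act s^-1%g x))%:R).
Proof.
split.
  have := bdd_bool R (measurable_level k).
  by move=> /(bdd_act act_pmp s^-1%g).
move=> eps eps0; rewrite /level; case: code_pair => a q; case: code_pair => m j.
set c := threshold m j.
have c01 : 0 <= c <= 1.
  rewrite /c /threshold divr_ge0//= ler_pdivrMr// mul1r ler_nat ltnS geq_minr//.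
pose w x := 2^-1 + ((S a (act s^-1%g x) + 1) / 2 - c) / 2.
have w01 x : 0 <= w x <= 1.
  have := S1 a (act s^-1%g x); rewrite ler_norml /w => /andP[? ?].
  by move/andP: c01 => [? ?]; apply/andP; split; lra.
have wc x : ((S a (act s^-1%g x) + 1) / 2 < c) = (w x < 2^-1).
  by rewrite /w; apply/idP/idP; lra.
have pw : ispoly w.
  apply: ispolyD; first exact: ispoly_cst.
  apply: ispolyM; last exact: ispoly_cst.
  apply: ispolyB; last exact: ispoly_cst.
  apply: ispolyM; last exact: ispoly_cst.
  by apply: ispolyD; [exact: ispolyS|exact: ispoly_cst].
have ps n : ispoly (fun x => step_poly n (w x)).
  apply: ispolyX; apply: ispolyB; first exact: ispoly_cst.
  exact: ispolyX.
have mb : bdd (fun x => (w x < 2^-1)%R%:R : R).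
  apply: bdd_bool; rewrite (_ : [set _ | _] = w @^-1` `]-oo, 2^-1[%classic).
    by rewrite -[_ @^-1` _]setTI; apply: (ispoly_bdd pw).1 => //; exact: measurable_itv.
  by apply/seteqP; split => x /=; rewrite in_itv.
have : Ex (fun x => `|step_poly n (w x) - (w x < 2^-1)%R%:R|) @[n --> \oo] --> (0 : R).
  apply: (@Ex_cvg _ _ _ mu (fun n x => step_poly n (w x)) (fun x => (w x < 2^-1)%R%:R) 1).
  - by move=> n; exact: (ispoly_bdd (ps n)).1.
  - exact: mb.1.
  - by move=> n x; have /andP[? ?] := step_poly01 n (w01 x); rewrite ger0_norm.
  - by apply: aeW => x; exact: step_poly_cvg.
move/cvgrPdist_lt => /(_ _ eps0) [n _ /(_ n (leqnn n))] /=.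
rewrite sub0r normrN ger0_norm ?Ex_ge0// => Hn.
exists (fun x => step_poly n (w x)); split=> //; first by move=> x; exact: step_poly01.
under eq_Ex do rewrite wc distrC.
exact: Hn.
Qed.

Section Density.
Context (e : nat -> G) (e_surj : forall s, exists n, e n = s).
Hypothesis genS : dynamically_generating mu act (range (fun n => cplx (S n))).

Let b := tbit act e level.

(** [S n] is uniformly within [2 / m.+1] of a staircase built on its own level
    sets, hence the level sets generate because [S] does. *)
Lemma approximable_S n : approximable mu b (S n).
Proof.
have mb := measurable_tbit act_pmp e measurable_level.
have [i1 ei1] := e_surj 1%g.
apply: approximable_closed => //; first exact: bdd_S.
move=> eps eps0.
pose m := Num.truncn (2 / eps).
have m0 : 2 / m.+1%:R < eps.
  rewrite ltr_pdivrMr// mulrC -ltr_pdivrMr//.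
  have e20 : 0 <= 2 / eps by rewrite divr_ge0// ltW.
  by have /andP[] := truncn_itv e20.
pose g (x : X) : R := \sum_(j < m.+1) (2 / m.+1%:R) * (1 - (b (pair_code (i1, pair_code (n, pair_code (m, val j)))) x)%:R) - 1.
have bbit j : bdd (fun x => (b j x)%:R : R) by exact: bdd_bool.
have bj j : bdd (fun x => 1 - (b j x)%:R : R) by apply: bddB => //; exact: bdd_cst.
exists g; split.
- apply: bddB; last exact: bdd_cst.
  by apply: bdd_sum => j _; exact: bddZ.
- apply: approximableB => //; [|exact: bdd_cst| |exact: approximable_cst].
    by apply: bdd_sum => j _; exact: bddZ.
  apply: approximable_sum => [//|j|j]; first exact: bddZ.
  apply: approximableZ => //; apply: approximableB => //; first exact: bdd_cst.
    exact: approximable_cst.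
  exact: approximable_bit.
apply: le_lt_trans m0; rewrite -(Ex_cst mu (2 / _)); apply: le_Ex.
- apply: bdd_norm; apply: bddB; first exact: bdd_S.
  by apply: bddB; [apply: bdd_sum => j _; exact: bddZ|exact: bdd_cst].
- exact: bdd_cst.
move=> x; rewrite /g.
pose v := (S n x + 1) / 2.
have v01 : 0 <= v <= 1.
  by have := S1 n x; rewrite ler_norml /v => /andP[? ?]; apply/andP; split; lra.
(* [t] counts the thresholds that are at most [v] *)
pose t := Num.truncn (m.+1%:R * v).
have /andP[t1 t2] : t%:R <= m.+1%:R * v < t.+1%:R.
  by apply: truncn_itv; rewrite mulr_ge0//; case/andP: v01.
have tm : (t <= m.+1)%N.
  rewrite -(ler_nat R) (le_trans t1)// ler_piMr//; by case/andP: v01.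
have bE (j : 'I_m.+1) : 1 - (b (pair_code (i1, pair_code (n, pair_code (m, val j)))) x)%:R = (j < t)%N%:R :> R.
  rewrite /b tbitE ei1 invg1 (act1 act_pmp) /level !pair_codeK -/v /threshold.
  have /minn_idPl -> : (val j <= m)%N by rewrite -ltnS ltn_ord.
  rewrite ltr_pdivlMr// [v * _]mulrC.
  have -> : (m.+1%:R * v < (val j).+1%:R) = ~~ (j < t)%N.
    rewrite -leqNgt; apply/idP/idP => [|tj]; last by rewrite (lt_le_trans t2)// ler_nat.
    by move=> /(le_lt_trans t1); rewrite ltr_nat.
  by case: (_ < _)%N; rewrite ?subr0 ?subrr.
under eq_bigr do rewrite bE.
rewrite -mulr_sumr -natr_sum.
have -> : (\sum_(i < m.+1) (i < t)%N)%N = t.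
  rewrite -[RHS]card_ord -sum1_card (big_ord_widen _ (fun=> 1%N) tm) [RHS]big_mkcond.
  by apply: eq_bigr => i _; case: (_ < _)%N.
have SE : S n x = 2 * v - 1 by rewrite /v; lra.
have u1 : t%:R / m.+1%:R <= v by rewrite ler_pdivrMr// mulrC.
have u2 : v <= t%:R / m.+1%:R + 1 / m.+1%:R.
  by rewrite -mulrDl ler_pdivlMr// natr1 mulrC ltW.
rewrite SE mulrAC -mulrA; move: u1 u2; rewrite mul1r.
set u := t%:R / _; set q := m.+1%:R^-1.
by move=> u1 u2; rewrite ler_norml; apply/andP; split; lra.
Qed.

(** The indicator of [B] is approximated by a function of finitely many translated
    level sets, and such functions are limits of polynomials. *)
Lemma unit_limit_measurable (B : X -> bool) : measurable [set x | B x] ->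
  unit_limit (fun x => (B x)%:R).
Proof.
move=> mB; have bB := bdd_bool R mB; split=> // eps eps0.
have mb := measurable_tbit act_pmp e measurable_level.
have aB : approximable mu b (fun x => (B x)%:R).
  apply: (generating_approximable act_pmp mb (tbit_act act_pmp e_surj level) genS) => //.
  move=> _ [n _ <-]; split; first exact: bdd_cplx (bdd_S n).
  exists (S n), (fun=> 0); split => //.
  - exact: bdd_S.
  - exact: bdd_cst.
  - exact: approximable_S.
  - exact: approximable_cst.
  - by apply: aeW.
have e2 : 0 < eps / 2 by rewrite divr_gt0.
(* centred at zero, the indicator is clipped to values that shift back into [0, 1] *)
have aB' : approximable mu b (fun x => (B x)%:R - 2^-1).
  by apply: approximableB => //; [exact: bdd_cst|exact: approximable_cst].
have [] := @approximable_clip _ _ _ mu b mb _ 2^-1 (bddB bB (bdd_cst _ 2^-1)) _ _ aB' _ e2.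
- by move=> x; case: (B x); rewrite /= ler_norml; apply/andP; split; lra.
- by [].
move=> n [c [c1 cB]].
have [] := @unit_limit_code b n (fun t => c t + 2^-1).
- by move=> j; exact: unit_limit_level.
- by move=> t; have := c1 t; rewrite ler_norml => /andP[? ?]; apply/andP; split; lra.
move=> bc /(_ _ e2)[p [pp p1 cp]]; exists p; split=> //.
have bp := ispoly_bdd pp.
rewrite [ltRHS]splitr; apply: le_lt_trans (ltrD cB cp).
rewrite -ExD; [|by apply: bdd_norm; apply: bddB; [apply: bddB => //; exact: bdd_cst|exact: bdd_bitcode]
  |by apply: bdd_norm; exact: bddB].
apply: le_Ex; first by apply: bdd_norm; exact: bddB.
  by apply: bddD; apply: bdd_norm; [apply: bddB; [apply: bddB => //; exact: bdd_cst|exact: bdd_bitcode]|exact: bddB].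
move=> x; apply: le_trans (ler_normD _ _); rewrite le_eqVlt; apply/orP; left; apply/eqP.
by congr (`|_|); ring.
Qed.

End Density.
End Polynomials.

(** * Averages on a finite set and real positive maps *)

Section Mean.
Context (R : realType).

Definition mean (d : nat) (f : 'I_d -> R) : R := d%:R^-1 * \sum_(k < d) f k.

Section FixedDim.
Context (d : nat) (d0 : (0 < d)%N).
Implicit Types f g : 'I_d -> R.

Let dn0 : d%:R != 0 :> R. Proof. by rewrite pnatr_eq0 -lt0n. Qed.

Lemma eq_mean f g : f =1 g -> mean f = mean g.
Proof. by move=> fg; congr mean; apply/funext. Qed.

Lemma meanD f g : mean (fun k => f k + g k) = mean f + mean g.
Proof. by rewrite /mean big_split mulrDr. Qed.

Lemma meanZ c f : mean (fun k => c * f k) = c * mean f.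
Proof. by rewrite /mean -mulr_sumr mulrCA. Qed.

Lemma meanB f g : mean (fun k => f k - g k) = mean f - mean g.
Proof. by rewrite /mean sumrB mulrBr. Qed.

Lemma mean_sum (I : Type) (r : seq I) (F : I -> 'I_d -> R) :
  mean (fun k => \sum_(i <- r) F i k) = \sum_(i <- r) mean (F i).
Proof. by rewrite /mean exchange_big/= mulr_sumr. Qed.

Lemma mean_cst c : mean (fun _ : 'I_d => c) = c.
Proof. by rewrite /mean sumr_const card_ord -[c *+ d]mulr_natl mulrA mulVf// mul1r. Qed.

Lemma le_mean f g : (forall k, f k <= g k) -> mean f <= mean g.
Proof. by move=> fg; rewrite /mean ler_wpM2l// ler_sum. Qed.

Lemma mean_ge0 f : (forall k, 0 <= f k) -> 0 <= mean f.
Proof. by move=> f0; rewrite /mean mulr_ge0// sumr_ge0. Qed.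

Lemma le_norm_mean f : `|mean f| <= mean (fun k => `|f k|).
Proof.
rewrite /mean normrM ger0_norm// ler_wpM2l//.
exact: ler_norm_sum.
Qed.

Lemma le_mean_dist f g h : mean (fun k => `|f k - h k|) <=
  mean (fun k => `|f k - g k|) + mean (fun k => `|g k - h k|).
Proof.
by rewrite -meanD; apply: le_mean => k; rewrite -(subrKA (g k)) ler_normD.
Qed.

Lemma mean_distC f g : mean (fun k => `|f k - g k|) = mean (fun k => `|g k - f k|).
Proof. by apply: eq_mean => k; rewrite distrC. Qed.

Lemma mean_perm (s : 'S_d) f : mean (fun k => f (s k)) = mean f.
Proof. by rewrite /mean [in RHS](reindex_inj (@perm_inj _ s)). Qed.

Lemma sqr_mean f : mean f ^+ 2 <= mean (fun k => f k ^+ 2).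
Proof.
have : 0 <= mean (fun k => (f k - mean f) ^+ 2) by apply: mean_ge0 => k; exact: sqr_ge0.
rewrite (@eq_mean _ (fun k => f k ^+ 2 + (- (2 * mean f) * f k + mean f ^+ 2))).
  by rewrite meanD meanD meanZ mean_cst; lra.
by move=> k; ring.
Qed.

Lemma mean_norm_le f (e : R) : 0 <= e -> mean (fun k => f k ^+ 2) <= e ^+ 2 ->
  mean (fun k => `|f k|) <= e.
Proof.
move=> e0 fe; rewrite -(@ler_pXn2r _ 2)// ?nnegrE//; last exact: mean_ge0.
rewrite (le_trans (sqr_mean _))//.
by under eq_mean do rewrite real_normK ?num_real//.
Qed.

Lemma mean_card (b : 'I_d -> bool) : mean (fun k => (b k)%:R) = #|[set k | b k]%SET|%:R / d%:R.
Proof.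
rewrite /mean mulrC -natr_sum; congr (_%:R / _).
by rewrite -sum1dep_card [RHS]big_mkcond; apply: eq_bigr => k _; case: (b k).
Qed.

End FixedDim.

(** The product is changed one factor at a time. *)
Lemma prod_dist (I : Type) (r : seq I) (a b : I -> R) (C : R) : 1 <= C ->
  (forall i, `|a i| <= C) -> (forall i, `|b i| <= C) ->
  `|\prod_(i <- r) a i - \prod_(i <- r) b i| <= C ^+ size r * \sum_(i <- r) `|a i - b i|.
Proof.
move=> C1 aC bC; have C0 : 0 <= C by rewrite (le_trans _ C1).
have prC s : `|\prod_(i <- s) b i| <= C ^+ size s.
  rewrite normr_prod; elim: s => [|i s ih]; first by rewrite big_nil.
  by rewrite big_cons exprS ler_pM// prodr_ge0.
elim: r => [|i r ih]; first by rewrite !big_nil subrr normr0 mulr0.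
rewrite !big_cons [size _]/= exprS.
rewrite (_ : _ - _ = a i * (\prod_(j <- r) a j - \prod_(j <- r) b j) +
   (a i - b i) * \prod_(j <- r) b j); last ring.
rewrite (le_trans (ler_normD _ _))// !normrM mulrDr addrC lerD//.
  rewrite mulrC ler_wpM2r// (le_trans (prC r))// ler_peMl// exprn_ge0//.
by rewrite -mulrA ler_pM// mulr_ge0// sumr_ge0.
Qed.

End Mean.

Section RealMaps.
Context (R : realType) (G : groupType) (dX : measure_display)
  (X : measurableType dX) (mu : probability X R) (act : G -> X -> X).
Hypothesis act_pmp : pmp_action mu act.
Local Notation Ex := (Ex mu).
Local Notation Re := (@complex.Re R).
Local Notation Im := (@complex.Im R).

Section Positive.
Context (d : nat).
Implicit Types (psi : (X -> R) -> 'I_d -> R) (f g : X -> R).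

(** The real counterpart of [unital_positive_map], which only sees functions that
    are bounded everywhere. *)
Definition real_positive psi : Prop :=
  [/\ forall c f g, bdd f -> bdd g -> forall k, psi (fun x => c * f x + g x) k = c * psi f k + psi g k,
      forall k, psi (fun=> 1) k = 1 &
      forall f, bdd f -> (forall x, 0 <= f x) -> forall k, 0 <= psi f k].

Variable psi : (X -> R) -> 'I_d -> R.
Hypothesis psiP : real_positive psi.

Lemma psi_lin c f g k : bdd f -> bdd g -> psi (fun x => c * f x + g x) k = c * psi f k + psi g k.
Proof. by case: psiP => + _ _ => H bf bg; exact: H. Qed.

Lemma psi_cst c k : psi (fun=> c) k = c.
Proof.
have psi0 : psi (fun=> 0) k = 0.
  have := psi_lin (-1) k (bdd_cst X (0 : R)) (bdd_cst X (0 : R)).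
  by under [X in psi X _]eq_fun do rewrite mulr0 addr0; rewrite mulN1r addNr.
have := psi_lin c k (bdd_cst X (1 : R)) (bdd_cst X (0 : R)).
under [X in psi X _]eq_fun do rewrite mulr1 addr0.
by case: psiP => _ -> _; rewrite psi0 addr0 mulr1.
Qed.

Lemma psiZ c f k : bdd f -> psi (fun x => c * f x) k = c * psi f k.
Proof.
move=> bf; have := psi_lin c k bf (bdd_cst X (0 : R)).
by under [X in psi X _]eq_fun do rewrite addr0; rewrite psi_cst addr0.
Qed.

Lemma psiD f g k : bdd f -> bdd g -> psi (fun x => f x + g x) k = psi f k + psi g k.
Proof.
move=> bf bg; have := psi_lin 1 k bf bg.
by under [X in psi X _]eq_fun do rewrite mul1r; rewrite mul1r.
Qed.

Lemma psiB f g k : bdd f -> bdd g -> psi (fun x => f x - g x) k = psi f k - psi g k.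
Proof.
move=> bf bg; have := psi_lin (-1) k bg bf.
under [X in psi X _]eq_fun do rewrite mulN1r addrC.
by rewrite mulN1r addrC.
Qed.

Lemma psi_sum (I : Type) (r : seq I) (F : I -> X -> R) k : (forall i, bdd (F i)) ->
  psi (fun x => \sum_(i <- r) F i x) k = \sum_(i <- r) psi (F i) k.
Proof.
move=> bF; elim: r => [|i r ih].
  by under [X in psi X _]eq_fun do rewrite big_nil; rewrite big_nil psi_cst.
under [X in psi X _]eq_fun do rewrite big_cons.
by rewrite big_cons psiD ?ih//; apply: bdd_sum.
Qed.

Lemma le_psi f g k : bdd f -> bdd g -> (forall x, f x <= g x) -> psi f k <= psi g k.
Proof.
move=> bf bg fg; rewrite -subr_ge0 -psiB//; case: psiP => _ _; apply; first exact: bddB.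
by move=> x; rewrite subr_ge0.
Qed.

Lemma norm_psi f (M : R) k : bdd f -> (forall x, `|f x| <= M) -> `|psi f k| <= M.
Proof.
move=> bf fM; rewrite ler_norml -(psi_cst (- M) k) -[X in _ && (_ <= X)](psi_cst M k).
by rewrite !le_psi//; try exact: bdd_cst; move=> x; have := fM x; rewrite ler_norml => /andP[].
Qed.

Lemma psi01 f k : bdd f -> (forall x, 0 <= f x <= 1) -> 0 <= psi f k <= 1.
Proof.
move=> bf f01; rewrite -{1}(psi_cst 0 k) -[X in _ && (_ <= X)](psi_cst 1 k).
by rewrite !le_psi//; try exact: bdd_cst; move=> x; have /andP[] := f01 x.
Qed.

(** Cauchy-Schwarz for positive maps: expand the image of
    [(f - psi f k) ^+ 2], which is nonnegative. *)
Lemma sqr_psi f k : bdd f -> psi f k ^+ 2 <= psi (fun x => f x ^+ 2) k.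
Proof.
move=> bf; have bt := bdd_cst X (psi f k).
have : 0 <= psi (fun x => (f x - psi f k) ^+ 2) k.
  by case: psiP => _ _; apply; [apply: bdd_sqr; exact: bddB|move=> x; exact: sqr_ge0].
have -> : (fun x => (f x - psi f k) ^+ 2) =
   (fun x => f x ^+ 2 + (- (2 * psi f k) * f x + psi f k ^+ 2)).
  by apply/funext => x; ring.
rewrite psiD; [|exact: bdd_sqr|by apply: bddD; [exact: bddZ|exact: bdd_cst]].
by rewrite psiD; [|exact: bddZ|exact: bdd_cst]; rewrite psiZ// psi_cst; lra.
Qed.

End Positive.

Context (S : nat -> X -> R) (mS : forall n, measurable_fun setT (S n))
  (S1 : forall n x, `|S n x| <= 1).
Let bS n : bdd (S n). Proof. exact: (bdd_S mS). Qed.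
Let bSa s n : bdd (fun x => S n (act s x)). Proof. exact: (bdd_act act_pmp). Qed.
Let bmev l : bdd (mev act S l). Proof. exact: (bdd_mev act_pmp). Qed.
Let bpev q : bdd (pev act S q). Proof. exact: (bdd_pev act_pmp). Qed.

Section Dim.
Context (d : nat) (sigma : G -> 'S_d).

(** The failure of multiplicativity of [sigma] on [F], stated for the inverses
    because these are what acts on functions. *)
Definition almost_mult (F : {fset G}) (delta : R) : Prop :=
  forall s t, s \in F -> t \in F ->
    mean (fun k => ((sigma (s * t)%g)^-1%g k != (sigma t)^-1%g ((sigma s)^-1%g k))%:R) <= delta.

Definition admissible (F : {fset G}) (m : nat) (l : tmono G) :=
  all (fun p => (p.1 \in F) && (p.2 < m)%N) l.

(** The real counterpart of [UP], with L^1 instead of L^2 norms on ['I_d]. *)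
Definition rUP (F : {fset G}) (m : nat) (delta : R) (psi : (X -> R) -> 'I_d -> R) : Prop :=
  [/\ real_positive psi,
     forall l, (0 < size l <= m)%N -> admissible F m l ->
       mean (fun k => `|psi (mev act S l) k -
         \prod_(p <- l) psi (fun x => S p.2 (act p.1^-1%g x)) k|) < delta,
     forall l, (0 < size l <= m)%N -> admissible F m l ->
       `|mean (psi (mev act S l)) - Ex (mev act S l)| < delta &
     forall s n, s \in F -> (n < m)%N ->
       mean (fun k => `|psi (fun x => S n (act s^-1%g x)) k -
                        psi (S n) ((sigma s)^-1%g k)|) < delta].

Lemma rUP_sub (F F' : {fset G}) m m' delta delta' psi : (F `<=` F')%fset -> (m <= m')%N ->
  delta' <= delta -> rUP F' m' delta' psi -> rUP F m delta psi.
Proof.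
move=> /fsubsetP FF mm dd [psiP H1 H2 H3].
have adm l : admissible F m l -> admissible F' m' l.
  by apply: sub_all => p /andP[/FF -> /leq_trans ->].
split=> //.
- move=> l /andP[l0 lm] al; apply: lt_le_trans dd; apply: H1; last exact: adm.
  by rewrite l0 (leq_trans lm).
- move=> l /andP[l0 lm] al; apply: lt_le_trans dd; apply: H2; last exact: adm.
  by rewrite l0 (leq_trans lm).
- by move=> s n /FF sF nm; apply: lt_le_trans dd; apply: H3 => //; exact: leq_trans mm.
Qed.

Lemma almost_mult_sub (F F' : {fset G}) delta delta' : (F `<=` F')%fset ->
  delta' <= delta -> almost_mult F' delta' -> almost_mult F delta.
Proof.
by move=> /fsubsetP FF dd H s t /FF sF /FF tF; apply: le_trans (H s t sF tF) dd.
Qed.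

(** The evaluation of a monomial on ['I_d], where [xi n] stands for [S n] and
    [sigma] for the action. *)
Definition mevd (xi : nat -> 'I_d -> R) (l : tmono G) (k : 'I_d) : R :=
  \prod_(p <- l) xi p.2 ((sigma p.1)^-1%g k).
Definition pevd (xi : nat -> 'I_d -> R) (q : tpoly R G) (k : 'I_d) : R :=
  \sum_(p <- q) p.1 * mevd xi p.2 k.

Lemma pevd_mul xi q r k : pevd xi (pmul q r) k = pevd xi q k * pevd xi r k.
Proof.
rewrite /pevd /pmul big_flatten big_map mulr_suml; apply: eq_bigr => p _.
rewrite big_map mulr_sumr; apply: eq_bigr => p' _.
by rewrite /mevd big_cat mulrACA.
Qed.

Definition weight (q : tpoly R G) : R := \sum_(p <- q) `|p.1|.

Lemma weight_ge0 q : 0 <= weight q. Proof. exact: sumr_ge0. Qed.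

Lemma norm_pevd xi q k : (forall n k, `|xi n k| <= 1) -> `|pevd xi q k| <= weight q.
Proof.
move=> xi1; rewrite /pevd (le_trans (ler_norm_sum _ _ _))//; apply: ler_sum => p _.
rewrite normrM ler_piMr//.
by rewrite /mevd normr_prod prodr_ile1// => g _; rewrite normr_ge0 xi1.
Qed.

End Dim.

(** Hides the quantifiers over [F], [m] and [delta] that occur in the entropy:
    [Q] holds for all maps that are close enough to being multiplicative,
    measure-preserving and equivariant. *)
Definition eventually (Q : forall d, (G -> 'S_d) -> ((X -> R) -> 'I_d -> R) -> Prop) : Prop :=
  exists (F : {fset G}) (m : nat) (delta : R), 0 < delta /\
    forall d (sigma : G -> 'S_d) psi, (0 < d)%N -> almost_mult sigma F delta ->
      rUP sigma F m delta psi -> Q d sigma psi.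

Lemma eventually_and Q1 Q2 : eventually Q1 -> eventually Q2 ->
  eventually (fun d sigma psi => Q1 d sigma psi /\ Q2 d sigma psi).
Proof.
move=> [F1 [m1 [e1 [e10 H1]]]] [F2 [m2 [e2 [e20 H2]]]].
exists (F1 `|` F2)%fset, (maxn m1 m2), (Num.min e1 e2); split; first by rewrite lt_min e10.
move=> d sigma psi d0 gs ups; split.
- apply: H1 => //; first apply: almost_mult_sub gs; try exact: fsubsetUl.
    by rewrite ge_min lexx.
  by apply: rUP_sub ups; rewrite ?fsubsetUl ?leq_maxl// ge_min lexx.
- apply: H2 => //; first apply: almost_mult_sub gs; try exact: fsubsetUr.
    by rewrite ge_min lexx orbT.
  by apply: rUP_sub ups; rewrite ?fsubsetUr ?leq_maxr// ge_min lexx orbT.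
Qed.

Lemma eventually_mono (Q1 Q2 : forall d, (G -> 'S_d) -> ((X -> R) -> 'I_d -> R) -> Prop) :
  (forall d sigma psi, (0 < d)%N -> real_positive psi -> Q1 d sigma psi -> Q2 d sigma psi) ->
  eventually Q1 -> eventually Q2.
Proof.
move=> H [F [m [e [e0 HQ]]]]; exists F, m, e; split=> // d sigma psi d0 gs ups.
by apply: H => //; [case: ups|exact: HQ].
Qed.

Lemma eventuallyT (Q : forall d, (G -> 'S_d) -> ((X -> R) -> 'I_d -> R) -> Prop) :
  (forall d sigma psi, (0 < d)%N -> real_positive psi -> Q d sigma psi) -> eventually Q.
Proof.
move=> H; exists fset0, 0%N, 1; split=> // d sigma psi d0 _ [psiP _ _ _].
exact: H.
Qed.

Lemma eventually_all_seq (I : eqType) (r : seq I)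
    (Q : I -> forall d, (G -> 'S_d) -> ((X -> R) -> 'I_d -> R) -> Prop) :
  (forall i, i \in r -> eventually (Q i)) ->
  eventually (fun d sigma psi => forall i, i \in r -> Q i d sigma psi).
Proof.
elim: r => [|i r ih] H; first by apply: eventuallyT.
have Hr j : j \in r -> eventually (Q j) by move=> jr; apply: H; rewrite inE jr orbT.
have := eventually_and (H i (mem_head _ _)) (ih Hr).
apply: eventually_mono => d sigma psi _ _ [Qi Qr] j.
by rewrite inE => /orP[/eqP ->|/Qr].
Qed.

Lemma eventually_all (I : finType)
    (Q : I -> forall d, (G -> 'S_d) -> ((X -> R) -> 'I_d -> R) -> Prop) :
  (forall i, eventually (Q i)) ->
  eventually (fun d sigma psi => forall i, Q i d sigma psi).
Proof.
move=> H; apply: eventually_mono (@eventually_all_seq I (enum I) Q (fun i _ => H i)).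
by move=> d sigma psi _ _ HQ i; apply: HQ; rewrite mem_enum.
Qed.

Lemma admissible_large (q : tpoly R G) : exists (F : {fset G}) (m : nat), forall p, p \in q ->
  (size p.2 <= m)%N /\ admissible F m p.2.
Proof.
elim: q => [|p q [F [m H]]]; first by exists fset0, 0%N.
pose F' := [fset s in [seq g.1 | g <- p.2]]%fset.
pose m' := maxn (size p.2) (\max_(g <- p.2) g.2).+1.
exists (F `|` F')%fset, (maxn m m') => p'; rewrite inE => /orP[/eqP ->|/H[H1 H2]].
  split; first by rewrite /m' !leq_max leqnn orbT.
  apply/allP => g gp; apply/andP; split.
    by rewrite !inE; apply/orP; right; apply/mapP; exists g.
  rewrite /m' !leq_max; apply/orP; right; apply/orP; right; rewrite ltnS.
  exact: (@leq_bigmax_seq _ p.2 xpredT (fun g : G * nat => g.2) g gp).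
split; first by rewrite leq_max H1.
by apply: sub_all H2 => g /andP[gF gm]; rewrite inE gF leq_max gm.
Qed.

Definition xi_of d (psi : (X -> R) -> 'I_d -> R) (n : nat) : 'I_d -> R := psi (S n).

Lemma norm_xi d (psi : (X -> R) -> 'I_d -> R) n k : real_positive psi -> `|xi_of psi n k| <= 1.
Proof. by move=> psiP; exact: norm_psi. Qed.

Lemma mono_dist d (sigma : G -> 'S_d) F m (delta : R) psi l : (0 < d)%N -> 0 < delta ->
  rUP sigma F m delta psi -> (size l <= m)%N -> admissible F m l ->
  mean (fun k => `|psi (mev act S l) k - mevd sigma (xi_of psi) l k|) <= delta + (size l)%:R * delta.
Proof.
move=> d0 e0 [psiP H1 _ H3] lm al.
case: l lm al => [|g0 l0] lm al.
  have -> : (fun k => `|psi (mev act S [::]) k - mevd sigma (xi_of psi) [::] k|) = fun=> 0.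
    apply/funext => k; rewrite /mevd big_nil (_ : mev act S [::] = fun=> 1).
      by rewrite psi_cst// subrr normr0.
    by apply/funext => x; rewrite /mev big_nil.
  by rewrite mean_cst// mul0r addr0 ltW.
set l := g0 :: l0 in lm al *.
rewrite (le_trans (le_mean_dist _ (fun k => \prod_(p <- l) psi (fun x => S p.2 (act p.1^-1%g x)) k) _))//.
rewrite lerD//; first by apply: ltW; apply: H1.
apply: (@le_trans _ _ (mean (fun k => \sum_(p <- l) `|psi (fun x => S p.2 (act p.1^-1%g x)) k -
    psi (S p.2) ((sigma p.1)^-1%g k)|))).
  apply: le_mean => k.
  have := @prod_dist R _ l (fun p => psi (fun x => S p.2 (act p.1^-1%g x)) k)
     (fun p => psi (S p.2) ((sigma p.1)^-1%g k)) 1 (lexx _).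
  rewrite expr1n mul1r; apply=> p; first by apply: norm_psi => //.
  exact: norm_psi.
rewrite mean_sum// -[leLHS]/(\sum_(p <- l) _).
have /allP al' := al.
rewrite big_seq_cond.
apply: (@le_trans _ _ (\sum_(p <- l | (p \in l) && true) delta)).
  apply: ler_sum => p; rewrite andbT => /al' /andP[pF pm].
  by apply: ltW; exact: H3.
by rewrite -big_seq_cond big_const_seq count_predT iter_addr_0 mulr_natl.
Qed.

(** Maps that are almost multiplicative and equivariant on the translates of [S]
    almost commute with the evaluation of polynomials. *)
Lemma eventually_pevd q (eta : R) : 0 < eta -> eventually (fun d sigma psi =>
  mean (fun k => `|psi (pev act S q) k - pevd sigma (xi_of psi) q k|) <= eta).
Proof.
move=> eta0; have [F [m H]] := admissible_large q.
have W0 : 0 < weight q + 1 by rewrite ltr_wpDl// weight_ge0.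
have m0 : 0 < 1 + m%:R :> R by rewrite ltr_pwDl.
pose delta := eta / (weight q + 1) / (1 + m%:R).
have de0 : 0 < delta by rewrite !divr_gt0.
exists F, m, delta; split=> // d sigma psi d0 _ ups; have [psiP _ _ _] := ups.
have -> : eta = (weight q + 1) * (1 + m%:R) * delta.
  by rewrite /delta; field; rewrite !gt_eqF.
apply: (@le_trans _ _ (mean (fun k => \sum_(p <- q) `|p.1| *
    `|psi (mev act S p.2) k - mevd sigma (xi_of psi) p.2 k|))).
  apply: le_mean => k; rewrite /pev psi_sum//; last first.
    by move=> p; apply: bddZ; exact: bmev.
  rewrite /pevd -sumrB (le_trans (ler_norm_sum _ _ _))//; apply: ler_sum => p _.
  by rewrite psiZ//; rewrite -mulrBr normrM.
rewrite mean_sum//; under eq_bigr do rewrite meanZ//.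
apply: (@le_trans _ _ (\sum_(p <- q) `|p.1| * ((1 + m%:R) * delta))).
  rewrite big_seq_cond [leRHS]big_seq_cond; apply: ler_sum => p; rewrite andbT => /H[pm pa].
  rewrite ler_wpM2l// (le_trans (mono_dist d0 de0 ups pm pa))//.
  by rewrite mulrDl mul1r lerD2l ler_wpM2r ?ler_nat// ltW.
rewrite -mulr_suml -/(weight q) -mulrA ler_wpM2r ?lerDl//.
by rewrite mulr_ge0// ltW.
Qed.

Lemma eventually_Ex q (eta : R) : 0 < eta -> eventually (fun d sigma psi =>
  `|mean (psi (pev act S q)) - Ex (pev act S q)| <= eta).
Proof.
move=> eta0; have [F [m H]] := admissible_large q.
have W0 : 0 < weight q + 1 by rewrite ltr_wpDl// weight_ge0.
pose delta := eta / (weight q + 1).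
have de0 : 0 < delta by rewrite !divr_gt0.
exists F, m, delta; split=> // d sigma psi d0 _ [psiP _ H2 _].
have -> : mean (psi (pev act S q)) = \sum_(p <- q) p.1 * mean (psi (mev act S p.2)).
  transitivity (mean (fun k => \sum_(p <- q) p.1 * psi (mev act S p.2) k)).
    apply: eq_mean => k; rewrite /pev psi_sum//; last by move=> p; exact: bddZ.
    by apply: eq_bigr => p _; rewrite psiZ.
  by rewrite mean_sum//; apply: eq_bigr => p _; rewrite meanZ.
have -> : Ex (pev act S q) = \sum_(p <- q) p.1 * Ex (mev act S p.2).
  rewrite Ex_sum; last by move=> p _; exact: bddZ.
  by apply: eq_bigr => p _; rewrite ExZ.
rewrite -sumrB (le_trans (ler_norm_sum _ _ _))//.
apply: (@le_trans _ _ (\sum_(p <- q) `|p.1| * delta)).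
  rewrite big_seq_cond [leRHS]big_seq_cond; apply: ler_sum => p; rewrite andbT => /H[pm pa].
  rewrite -mulrBr normrM ler_wpM2l//.
  have [p0|p0] := posnP (size p.2); last by apply: ltW; apply: H2; rewrite ?p0.
  rewrite (size0nil p0) (_ : mev act S [::] = fun=> 1).
    rewrite Ex_cst; under eq_mean do rewrite psi_cst//.
    by rewrite mean_cst// subrr normr0 ltW.
  by apply/funext => x; rewrite /mev big_nil.
rewrite -mulr_suml -/(weight q) /delta mulrC mulrAC ler_pdivrMr//.
by rewrite ler_wpM2l ?lerDl// ltW.
Qed.

(** [psi] is almost an L^2 contraction on polynomials, by [sqr_psi] and because
    the square of a polynomial is again one, whose integral [psi] nearly keeps. *)
Lemma eventually_sqr q (eta : R) : 0 < eta -> eventually (fun d sigma psi =>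
  mean (fun k => `|psi (pev act S q) k|) ^+ 2 <= Ex (fun x => pev act S q x ^+ 2) + eta).
Proof.
move=> eta0; apply: eventually_mono (eventually_Ex (pmul q q) eta0).
move=> d sigma psi d0 psiP.
have -> : pev act S (pmul q q) = fun x => pev act S q x ^+ 2.
  by apply/funext => x; rewrite pev_mul expr2.
rewrite ler_norml => /andP[_ H]; apply: (@le_trans _ _ (mean (psi (fun x => pev act S q x ^+ 2)))).
  rewrite (le_trans (sqr_mean d0 _))//; apply: le_mean => k.
  by rewrite real_normK ?num_real// sqr_psi.
by rewrite -lerBlDl.
Qed.

Lemma eventually_trans s q (eta : R) : 0 < eta -> eventually (fun d sigma psi =>
  mean (fun k => `|pevd sigma (xi_of psi) (ptrans s q) k -
                   pevd sigma (xi_of psi) q ((sigma s)^-1%g k)|) <= eta).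
Proof.
move=> eta0; have [F [m H]] := admissible_large q.
have W0 : 0 < weight q + 1 by rewrite ltr_wpDl// weight_ge0.
have m0 : 0 < 1 + m%:R :> R by rewrite ltr_pwDl.
pose delta := eta / (weight q + 1) / (1 + m%:R) / 2.
have de0 : 0 < delta by rewrite !divr_gt0.
exists (s |` F)%fset, m, delta; split=> // d sigma psi d0 gs [psiP _ _ _].
have -> : eta = (weight q + 1) * (1 + m%:R) * (2 * delta).
  by rewrite /delta; field; rewrite !gt_eqF.
apply: (@le_trans _ _ (mean (fun k => \sum_(p <- q) `|p.1| * (\sum_(g <- p.2)
   2 * ((sigma (s * g.1)%g)^-1%g k != (sigma g.1)^-1%g ((sigma s)^-1%g k))%:R)))).
  apply: le_mean => k; rewrite /pevd /ptrans big_map -sumrB.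
  rewrite (le_trans (ler_norm_sum _ _ _))//; apply: ler_sum => p _ /=.
  rewrite -mulrBr normrM ler_wpM2l// /mevd big_map/=.
  have := @prod_dist R _ p.2 (fun g => xi_of psi g.2 ((sigma (s * g.1)%g)^-1%g k))
     (fun g => xi_of psi g.2 ((sigma g.1)^-1%g ((sigma s)^-1%g k))) 1 (lexx _).
  rewrite expr1n mul1r => /(_ (fun g => norm_xi _ _ psiP) (fun g => norm_xi _ _ psiP)).
  move=> /le_trans; apply; apply: ler_sum => g _.
  case: eqP => [->|_]; first by rewrite subrr normr0 mulr0.
  rewrite mulr1 (le_trans (ler_normB _ _))// -[2]/(1 + 1) lerD//; exact: norm_xi.
rewrite mean_sum//; under eq_bigr do rewrite meanZ// mean_sum//.
apply: (@le_trans _ _ (\sum_(p <- q) `|p.1| * ((1 + m%:R) * (2 * delta)))).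
  rewrite big_seq_cond [leRHS]big_seq_cond; apply: ler_sum => p; rewrite andbT => /H[pm /allP pa].
  rewrite ler_wpM2l// big_seq_cond.
  apply: (@le_trans _ _ (\sum_(g <- p.2 | (g \in p.2) && true) 2 * delta)).
    apply: ler_sum => g; rewrite andbT => /pa /andP[gF _].
    by rewrite meanZ// ler_wpM2l// gs// !inE ?eqxx// gF orbT.
  rewrite -big_seq_cond big_const_seq count_predT iter_addr_0 -[_ *+ size _]mulr_natl.
  apply: ler_wpM2r; first by rewrite mulr_ge0// ltW.
  by rewrite addrC natr1 ler_nat ltnW// ltnS.
rewrite -mulr_suml -/(weight q) -mulrA ler_wpM2r ?lerDl//.
by apply: mulr_ge0; [exact: ltW|apply: mulr_ge0 => //; exact: ltW].
Qed.

End RealMaps.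

(** * From a positive map to a labelling *)

Section Rounding.
Context (R : realType) (d N : nat) (d0 : (0 < d)%N).
Variable y : 'I_N.+1 -> 'I_d -> R.
Hypothesis y01 : forall j k, 0 <= y j k <= 1.

Let r j k : bool := 2^-1 < y j k.

Lemma round_dist j k : `|(r j k)%:R - y j k| <= 2 * (y j k - y j k ^+ 2).
Proof.
have /andP[y0 y1] := y01 j k; rewrite /r ler_norml expr2; case: ltP => h /=; apply/andP; split; nra.
Qed.

Lemma pick_round j k :
  `|(odflt ord0 [pick i | r i k] == j)%:R - (r j k)%:R| <= `|\sum_i (r i k)%:R - 1| :> R.
Proof.
rewrite -natr_sum; have [s1|s1] := eqVneq (\sum_i r i k)%N 1%N.
  have rP i : r i k -> forall i', r i' k -> i = i'.
    move=> ri i' ri'; apply/eqP/negPn/negP => ii'.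
    move: s1; rewrite (bigD1 i)//= (bigD1 i')//= 1?eq_sym// ri ri'.
    by move=> /eqP; rewrite add1n add1n.
  case: pickP => [i ri|rn] /=; last first.
    by move: s1; rewrite big1// => i _; rewrite rn.
  rewrite s1 subrr normr0 (_ : (i == j) = r j k) ?subrr ?normr0//.
  by apply/eqP/idP => [<-//|rj]; exact: rP.
apply: (@le_trans _ _ 1).
  by case: (_ == j); case: (r j k); rewrite ?subrr ?subr0 ?sub0r ?normrN ?normr1 ?normr0//.
move: s1; case: (\sum_i _)%N => [|[|n]] // _; first by rewrite sub0r normrN normr1.
by rewrite -natr1 addrK normr_nat -[1]/(1%:R) ler_nat.
Qed.

(** Functions with values in [0, 1] that are almost idempotent and almost add up
    to one are close to the indicators of the classes of a labelling.  Each
    [y j] is rounded at [1/2]; the label of [k] is one whose rounding is [1], and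
    it is the only one except at the places where the roundings do not add up
    to one. *)
Lemma rounding : exists q : {ffun 'I_d -> 'I_N.+1}, forall j,
  mean (fun k => `|(q k == j)%:R - y j k|) <=
  4 * (\sum_i mean (fun k => y i k - y i k ^+ 2)) + mean (fun k => `|\sum_i y i k - 1|).
Proof.
exists [ffun k => odflt ord0 [pick i | r i k]] => j.
rewrite -mean_sum// -meanZ// -meanD//; apply: le_mean => k; rewrite ffunE.
have yy i : 0 <= y i k - y i k ^+ 2.
  by have /andP[? ?] := y01 i k; rewrite expr2; nra.
set Y := \sum_i (y i k - _); set Z := `|_ - 1|.
rewrite (le_trans (ler_distD (r j k)%:R _ _))//.
rewrite (_ : 4 * Y + Z = (2 * Y + Z) + 2 * Y); last by ring.
apply: lerD; last first.
  rewrite (le_trans (round_dist _ _))// ler_wpM2l// /Y (bigD1 j)//= lerDl.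
  by apply: sumr_ge0 => i _.
rewrite (le_trans (pick_round _ _))//.
rewrite (_ : _ - 1 = \sum_i ((r i k)%:R - y i k) + (\sum_i y i k - 1)); last by rewrite sumrB; ring.
rewrite (le_trans (ler_normD _ _))// lerD2r (le_trans (ler_norm_sum _ _ _))//.
by rewrite /Y mulr_sumr; apply: ler_sum => i _; exact: round_dist.
Qed.

End Rounding.

Section Names.
Context (R : realType).

Lemma ind_prod (F : finType) (T : eqType) (f t : F -> T) (g h : {ffun F -> T}) :
  g =1 f -> h =1 t -> (g == h)%:R = \prod_(s <- enum F) (f s == t s)%:R :> R.
Proof.
move=> gf ht; have [gh|gh] := eqVneq g h.
  by rewrite big1// => s _; rewrite -gf -ht gh eqxx.
have [s gs] : exists s, f s != t s.
  apply/existsP; rewrite -negb_forall; apply: contra gh => /forallP H.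
  by apply/eqP/ffunP => s; rewrite gf ht; apply/eqP.
by rewrite big_enum/= (bigD1 s)//= (negbTE gs) mul0r.
Qed.

(** The counterpart of [name] on ['I_d], for the labelling [q]. *)
Definition named (G : groupType) (d N : nat) (sigma : G -> 'S_d) (F : {fset G})
  (q : {ffun 'I_d -> 'I_N.+1}) (k : 'I_d) : {ffun F -> 'I_N.+1} :=
  [ffun s => q ((sigma (val s))^-1%g k)].

End Names.

Section Encode.
Context (R : realType) (G : groupType) (dX : measure_display)
  (X : measurableType dX) (mu : probability X R) (act : G -> X -> X).
Hypothesis act_pmp : pmp_action mu act.
Context (e : nat -> G) (e_surj : forall s, exists n, e n = s).
Context (P : nat -> set X) (genP : generating_partition mu act P).
Context (L : X -> nat) (PL : forall n x, P n x <-> L x = n).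
Context (S : nat -> X -> R) (mS : forall n, measurable_fun setT (S n))
  (S1 : forall n x, `|S n x| <= 1).
Hypothesis genS : dynamically_generating mu act (range (fun n => cplx (S n))).
Local Notation Ex := (Ex mu).
Local Notation eventually := (@eventually R G _ X mu act S).
Let bS n : bdd (S n). Proof. exact: (bdd_S mS). Qed.
Let bpev q : bdd (pev act S q). Proof. exact: (bdd_pev act_pmp mS S1). Qed.
Let blab N j : bdd (fun x => (lab L N x == j)%:R : R).
Proof. exact: (bdd_ind R (fun i => i == j) (mlab_lab genP PL (N:=N))). Qed.

(** The product over [s] in [F] of the translates by [s] of [g (t s)].  When [g j]
    approximates the indicator of label [j], it approximates the indicator of
    the points of name [t]. *)
Definition pprod (F : {fset G}) (N : nat) (g : 'I_N.+1 -> tpoly R G) (t : {ffun F -> 'I_N.+1}) :=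
  foldr (fun s acc => pmul (ptrans (val s) (g (t s))) acc) [:: (1, [::])] (enum {: F}).

Lemma pev_pprod (F : {fset G}) N (g : 'I_N.+1 -> tpoly R G) (t : {ffun F -> 'I_N.+1}) x :
  pev act S (pprod g t) x = \prod_(s <- enum {: F}) pev act S (g (t s)) (act (val s)^-1%g x).
Proof.
rewrite /pprod; elim: (enum {: F}) => [|s r ih] /=.
  by rewrite big_nil /pev big_seq1 /mev big_nil mulr1.
by rewrite pev_mul (pev_trans act_pmp) ih big_cons.
Qed.

Lemma pevd_pprod d (sigma : G -> 'S_d) xi (F : {fset G}) N (g : 'I_N.+1 -> tpoly R G) (t : {ffun F -> 'I_N.+1}) k :
  pevd sigma xi (pprod g t) k = \prod_(s <- enum {: F}) pevd sigma xi (ptrans (val s) (g (t s))) k.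
Proof.
rewrite /pprod; elim: (enum {: F}) => [|s r ih] /=.
  by rewrite big_nil /pevd big_seq1 /mevd big_nil mulr1.
by rewrite pevd_mul ih big_cons.
Qed.

Lemma weight_ptrans s (q : tpoly R G) : weight (ptrans s q) = weight q.
Proof. by rewrite /weight /ptrans big_map. Qed.

Lemma named_ind d N (sigma : G -> 'S_d) (F : {fset G}) (q : {ffun 'I_d -> 'I_N.+1}) k t :
  (named sigma F q k == t)%:R = \prod_(s <- enum {: F}) (q ((sigma (val s))^-1%g k) == t s)%:R :> R.
Proof. by apply: ind_prod => // s; rewrite ffunE. Qed.

Lemma name_ind (F : {fset G}) N x t :
  (name act L F N x == t)%:R = \prod_(s <- enum {: F}) (lab L N (act (val s)^-1%g x) == t s)%:R :> R.
Proof. by apply: ind_prod => // s; rewrite ffunE. Qed.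

Lemma Ex_pprod (F : {fset G}) N (g : 'I_N.+1 -> tpoly R G) (e1 : R) t :
  (forall j x, 0 <= pev act S (g j) x <= 1) ->
  (forall j, Ex (fun x => `|(lab L N x == j)%:R - pev act S (g j) x|) <= e1) ->
  Ex (fun x => `|(name act L F N x == t)%:R - pev act S (pprod g t) x|) <= #|{: F}|%:R * e1.
Proof.
move=> g01 ge1.
have bn : bdd (fun x => (name act L F N x == t)%:R : R).
  exact: (bdd_ind R (fun u => u == t) (mlab_name act_pmp genP PL (F:=F) (N:=N))).
have bt s : bdd (fun x => `|(lab L N (act (val s)^-1%g x) == t s)%:R -
     pev act S (g (t s)) (act (val s)^-1%g x)|).
  exact: (bdd_act act_pmp (val s)^-1%g (bdd_norm (bddB (blab (t s)) (bpev (g (t s)))))).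
apply: (@le_trans _ _ (Ex (fun x => \sum_(s <- enum {: F})
   `|(lab L N (act (val s)^-1%g x) == t s)%:R - pev act S (g (t s)) (act (val s)^-1%g x)|))).
  apply: le_Ex; [by apply: bdd_norm; exact: bddB|by apply: bdd_sum => s _; exact: bt|].
  move=> x; rewrite name_ind pev_pprod.
  have := @prod_dist R _ (enum {: F}) (fun s => (lab L N (act (val s)^-1%g x) == t s)%:R)
    (fun s => pev act S (g (t s)) (act (val s)^-1%g x)) 1 (lexx _).
  rewrite expr1n mul1r; apply=> s; first by rewrite normr_nat; case: (_ == _).
  by have /andP[g0 g1] := g01 (t s) (act (val s)^-1%g x); rewrite ger0_norm.
rewrite Ex_sum; last by move=> s _; exact: bt.
apply: (@le_trans _ _ (\sum_(s <- enum {: F}) e1)).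
  apply: ler_sum => s _.
  by rewrite (Ex_act act_pmp (val s)^-1%g (bdd_norm (bddB (blab (t s)) (bpev (g (t s)))))).
by rewrite big_const_seq count_predT iter_addr_0 -cardE mulr_natl.
Qed.

Lemma label_polynomials N (e1 : R) : 0 < e1 -> exists g : 'I_N.+1 -> tpoly R G,
  (forall j x, 0 <= pev act S (g j) x <= 1) /\
  (forall j, Ex (fun x => `|(lab L N x == j)%:R - pev act S (g j) x|) <= e1).
Proof.
move=> e10.
have /choice[g gP] : forall j : 'I_N.+1, exists q, (forall x, 0 <= pev act S q x <= 1) /\
   Ex (fun x => `|(lab L N x == j)%:R - pev act S q x|) <= e1.
  move=> j; have mB : measurable [set x | lab L N x == j] by exact: (mlab_lab genP PL).
  have [_ /(_ _ e10)[p [[q pq] p01 pe]]] := unit_limit_measurable act_pmp mS S1 e_surj genS mB.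
  have pE : p = pev act S q by exact/funext.
  by exists q; rewrite -pE; split=> //; exact: ltW.
by exists g; split => j; have [] := gP j.
Qed.

(** If [g j] is close to the indicator of label [j], then [g j - g j ^+ 2] and
    [\sum_j g j - 1] are small in mean on [X], hence so are their images under
    [psi], and [rounding] applies to the latter. *)
Lemma rounded_polynomials N (g : 'I_N.+1 -> tpoly R G) (e1 eta : R) :
  (forall j x, 0 <= pev act S (g j) x <= 1) ->
  (forall j, Ex (fun x => `|(lab L N x == j)%:R - pev act S (g j) x|) <= e1) ->
  0 < e1 -> 0 < eta ->
  eventually (fun d sigma psi => exists q : {ffun 'I_d -> 'I_N.+1}, forall j,
    mean (fun k => `|(q k == j)%:R - psi (pev act S (g j)) k|) <=
    4 * (N.+1%:R * (e1 + eta)) + Num.sqrt (N.+1%:R ^+ 2 * e1 + eta)).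
Proof.
move=> g01 ge1 e10 eta0.
pose C := 1 + \sum_j weight (g j).
have C0 : 0 < C by rewrite ltr_pwDl// sumr_ge0// => j _; exact: weight_ge0.
have Cw j : weight (g j) <= C.
  rewrite /C (bigD1 j)//= addrCA lerDl addr_ge0// sumr_ge0// => i _; exact: weight_ge0.
pose z := eta / (4 + C).
have z0 : 0 < z by rewrite divr_gt0// addr_gt0.
(* the polynomial [\sum_j g j - 1] *)
pose sumq : tpoly R G := (-1, [::]) :: flatten [seq g j | j <- enum 'I_N.+1].
have sumqE x : pev act S sumq x = \sum_j pev act S (g j) x - 1.
  rewrite /sumq /pev big_cons /mev big_nil mulr1 addrC; congr (_ - _).
  by rewrite big_flatten big_map big_enum.
have H1 := eventually_all (fun j => eventually_pevd act_pmp mS S1 (g j) z0).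
have H2 := eventually_all (fun j => eventually_pevd act_pmp mS S1 (pmul (g j) (g j)) z0).
have H3 := eventually_all (fun j => eventually_Ex act_pmp mS S1 (g j) z0).
have H4 := eventually_all (fun j => eventually_Ex act_pmp mS S1 (pmul (g j) (g j)) z0).
have H5 := eventually_sqr act_pmp mS S1 sumq eta0.
have := eventually_and H1 (eventually_and H2 (eventually_and H3 (eventually_and H4 H5))).
apply: eventually_mono => d sigma psi d0 psiP [{}H1 [{}H2 [{}H3 [{}H4 {}H5]]]].
have y01 j k : 0 <= psi (pev act S (g j)) k <= 1 by exact: psi01.
have [q qP] := rounding y01; exists q => j; apply: le_trans (qP j) _.
have xi1 n k : `|xi_of S psi n k| <= 1 by exact: norm_xi.
apply: lerD.
  rewrite ler_wpM2l//; apply: (@le_trans _ _ (\sum_(i < N.+1) (e1 + eta))); last first.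
    by rewrite sumr_const card_ord mulr_natl.
  apply: ler_sum => i _; rewrite meanB//.
  have m1 : mean (psi (pev act S (g i))) <= Ex (pev act S (g i)) + z.
    by have := H3 i; rewrite ler_norml => /andP[_]; lra.
  have m2 : Ex (pev act S (pmul (g i) (g i))) - z <= mean (psi (pev act S (pmul (g i) (g i)))).
    by have := H4 i; rewrite ler_norml => /andP[+ _]; lra.
  have m3 : mean (psi (pev act S (pmul (g i) (g i)))) -
            mean (fun k => psi (pev act S (g i)) k ^+ 2) <= z + (1 + C) * z.
    rewrite -meanB//; apply: (@le_trans _ _ (mean (fun k =>
      `|psi (pev act S (pmul (g i) (g i))) k - pevd sigma (xi_of S psi) (pmul (g i) (g i)) k| +
      (1 + C) * `|psi (pev act S (g i)) k - pevd sigma (xi_of S psi) (g i) k|))).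
      apply: le_mean => k; rewrite pevd_mul.
      set a := psi _ k; set b := psi _ k; set c := pevd _ _ _ _.
      rewrite (_ : a - _ = (a - c * c) + (c + b) * (c - b)); last by ring.
      rewrite lerD ?ler_norm// (le_trans (ler_norm _))// normrM (distrC b).
      rewrite ler_wpM2r// (le_trans (ler_normD _ _))// addrC lerD//.
        by have /andP[b0 b1] := y01 i k; rewrite ger0_norm.
      by apply: le_trans (Cw i); exact: norm_pevd.
    rewrite meanD// meanZ//; apply: lerD; first exact: H2.
    by apply: ler_wpM2l; [apply: addr_ge0 => //; exact: ltW|exact: H1].
  have m4 : Ex (pev act S (g i)) - Ex (pev act S (pmul (g i) (g i))) <= e1.
    rewrite -ExB//; apply: le_trans (ge1 i); apply: le_Ex; first exact: bddB.
      by apply: bdd_norm; exact: bddB.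
    move=> x; rewrite pev_mul; have /andP[g0 g1] := g01 i x.
    by case: (lab L N x == i); rewrite /= ler_normr; apply/orP; [left|right]; nra.
  have zE : eta = 4 * z + C * z by rewrite -mulrDl /z mulrC divfK// gt_eqF// addr_gt0.
  move: m1 m2 m3 m4; rewrite zE [in (1 + _) * _]mulrDl; move: (C * z) => w.
  move: (mean (psi (pev act S (g i)))) (Ex (pev act S (g i)))
   (mean (psi (pev act S (pmul (g i) (g i))))) (Ex (pev act S (pmul (g i) (g i))))
   (mean (fun k => psi (pev act S (g i)) k ^+ 2)) => a1 a2 a3 a4 a5.
  by lra.
rewrite -[leLHS]ger0_norm ?mean_ge0// -sqrtr_sqr ler_wsqrtr//.
have -> : mean (fun k => `|\sum_i psi (pev act S (g i)) k - 1|) = mean (fun k => `|psi (pev act S sumq) k|).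
  apply: eq_mean => k; have -> : pev act S sumq = fun x => \sum_j pev act S (g j) x - 1.
    exact/funext.
  rewrite psiB//; [|by apply: bdd_sum|exact: bdd_cst].
  by rewrite psi_sum// psi_cst.
apply: le_trans H5 _; rewrite lerD2r.
have bsq : bdd (fun x => \sum_j `|(lab L N x == j)%:R - pev act S (g j) x|).
  by apply: bdd_sum => i _; apply: bdd_norm; exact: bddB.
apply: (@le_trans _ _ (Ex (fun x => N.+1%:R * (\sum_j `|(lab L N x == j)%:R - pev act S (g j) x|)))).
  apply: le_Ex; [exact: bdd_sqr|exact: bddZ|].
  move=> x; rewrite sumqE.
  have -> : \sum_j pev act S (g j) x - 1 = - \sum_j ((lab L N x == j)%:R - pev act S (g j) x).
    rewrite sumrB opprB; congr (_ - _).
    by rewrite (bigD1 (lab L N x))//= eqxx big1 ?addr0// => i; rewrite eq_sym => /negbTE ->.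
  rewrite sqrrN expr2 (le_trans (ler_norm _))// normrM.
  have le1 i : `|(lab L N x == i)%:R - pev act S (g i) x| <= 1.
    have /andP[g0 g1] := g01 i x.
    by rewrite ler_norml; case: (lab L N x == i) => /=; apply/andP; split; lra.
  apply: ler_pM => //; last exact: ler_norm_sum.
  apply: (le_trans (ler_norm_sum _ _ _)); apply: (@le_trans _ _ (\sum_(i < N.+1) 1)).
    by apply: ler_sum => i _.
  by rewrite sumr_const card_ord.
rewrite ExZ// expr2 -mulrA ler_wpM2l// Ex_sum; last by move=> i _; apply: bdd_norm; exact: bddB.
apply: (@le_trans _ _ (\sum_(i < N.+1) e1)); first by apply: ler_sum => i _.
by rewrite sumr_const card_ord mulr_natl.
Qed.

Lemma dist_bool_le1 (b : bool) (y : R) : 0 <= y <= 1 -> `|b%:R - y| <= 1.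
Proof.
by move=> /andP[y0 y1]; rewrite ler_norml; case: b => /=; apply/andP; split; lra.
Qed.

Definition round_error (N : nat) (e1 eta : R) : R :=
  4 * (N.+1%:R * (e1 + eta)) + Num.sqrt (N.+1%:R ^+ 2 * e1 + eta).

(** Almost multiplicativity and equivariance extend the agreement of [psi (g j)]
    with the indicators of [q] to products of translates, that is, to names. *)
Lemma encode_atoms (F : {fset G}) N (g : 'I_N.+1 -> tpoly R G) (e1 eta : R) :
  (forall j x, 0 <= pev act S (g j) x <= 1) ->
  (forall j, Ex (fun x => `|(lab L N x == j)%:R - pev act S (g j) x|) <= e1) ->
  0 < e1 -> 0 < eta ->
  eventually (fun d sigma psi => exists q : {ffun 'I_d -> 'I_N.+1},
    forall t : {ffun F -> 'I_N.+1},
    mean (fun k => `|psi (pev act S (pprod g t)) k - (named sigma F q k == t)%:R|) <=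
    eta + #|{: F}|%:R * round_error N e1 eta).
Proof.
move=> g01 ge1 e10 eta0.
pose C := 1 + \sum_j weight (g j).
have C1 : 1 <= C by rewrite lerDl sumr_ge0// => j _; exact: weight_ge0.
have Cw j : weight (g j) <= C.
  rewrite /C (bigD1 j)//= addrCA lerDl addr_ge0// sumr_ge0// => i _; exact: weight_ge0.
pose n := size (enum {: F}).
pose K : R := 1 + C ^+ n * (n%:R * 2).
have K0 : 0 < K by rewrite ltr_pwDl// !mulr_ge0// exprn_ge0// (le_trans _ C1).
pose z := eta / K.
have z0 : 0 < z by rewrite divr_gt0.
have H1 := eventually_all (fun t => eventually_pevd act_pmp mS S1 (pprod (F:=F) g t) z0).
have H2 := eventually_all (fun j => eventually_pevd act_pmp mS S1 (g j) z0).
have H3 := eventually_all (fun sj : F * 'I_N.+1 =>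
  eventually_trans mu act mS S1 (val sj.1) (g sj.2) z0).
have H4 := rounded_polynomials g01 ge1 e10 eta0.
have := eventually_and H1 (eventually_and H2 (eventually_and H3 H4)).
apply: eventually_mono => d sigma psi d0 psiP [{}H1 [{}H2 [{}H3 [q {}H4]]]].
exists q => t.
have xi1 n' k : `|xi_of S psi n' k| <= 1 by exact: norm_xi.
have y01 j k : 0 <= psi (pev act S (g j)) k <= 1 by exact: psi01.
pose xi := xi_of S psi.
pose a (s : F) k := pevd sigma xi (ptrans (val s) (g (t s))) k.
pose y (s : F) k := psi (pev act S (g (t s))) ((sigma (val s))^-1%g k).
have aC s k : `|a s k| <= C.
  by rewrite (le_trans (norm_pevd _ _ _ xi1))// weight_ptrans.
have yC s k : `|y s k| <= C.
  by have /andP[y0 y1] := y01 (t s) ((sigma (val s))^-1%g k); rewrite ger0_norm ?(le_trans y1).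
have ay s : mean (fun k => `|a s k - y s k|) <= 2 * z.
  rewrite (le_trans (le_mean_dist _ (fun k => pevd sigma xi (g (t s)) ((sigma (val s))^-1%g k)) _))//.
  rewrite mulr2n mulrDl mul1r lerD//; first exact: (H3 (s, t s)).
  rewrite (mean_perm ((sigma (val s))^-1%g) (fun k => `|pevd sigma xi (g (t s)) k - psi (pev act S (g (t s))) k|)).
  by rewrite mean_distC; exact: H2.
rewrite (le_trans (le_mean_dist _ (fun k => pevd sigma xi (pprod g t) k) _))//.
have etaE : eta = z + C ^+ n * (n%:R * (2 * z)).
  rewrite (_ : z + _ = K * z); last by rewrite /K; ring.
  by rewrite /z mulrC divfK// gt_eqF.
apply: (@le_trans _ _ (z + (C ^+ n * (n%:R * (2 * z)) + #|{: F}|%:R * round_error N e1 eta)));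
  last by rewrite addrA -etaE.
apply: lerD; first exact: H1.
rewrite (le_trans (le_mean_dist _ (fun k => \prod_(s <- enum {: F}) y s k) _))// lerD//.
  apply: (@le_trans _ _ (mean (fun k => C ^+ n * \sum_(s <- enum {: F}) `|a s k - y s k|))).
    apply: le_mean => k; rewrite pevd_pprod.
    by apply: prod_dist => // s; exact: aC.
  rewrite meanZ// ler_wpM2l ?exprn_ge0 ?(le_trans _ C1)// mean_sum//.
  apply: (@le_trans _ _ (\sum_(s <- enum {: F}) 2 * z)); first by apply: ler_sum => s _.
  by rewrite big_const_seq count_predT iter_addr_0 -[leLHS]mulr_natl.
apply: (@le_trans _ _ (mean (fun k => \sum_(s <- enum {: F})
    `|y s k - (q ((sigma (val s))^-1%g k) == t s)%:R|))).
  apply: le_mean => k; rewrite named_ind.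
  have := @prod_dist R _ (enum {: F}) (fun s => y s k)
    (fun s => (q ((sigma (val s))^-1%g k) == t s)%:R) 1 (lexx _).
  rewrite expr1n mul1r; apply=> s; last by rewrite normr_nat; case: (_ == _).
  by have /andP[y0 y1] := y01 (t s) ((sigma (val s))^-1%g k); rewrite ger0_norm.
rewrite mean_sum//; apply: (@le_trans _ _ (\sum_(s <- enum {: F}) round_error N e1 eta)).
  apply: ler_sum => s _.
  rewrite (mean_perm ((sigma (val s))^-1%g) (fun k => `|psi (pev act S (g (t s))) k - (q k == t s)%:R|)).
  by rewrite mean_distC; exact: H4.
by rewrite big_const_seq count_predT iter_addr_0 -cardE mulr_natl.
Qed.

(** The [partition_defect] of the partition into the classes of [q]. *)
Definition defect (d N : nat) (sigma : G -> 'S_d) (F : {fset G}) (q : {ffun 'I_d -> 'I_N.+1}) : R :=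
  \sum_(t : {ffun F -> 'I_N.+1})
    `|prob mu (name act L F N) t - mean (fun k => (named sigma F q k == t)%:R)|.

(** The statistics of the names of [q] are those of the names on [X], since both
    are close to the averages of the polynomials [pprod g t].  And if the name
    of a point of [X] determines [S a] up to a small error, then the names of
    [q] determine [psi (S a)] by the same function [c a]. *)
Lemma encode_rUP (F : {fset G}) N K (c : 'I_K -> {ffun F -> 'I_N.+1} -> R) (eps delta : R) :
  0 < eps -> 0 < delta -> (forall a t, `|c a t| <= 1) ->
  (forall a : 'I_K, Ex (fun x => `|S a x - c a (name act L F N x)|) <= eps ^+ 2 / 32) ->
  eventually (fun d sigma psi => exists q : {ffun 'I_d -> 'I_N.+1},
    defect sigma F q <= delta /\
    forall a : 'I_K, mean (fun k => `|psi (S a) k - c a (named sigma F q k)|) <= eps).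
Proof.
move=> eps0 delta0 c1 Sc.
pose T : R := #|{: {ffun F -> 'I_N.+1}}|%:R.
pose n : R := #|{: F}|%:R.
have T0 : 0 <= T by [].
have n0 : 0 <= n by [].
pose w := Num.min (eps / 2 / (1 + T)) (delta / 3 / (1 + T)).
have T10 : 0 < 1 + T by rewrite ltr_pwDl.
have w0 : 0 < w by rewrite lt_min !divr_gt0.
pose B1 : R := 1 + n * (8 * N.+1%:R + N.+2%:R).
have B10 : 0 < B1 by rewrite ltr_pwDl// mulr_ge0// addr_ge0.
pose B2 : R := 2 * (1 + T) * T * n + 1.
have B20 : 0 < B2 by rewrite ltr_wpDl// !mulr_ge0// ltW.
(* [th] is the tolerance; the square root in [round_error] is why [e1] is its square *)
pose th : R := Num.min 1 (Num.min (w / B1) (eps ^+ 2 / 8 / B2)).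
have th0 : 0 < th by rewrite !lt_min ltr01 !divr_gt0// exprn_gt0.
have th1 : th <= 1 by rewrite ge_min lexx.
have thw : th * B1 <= w by rewrite -ler_pdivlMr// !ge_min lexx orbT.
have the : th * B2 <= eps ^+ 2 / 8 by rewrite -ler_pdivlMr// !ge_min lexx !orbT.
pose e1 := th ^+ 2.
have e10 : 0 < e1 by rewrite exprn_gt0.
have e1th : e1 <= th by rewrite /e1 expr2 ler_piMr// ltW.
have [g [g01 ge1]] := @label_polynomials N e1 e10.
have err : e1 + n * round_error N e1 e1 <= w.
  apply: le_trans thw.
  rewrite (_ : th * B1 = th + n * (th * (8 * N.+1%:R + N.+2%:R))); last by rewrite /B1; ring.
  apply: lerD => //; rewrite ler_wpM2l//.
  rewrite [leRHS]mulrDr /round_error; apply: lerD.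
    rewrite (_ : 4 * (N.+1%:R * (e1 + e1)) = e1 * (8 * N.+1%:R)); last by ring.
    by rewrite ler_wpM2r// mulr_ge0.
  rewrite -[leRHS]ger0_norm ?mulr_ge0 ?(ltW th0)// -sqrtr_sqr ler_wsqrtr//.
  rewrite exprMn -/e1 -[N.+2%:R]natr1 sqrrD1 -[X in _ + X <= _]mulr1 [_ * e1]mulrC -mulrDr ler_wpM2l ?(ltW e10)//.
  by rewrite lerD2r lerDl mulrn_wge0.
(* the error of recovering [S a] from the polynomials that stand for the names *)
pose Qp a : tpoly R G := (1, [:: (1%g, val a)]) ::
  flatten [seq pscale (- c a t) (pprod g t) | t <- enum {: {ffun F -> 'I_N.+1}}].
have QpE a x : pev act S (Qp a) x = S a x - \sum_t c a t * pev act S (pprod g t) x.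
  rewrite /Qp /pev big_cons {1}/mev big_seq1/= invg1 (act1 act_pmp) mul1r; congr (_ + _).
  rewrite big_flatten big_map big_enum/= -sumrN; apply: eq_bigr => t _.
  by rewrite -/(pev act S (pscale (- c a t) (pprod g t)) x) pev_scale mulNr.
have bpp t := bpev (pprod (F:=F) g t).
have bsum a : bdd (fun x => \sum_t c a t * pev act S (pprod g t) x).
  by apply: bdd_sum => t _; exact: bddZ.
have bn (f : {ffun F -> 'I_N.+1} -> R) : bdd (fun x => f (name act L F N x)).
  exact: (bdd_lab f (mlab_name act_pmp genP PL (F:=F) (N:=N))).
have nT (t : {ffun F -> 'I_N.+1}) := Ex_pprod t g01 ge1.
have pp01 (t : {ffun F -> 'I_N.+1}) x : 0 <= pev act S (pprod g t) x <= 1.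
  rewrite pev_pprod prodr_ge0 ?prodr_ile1// => s _.
  by have /andP[] := g01 (t s) (act (val s)^-1%g x).
have sq a : Ex (fun x => pev act S (Qp a) x ^+ 2) + e1 <= (eps / 2) ^+ 2.
  have bu : bdd (fun x => `|S a x - c a (name act L F N x)|).
    by apply: bdd_norm; apply: bddB => //; exact: bn.
  have bv : bdd (fun x => \sum_t `|(name act L F N x == t)%:R - pev act S (pprod g t) x|).
    apply: bdd_sum => t _; apply: bdd_norm; apply: bddB => //.
    exact: (bn (fun u => (u == t)%:R)).
  apply: (@le_trans _ _ (4 * (eps ^+ 2 / 32) + 2 * (1 + T) * (T * (n * e1)) + e1)).
    rewrite lerD2r.
    apply: (@le_trans _ _ (Ex (fun x => 4 * `|S a x - c a (name act L F N x)| +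
      2 * (1 + T) * (\sum_t `|(name act L F N x == t)%:R - pev act S (pprod g t) x|)))).
      apply: le_Ex; first by apply: bdd_sqr; exact: bpev.
        by apply: bddD; exact: bddZ.
      move=> x; rewrite QpE.
      set u := S a x - c a (name act L F N x).
      pose v := \sum_t c a t * ((name act L F N x == t)%:R - pev act S (pprod g t) x).
      have uv : S a x - \sum_t c a t * pev act S (pprod g t) x = u + v.
        rewrite /u /v; under [X in _ = _ + X]eq_bigr do rewrite mulrBr.
        rewrite sumrB [X in _ + (X - _)](_ : _ = c a (name act L F N x)); first by ring.
        by rewrite [RHS]sum_ind.
      have u2 : `|u| <= 2.
        by rewrite (le_trans (ler_normB _ _))// -[2]/(1 + 1) lerD.
      have vT : `|v| <= \sum_t `|(name act L F N x == t)%:R - pev act S (pprod g t) x|.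
        rewrite (le_trans (ler_norm_sum _ _ _))//; apply: ler_sum => t _.
        by rewrite normrM ler_piMl.
      set V := \sum_t `|_| in vT *.
      have v1 : V <= 1 + T.
        apply: (@le_trans _ _ (\sum_(t : {ffun F -> 'I_N.+1}) 1)).
          by apply: ler_sum => t _; apply: dist_bool_le1.
        by rewrite sumr_const lerDr.
      rewrite uv; apply: (@le_trans _ _ (2 * u ^+ 2 + 2 * v ^+ 2)).
        by rewrite -subr_ge0 (_ : _ - _ = (u - v) ^+ 2) ?sqr_ge0//; ring.
      have uu : u ^+ 2 <= 2 * `|u|.
        by rewrite -real_normK ?num_real// expr2 ler_wpM2r.
      have vv : v ^+ 2 <= (1 + T) * V.
        by rewrite -real_normK ?num_real// expr2 ler_pM// (le_trans vT).
      rewrite (_ : 2 * (1 + T) * V = 2 * ((1 + T) * V)); last by ring.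
      rewrite (_ : 4 * `|u| = 2 * (2 * `|u|)); last by ring.
      by rewrite lerD// ler_wpM2l.
    rewrite ExD; [|exact: bddZ|exact: bddZ].
    rewrite ExZ// ExZ// lerD//; first by rewrite ler_wpM2l.
    rewrite ler_wpM2l ?mulr_ge0 ?(ltW T10)// Ex_sum.
      apply: (@le_trans _ _ (\sum_(t : {ffun F -> 'I_N.+1}) n * e1)).
        by apply: ler_sum => t _; exact: nT.
      by rewrite sumr_const -[leLHS]mulr_natl.
    move=> t _; apply: bdd_norm; apply: bddB => //.
    exact: (bn (fun u => (u == t)%:R)).
  rewrite -addrA (_ : _ + e1 = e1 * B2); last by rewrite /B2; ring.
  have : e1 * B2 <= eps ^+ 2 / 8.
    by apply: le_trans the; rewrite ler_wpM2r ?(ltW B20).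
  by rewrite exprMn; move: (e1 * B2) (eps ^+ 2) => x1 x2; lra.
have H1 := @encode_atoms F N g e1 e1 g01 ge1 e10 e10.
have H2 := eventually_all (fun a => eventually_sqr act_pmp mS S1 (Qp a) e10).
have H3 := eventually_all (fun t => eventually_Ex act_pmp mS S1 (pprod (F:=F) g t) e10).
have := eventually_and H1 (eventually_and H2 H3).
apply: eventually_mono => d sigma psi d0 psiP [[q {}H1] [{}H2 {}H3]].
have {}H1 t : mean (fun k => `|psi (pev act S (pprod g t)) k - (named sigma F q k == t)%:R|) <= w.
  by rewrite (le_trans (H1 t)).
exists q; split.
  apply: (@le_trans _ _ (\sum_(t : {ffun F -> 'I_N.+1}) (delta / (1 + T)))); last first.
    by rewrite sumr_const -mulr_natr mulrAC ler_pdivrMr// ler_wpM2l ?(ltW delta0)// lerDr.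
  apply: ler_sum => t _.
  rewrite (_ : delta / (1 + T) = delta / 3 / (1 + T) + (delta / 3 / (1 + T) + delta / 3 / (1 + T))); last first.
    by field; rewrite gt_eqF.
  have wd : w <= delta / 3 / (1 + T) by rewrite ge_min lexx orbT.
  rewrite (le_trans (ler_distD (Ex (pev act S (pprod g t))) _ _))// lerD//.
    rewrite /prob -ExB//; last exact: (bn (fun u => (u == t)%:R)).
    rewrite (le_trans (le_norm_Ex _ _))//; first by apply: bddB => //; exact: (bn (fun u => (u == t)%:R)).
    rewrite (le_trans (nT t))// (le_trans _ wd)// (le_trans _ err)//.
    rewrite -[leLHS]add0r lerD ?(ltW e10)// ler_wpM2l// /round_error.
    rewrite -[leLHS]addr0 lerD ?sqrtr_ge0// mulrA -[leLHS]mul1r ler_pM//; [exact: ltW| |by rewrite lerDl ltW].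
    by rewrite -natrM ler1n.
  rewrite (le_trans (ler_distD (mean (psi (pev act S (pprod g t)))) _ _))// lerD//.
    rewrite distrC (le_trans (H3 t))// (le_trans _ wd)// (le_trans _ err)// lerDl mulr_ge0//.
    by rewrite /round_error addr_ge0 ?sqrtr_ge0// !mulr_ge0// addr_ge0// ltW.
  by rewrite -meanB (le_trans (le_norm_mean _))// (le_trans (H1 t)).
move=> a.
rewrite (le_trans (le_mean_dist _ (psi (fun x => \sum_t c a t * pev act S (pprod g t) x)) _))//.
rewrite [leRHS]splitr lerD//.
  have -> : (fun k => `|psi (S a) k - psi (fun x => \sum_t c a t * pev act S (pprod g t) x) k|) =
     fun k => `|psi (pev act S (Qp a)) k|.
    apply/funext => k; have -> : pev act S (Qp a) = fun x => S a x - \sum_t c a t * pev act S (pprod g t) x.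
      exact/funext.
    by rewrite psiB.
  rewrite -(@ler_pXn2r _ 2)// ?nnegrE ?mean_ge0//; first exact: le_trans (H2 a) (sq a).
  by rewrite divr_ge0// ltW.
apply: (@le_trans _ _ (mean (fun k => \sum_t `|psi (pev act S (pprod g t)) k - (named sigma F q k == t)%:R|))).
  apply: le_mean => k; rewrite psi_sum//; last by move=> t; exact: bddZ.
  rewrite [c a _]sum_ind -sumrB (le_trans (ler_norm_sum _ _ _))//.
  by apply: ler_sum => t _; rewrite psiZ// -mulrBr normrM ler_piMl.
rewrite mean_sum//; apply: (@le_trans _ _ (\sum_(t : {ffun F -> 'I_N.+1}) (eps / 2 / (1 + T)))).
  by apply: ler_sum => t _; rewrite (le_trans (H1 t))// ge_min lexx.
have e20 : 0 <= eps / 2 by rewrite divr_ge0// ltW.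
move: e20; move: (eps / 2) => x x0.
by rewrite sumr_const -mulr_natr mulrAC ler_pdivrMr// ler_wpM2l ?lerDr.
Qed.

End Encode.

(** * From a labelling to a positive map *)

Section Decode.
Context (R : realType) (G : groupType) (dX : measure_display)
  (X : measurableType dX) (mu : probability X R) (act : G -> X -> X).
Hypothesis act_pmp : pmp_action mu act.
Context (e : nat -> G) (e_surj : forall s, exists n, e n = s).
Context (P : nat -> set X) (genP : generating_partition mu act P).
Context (L : X -> nat) (PL : forall n x, P n x <-> L x = n).
Context (S : nat -> X -> R) (mS : forall n, measurable_fun setT (S n))
  (S1 : forall n x, `|S n x| <= 1).
Hypothesis genS : dynamically_generating mu act (range (fun n => cplx (S n))).
Local Notation Ex := (Ex mu).
Local Notation eventually := (@eventually R G _ X mu act S).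
Let bS n : bdd (S n). Proof. exact: (bdd_S mS). Qed.
Let bpev q : bdd (pev act S q). Proof. exact: (bdd_pev act_pmp mS S1). Qed.
Let blab N j : bdd (fun x => (lab L N x == j)%:R : R).
Proof. exact: (bdd_ind R (fun i => i == j) (mlab_lab genP PL (N:=N))). Qed.

Section Conditional.
Context (d N : nat) (sigma : G -> 'S_d) (F : {fset G}) (q : {ffun 'I_d -> 'I_N.+1}).
Hypothesis d0 : (0 < d)%N.
Implicit Types f : X -> R.

Let nm : X -> {ffun F -> 'I_N.+1} := name act L F N.
Let mnm : mlab nm. Proof. exact: (mlab_name act_pmp genP PL (F:=F) (N:=N)). Qed.
Let bn (c : {ffun F -> 'I_N.+1} -> R) : bdd (fun x => c (nm x)).
Proof. exact: bdd_lab. Qed.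

(** At names of measure zero, where there is no conditional average, the integral
    of [f] is used in order to keep the map unital. *)
Definition cvalue f (t : {ffun F -> 'I_N.+1}) : R :=
  if prob mu nm t == 0 then Ex f else cexp mu nm f t.

(** The positive map defined by a labelling: [f] is averaged over the points of [X]
    that have the name of [k]. *)
Definition psiq f (k : 'I_d) : R := cvalue f (named sigma F q k).

Lemma cvalueM f t : bdd f -> cvalue f t * prob mu nm t = Ex (fun x => f x * (nm x == t)%:R).
Proof.
move=> bf; rewrite -(cexpM mu _ mnm bf) /cvalue; case: eqP => [->|//].
by rewrite !mulr0.
Qed.

Lemma cexp_lin c f g t : bdd f -> bdd g ->
  cexp mu nm (fun x => c * f x + g x) t = c * cexp mu nm f t + cexp mu nm g t.
Proof.
move=> bf bg; rewrite /cexp mulrA -mulrDl; congr (_ / _).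
have bt : bdd (fun x => (nm x == t)%:R : R) by exact: (bn (fun u => (u == t)%:R)).
under eq_Ex do rewrite mulrDl -mulrA.
by rewrite ExD ?ExZ//; [exact: bddM|apply: bddZ; exact: bddM|exact: bddM].
Qed.

Lemma psiq_positive : real_positive psiq.
Proof.
split.
- move=> c f g bf bg k; rewrite /psiq /cvalue; case: eqP => _; last exact: cexp_lin.
  by rewrite ExD ?ExZ//; exact: bddZ.
- move=> k; rewrite /psiq /cvalue; case: eqP => [_|p0]; first by rewrite Ex_cst.
  rewrite /cexp (_ : Ex _ = prob mu nm (named sigma F q k)) ?divff//; first exact/eqP.
  by apply: eq_Ex => x; rewrite mul1r.
- move=> f bf f0 k; rewrite /psiq /cvalue; case: eqP => _; first exact: Ex_ge0.
  rewrite /cexp divr_ge0 ?prob_ge0// Ex_ge0// => x.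
  by rewrite mulr_ge0.
Qed.

Lemma psiq_ae f g : measurable_fun setT f -> bdd g -> {ae mu, forall x, f x = g x} ->
  psiq f = psiq g.
Proof.
move=> mf bg fg; apply/funext => k; rewrite /psiq /cvalue; case: eqP => _.
  exact: Rint_ae.
rewrite /cexp; congr (_ / _); set t := named _ _ _ _.
have bt : bdd (fun x => (nm x == t)%:R : R) by exact: (bn (fun u => (u == t)%:R)).
apply: Rint_ae; [by apply: measurable_funM => //; case: bt|exact: bddM|].
by apply: filterS fg => x ->.
Qed.

Context (delta : R).
Hypothesis qdelta : defect mu act L sigma F q <= delta.

Lemma delta_ge0 : 0 <= delta.
Proof. by apply: le_trans qdelta; apply: sumr_ge0. Qed.

Lemma mean_named (c : {ffun F -> 'I_N.+1} -> R) :
  mean (fun k => c (named sigma F q k)) =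
  \sum_t c t * mean (fun k => (named sigma F q k == t)%:R).
Proof.
under eq_mean do rewrite [c _]sum_ind.
by rewrite mean_sum//; apply: eq_bigr => t _; rewrite meanZ.
Qed.

Lemma mean_psiq f (M : R) : bdd f -> (forall x, `|f x| <= M) ->
  `|mean (psiq f) - Ex f| <= M * delta.
Proof.
move=> bf fM.
have -> : Ex f = \sum_t cvalue f t * prob mu nm t.
  transitivity (Ex (fun x => f x * 1)); first by apply: eq_Ex => x; rewrite mulr1.
  rewrite (Ex_lab mu (fun=> 1) mnm bf); apply: eq_bigr => t _.
  by rewrite mul1r cvalueM.
rewrite mean_named -sumrB (le_trans (ler_norm_sum _ _ _))//.
have M0 : 0 <= M by rewrite -(Ex_cst mu M); apply: Ex_ge0 => x; rewrite (le_trans _ (fM x)).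
apply: (@le_trans _ _ (M * defect mu act L sigma F q)); last by rewrite ler_wpM2l.
rewrite mulr_sumr; apply: ler_sum => t _; rewrite -mulrBr normrM distrC ler_wpM2r//.
rewrite /cvalue; case: eqP => _; last exact: norm_cexp.
rewrite (le_trans (le_norm_Ex _ bf))// -(Ex_cst mu M); apply: le_Ex => //; first exact: bdd_norm.
exact: bdd_cst.
Qed.

Lemma mean_norm_psiq f (M : R) : bdd f -> (forall x, `|f x| <= M) ->
  mean (fun k => `|psiq f k|) <= Ex (fun x => `|f x|) + M * delta.
Proof.
move=> bf fM; apply: (@le_trans _ _ (mean (psiq (fun x => `|f x|)))).
  apply: le_mean => k; rewrite ler_norml; apply/andP; split.
    rewrite lerNl -[leLHS]mulN1r -(psiZ psiq_positive)//; apply: (le_psi psiq_positive).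
    - exact: bddZ.
    - exact: bdd_norm.
    - by move=> x; rewrite mulN1r -normrN ler_norm.
  apply: (le_psi psiq_positive) => //; first exact: bdd_norm.
  by move=> x; exact: ler_norm.
have nM x : `|(`|f x|)| <= M by rewrite normr_id.
have := mean_psiq (bdd_norm bf) nM; rewrite ler_norml => /andP[_].
by rewrite lerBlDl.
Qed.

Lemma psiq_name (c : {ffun F -> 'I_N.+1} -> R) (C : R) : (forall t, `|c t| <= C) ->
  mean (fun k => `|psiq (fun x => c (nm x)) k - c (named sigma F q k)|) <= 2 * C * delta.
Proof.
move=> cC.
have C0 : 0 <= C by rewrite (le_trans _ (cC [ffun=> ord0])).
pose bad t : R := (prob mu nm t == 0)%:R.
apply: (@le_trans _ _ (mean (fun k => 2 * C * bad (named sigma F q k)))).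
  apply: le_mean => k; rewrite /psiq /cvalue /bad; set t := named _ _ _ _.
  case: eqP => [_|/eqP p0]; last first.
    rewrite (_ : cexp _ _ _ _ = c t) ?subrr ?normr0 ?mulr0//.
    rewrite /cexp (_ : Ex _ = c t * prob mu nm t) ?mulfK//.
    rewrite /prob -ExZ; last exact: (bn (fun u => (u == t)%:R)).
    by apply: eq_Ex => x; case: eqP => [->|_]; rewrite ?mulr0.
  rewrite mulr1 (le_trans (ler_normB _ _))// mulr2n mulrDl mul1r lerD//.
  rewrite (le_trans (le_norm_Ex _ _))// -(Ex_cst mu C); apply: le_Ex => //.
    by apply: bdd_norm.
  exact: bdd_cst.
rewrite meanZ// ler_wpM2l ?mulr_ge0// mean_named; apply: le_trans qdelta.
apply: ler_sum => t _; rewrite /bad; case: eqP => [->|_]; last by rewrite mul0r.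
by rewrite mul1r sub0r normrN ler_norm.
Qed.

(** One [2 * delta] pays for the passage from means to integrals, the other for
    the places whose name has measure zero in [X]. *)
Lemma psiq_approx f (c : {ffun F -> 'I_N.+1} -> R) (eps : R) : bdd f ->
  (forall x, `|f x| <= 1) -> (forall t, `|c t| <= 1) ->
  Ex (fun x => `|f x - c (nm x)|) <= eps ->
  mean (fun k => `|psiq f k - c (named sigma F q k)|) <= eps + 4 * delta.
Proof.
move=> bf f1 c1 fc.
rewrite (le_trans (le_mean_dist _ (psiq (fun x => c (nm x))) _))//.
rewrite (_ : _ + 4 * _ = (eps + 2 * delta) + 2 * 1 * delta); last by ring.
rewrite lerD//; last exact: psiq_name.
have -> : (fun k => `|psiq f k - psiq (fun x => c (nm x)) k|) =
    fun k => `|psiq (fun x => f x - c (nm x)) k|.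
  by apply/funext => k; rewrite (psiB psiq_positive).
apply: le_trans (mean_norm_psiq (M := 2) _ _) _; first exact: bddB.
  by move=> x; rewrite (le_trans (ler_normB _ _))// -[2]/(1 + 1) lerD.
by rewrite lerD2r.
Qed.

End Conditional.

(** If [F3] contains the products of [s] and elements of [F2], the name of [x] along
    [F3] determines the name of its translate by [s^-1] along [F2]; the default
    label is not reached then. *)
Definition pull (F2 F3 : {fset G}) N (s : G) (t : {ffun F3 -> 'I_N.+1}) : {ffun F2 -> 'I_N.+1} :=
  [ffun h : F2 => if insub (s * val h)%g is Some h' then t h' else ord0].

Lemma pull_name (F2 F3 : {fset G}) N s x : (forall h, h \in F2 -> (s * h)%g \in F3) ->
  pull F2 s (name act L F3 N x) = name act L F2 N (act s^-1%g x).
Proof.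
move=> H; apply/ffunP => h; rewrite !ffunE insubT ?H ?fsvalP// => hF.
by rewrite ffunE /= (actVM act_pmp).
Qed.

Lemma pull_named (F2 F3 : {fset G}) d N (sigma : G -> 'S_d) (q : {ffun 'I_d -> 'I_N.+1}) s k :
  (forall h, h \in F2 -> (s * h)%g \in F3) ->
  pull F2 s (named sigma F3 q k) = [ffun h : F2 => q ((sigma (s * val h)%g)^-1%g k)].
Proof.
move=> H; apply/ffunP => h; rewrite !ffunE insubT ?H ?fsvalP// => hF.
by rewrite ffunE.
Qed.

(** Names along [F2] determine the [S a] up to [eps]; [F3] contains enough products
    for the names along [F3] to determine their translates.  Functions of names
    are treated by [psiq] as if it were an equivariant homomorphism, up to
    the defects of [q] and of [sigma], so that all conditions hold for the
    translates of [S a]. *)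
Lemma decode_rUP (F' : {fset G}) (m' : nat) (delta' : R) : 0 < delta' ->
  exists (F3 : {fset G}) (N0 : nat), 1%g \in F3 /\ forall N, (N0 <= N)%N ->
  exists (Fg : {fset G}) (delta3 : R), 0 < delta3 /\
  forall d (sigma : G -> 'S_d) (q : {ffun 'I_d -> 'I_N.+1}), (0 < d)%N ->
    almost_mult sigma Fg delta3 -> defect mu act L sigma F3 q <= delta3 ->
    rUP mu act S sigma F' m' delta' (psiq sigma F3 q).
Proof.
move=> delta'0.
pose m : R := m'%:R.
pose eps := delta' / (8 * (1 + m)).
have m0 : 0 < 1 + m by rewrite ltr_pwDl.
have eps0 : 0 < eps by rewrite divr_gt0// mulr_gt0.
have /choice[FN FNP] : forall a : 'I_m', exists FN : {fset G} * nat, forall F N,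
    (FN.1 `<=` F)%fset -> (FN.2 <= N)%N ->
    exists c : {ffun F -> 'I_N.+1} -> R, (forall t, `|c t| <= 1) /\
      Ex (fun x => `|S a x - c (name act L F N x)|) < eps.
  move=> a; have [F0 [N0 H]] := name_approx act_pmp e_surj genP PL (bS a) (S1 a) ler01 eps0.
  by exists (F0, N0).
pose F2 : {fset G} := \big[fsetU/fset0]_(a < m') (FN a).1.
pose N0 := \max_(a < m') (FN a).2.
pose F1 : {fset G} := (1%g |` F')%fset.
pose F3 : {fset G} := (1%g |` [fset (p.1 * p.2)%g | p in (F1 `*` F2)])%fset.
have inF3 s h : s \in F1 -> h \in F2 -> (s * h)%g \in F3.
  move=> sF hF; rewrite !inE; apply/orP; right; apply/imfsetP; exists (s, h) => //.
  by rewrite inE /= sF hF.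
exists F3, N0; split; first by rewrite !inE eqxx.
move=> N N0N.
have /choice[c cP] : forall a : 'I_m', exists c : {ffun F2 -> 'I_N.+1} -> R,
    (forall t, `|c t| <= 1) /\ Ex (fun x => `|S a x - c (name act L F2 N x)|) < eps.
  move=> a; apply: FNP; first by rewrite /F2 (bigD1 a)//= fsubsetUl.
  by rewrite (leq_trans _ N0N)// (@leq_bigmax _ (fun a : 'I_m' => (FN a).2)).
pose n2 : R := #|{: F2}|%:R.
have n20 : 0 < 1 + n2 by rewrite ltr_pwDl.
(* the first bound is for the [m] factors of a product, the second for the places
   where [sigma] is not multiplicative on a translation of [F2] *)
pose delta3 := Num.min (delta' / (32 * (1 + m))) (delta' / (8 * (1 + n2))).
exists (F1 `|` F2)%fset, delta3; split.
  by rewrite lt_min !divr_gt0// mulr_gt0.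
move=> d sigma q d0 gs qd.
have d30 : 0 <= delta3 := delta_ge0 qd.
have err : eps + 4 * delta3 <= delta' / (4 * (1 + m)).
  have d32 : delta3 <= delta' / (32 * (1 + m)) by rewrite ge_min lexx.
  have -> : delta' / (4 * (1 + m)) = eps + 4 * (delta' / (32 * (1 + m))).
    by rewrite /eps; field; rewrite gt_eqF.
  by rewrite lerD2l ler_wpM2l.
have d3n : 2 * n2 * delta3 <= delta' / 4.
  have d8 : delta3 <= delta' / (8 * (1 + n2)) by rewrite ge_min lexx orbT.
  apply: (@le_trans _ _ (2 * (1 + n2) * (delta' / (8 * (1 + n2))))).
    by apply: ler_pM => //; [rewrite mulr_ge0|rewrite ler_wpM2l// lerDr].
  by rewrite le_eqVlt; apply/orP; left; apply/eqP; field; rewrite gt_eqF.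
have d3d : delta3 < delta'.
  apply: (@le_lt_trans _ _ (delta' / (32 * (1 + m)))); first by rewrite ge_min lexx.
  rewrite ltr_pdivrMr ?mulr_gt0// ltr_pMr//.
  by rewrite (@lt_le_trans _ _ 32) ?ler_peMr ?lerDl// (ltr_nat R 1 32).
have psiP := psiq_positive sigma F3 q.
pose cs (s : G) (a : 'I_m') (t : {ffun F3 -> 'I_N.+1}) := c a (pull F2 s t).
have cs1 s a t : `|cs s a t| <= 1 by have [H _] := cP a; exact: H.
have csP s (a : 'I_m') : s \in F1 -> Ex (fun x => `|S a (act s^-1%g x) - cs s a (name act L F3 N x)|) <= eps.
  move=> sF; rewrite ltW//; have [_] := cP a.
  rewrite -(Ex_act act_pmp s^-1%g); last first.
    apply: bdd_norm; apply: bddB => //.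
    exact: (bdd_lab (c a) (mlab_name act_pmp genP PL (F:=F2) (N:=N))).
  congr (_ < _); apply: eq_Ex => x; rewrite /cs pull_name// => h hF; exact: inF3.
have bSa s a : bdd (fun x => S a (act s x)) by exact: (bdd_act act_pmp).
have key s (a : 'I_m') : s \in F1 -> mean (fun k => `|psiq sigma F3 q (fun x => S a (act s^-1%g x)) k -
    cs s a (named sigma F3 q k)|) <= eps + 4 * delta3.
  by move=> sF; apply: psiq_approx => //; exact: csP.
have m4 : m * (delta' / (4 * (1 + m))) <= delta' / 4.
  rewrite (_ : m * _ = (m / (1 + m)) * (delta' / 4)); last by field; rewrite gt_eqF.
  by rewrite ler_piMl ?divr_ge0 ?(ltW delta'0)// ler_pdivrMr// mul1r lerDr.
have m5 : delta' / (4 * (1 + m)) <= delta' / 4.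
  rewrite invfM mulrA ler_piMr ?divr_ge0 ?(ltW delta'0)//.
  by rewrite invf_le1// lerDl.
split=> //.
- move=> l /andP[l0 lm] /allP al.
  pose cc (p : G * nat) (t : {ffun F3 -> 'I_N.+1}) : R :=
    if insub p.2 is Some a then cs p.1 a t else 0.
  have cc1 p t : `|cc p t| <= 1 by rewrite /cc; case: insubP => [a _ _|_]; rewrite ?normr0.
  have ccP p : p \in l -> Ex (fun x => `|S p.2 (act p.1^-1%g x) - cc p (name act L F3 N x)|) <= eps.
    move=> /al /andP[pF pm]; rewrite /cc insubT/=.
    by apply: (csP p.1 (Ordinal pm)); rewrite !inE pF orbT.
  have keyp p : p \in l -> mean (fun k => `|psiq sigma F3 q (fun x => S p.2 (act p.1^-1%g x)) k -
      cc p (named sigma F3 q k)|) <= eps + 4 * delta3.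
    by move=> pl; apply: psiq_approx => //; exact: ccP.
  pose c' (t : {ffun F3 -> 'I_N.+1}) := \prod_(p <- l) cc p t.
  have c'1 t : `|c' t| <= 1 by rewrite /c' normr_prod prodr_ile1// => p _; rewrite normr_ge0 cc1.
  have bcn (f : {ffun F3 -> 'I_N.+1} -> R) : bdd (fun x => f (name act L F3 N x)).
    exact: (bdd_lab f (mlab_name act_pmp genP PL (F:=F3) (N:=N))).
  have bmev : bdd (mev act S l) by exact: (bdd_mev act_pmp).
  have c'P : Ex (fun x => `|mev act S l x - c' (name act L F3 N x)|) <= (size l)%:R * eps.
    apply: (@le_trans _ _ (Ex (fun x => \sum_(p <- l)
        `|S p.2 (act p.1^-1%g x) - cc p (name act L F3 N x)|))).
      apply: le_Ex.
      - by apply: bdd_norm; apply: bddB => //; exact: bcn.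
      - by apply: bdd_sum => p _; apply: bdd_norm; apply: bddB => //; exact: bcn.
      move=> x; have := @prod_dist R _ l (fun p => S p.2 (act p.1^-1%g x))
        (fun p => cc p (name act L F3 N x)) 1 (lexx _).
      by rewrite expr1n mul1r; apply.
    rewrite Ex_sum; last by move=> p _; apply: bdd_norm; apply: bddB => //; exact: bcn.
    rewrite big_seq_cond; apply: (@le_trans _ _ (\sum_(p <- l | (p \in l) && true) eps)).
      by apply: ler_sum => p; rewrite andbT => /ccP.
    by rewrite -big_seq_cond big_const_seq count_predT iter_addr_0 mulr_natl.
  rewrite (le_lt_trans (le_mean_dist _ (fun k => c' (named sigma F3 q k)) _))//.
  apply: (@le_lt_trans _ _ (m * (delta' / (4 * (1 + m))) + m * (delta' / (4 * (1 + m))))); last first.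
    by apply: le_lt_trans (lerD m4 m4) _; lra.
  have lm' : (size l)%:R <= m by rewrite ler_nat.
  have l1 : 1 <= (size l)%:R :> R by rewrite ler1n.
  have e40 : 0 <= eps + 4 * delta3 by move: (ltW eps0) d30 => {}eps0 {}d30; apply: addr_ge0 => //; exact: mulr_ge0.
  apply: lerD.
    have PA : mean (fun k => `|psiq sigma F3 q (mev act S l) k - c' (named sigma F3 q k)|) <=
        (size l)%:R * eps + 4 * delta3.
      by apply: psiq_approx => // x; exact: mev_le1.
    apply: le_trans PA _.
    apply: (@le_trans _ _ ((size l)%:R * (eps + 4 * delta3))).
      by rewrite mulrDr lerD2l ler_peMl// mulr_ge0.
    by apply: ler_pM.
  apply: (@le_trans _ _ (mean (fun k => \sum_(p <- l)
     `|psiq sigma F3 q (fun x => S p.2 (act p.1^-1%g x)) k - cc p (named sigma F3 q k)|))).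
    apply: le_mean => k; rewrite distrC.
    have := @prod_dist R _ l (fun p => psiq sigma F3 q (fun x => S p.2 (act p.1^-1%g x)) k)
        (fun p => cc p (named sigma F3 q k)) 1 (lexx _).
    by rewrite expr1n mul1r; apply=> p //; apply: norm_psi.
  rewrite mean_sum// big_seq_cond.
  apply: (@le_trans _ _ (\sum_(p <- l | (p \in l) && true) (eps + 4 * delta3))).
    by apply: ler_sum => p; rewrite andbT => /keyp.
  rewrite -big_seq_cond big_const_seq count_predT iter_addr_0 -[leLHS]mulr_natl.
  by apply: ler_pM.
- move=> l _ _; apply: le_lt_trans d3d; rewrite -[leRHS]mul1r.
  by apply: mean_psiq => //; [exact: (bdd_mev act_pmp)|move=> x; exact: mev_le1].
- move=> s n sF nm; pose a : 'I_m' := Ordinal nm.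
  have sF1 : s \in F1 by rewrite !inE sF orbT.
  have oF1 : 1%g \in F1 by rewrite !inE eqxx.
  have k1 := key s a sF1; have k2 := key 1%g a oF1.
  have S1E : (fun x => S a (act 1^-1%g x)) = S a.
    by apply/funext => x; rewrite invg1 (act1 act_pmp).
  rewrite S1E in k2.
  rewrite (le_lt_trans (le_mean_dist _ (fun k => cs s a (named sigma F3 q k)) _))//.
  apply: (@le_lt_trans _ _ (delta' / 4 + (delta' / 4 + delta' / 4))); last by lra.
  apply: lerD; first by apply: le_trans k1 _; exact: le_trans err m5.
  apply: (le_trans (le_mean_dist _ (fun k => cs 1%g a (named sigma F3 q ((sigma s)^-1%g k))) _)).
  apply: lerD; last first.
    rewrite (mean_perm ((sigma s)^-1%g) (fun k => `|cs 1%g a (named sigma F3 q k) - psiq sigma F3 q (S a) k|)).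
    by rewrite mean_distC; apply: le_trans k2 _; exact: le_trans err m5.
  apply: le_trans d3n; apply: (@le_trans _ _ (mean (fun k => \sum_(h <- enum {: F2})
     2 * ((sigma (s * val h)%g)^-1%g k != (sigma (val h))^-1%g ((sigma s)^-1%g k))%:R))).
    apply: le_mean => k; rewrite /cs !pull_named//; try by move=> h hF; exact: inF3.
    have [E|/allPn[h hF E]] := boolP (all (fun h : F2 => (sigma (s * val h)%g)^-1%g k ==
        (sigma (val h))^-1%g ((sigma s)^-1%g k)) (enum {: F2})).
      rewrite (_ : [ffun h => q ((sigma (s * val h)%g)^-1%g k)] =
         [ffun h : F2 => q ((sigma (1 * val h)%g)^-1%g ((sigma s)^-1%g k))]).
        by rewrite subrr normr0 sumr_ge0// => h _; rewrite mulr_ge0.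
      apply/ffunP => h; rewrite !ffunE mul1g; congr (q _); apply/eqP.
      by apply: (allP E); rewrite mem_enum.
    rewrite big_enum/= (bigD1 h)//= E mulr1.
    have [ca1 _] := cP a.
    rewrite (le_trans (ler_normB _ _))// -[leLHS]addr0 lerD//.
      by rewrite -[2]/(1 + 1) lerD.
    by rewrite sumr_ge0// => h' _; rewrite mulr_ge0.
  rewrite mean_sum//; apply: (@le_trans _ _ (\sum_(h <- enum {: F2}) 2 * delta3)).
    apply: ler_sum => h _; rewrite meanZ// ler_wpM2l//; apply: gs.
      by rewrite inE sF1.
    by rewrite inE fsvalP orbT.
  by rewrite big_const_seq count_predT iter_addr_0 -cardE -[leLHS]mulr_natl /n2 mulrA [_ * 2]mulrC.
Qed.

(** The merging of the labels from [n] on. *)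
Definition coarse (n N : nat) (i : 'I_N.+1) : 'I_n.+1 := inord (minn i n).

Lemma coarse_lab n N x : (n <= N)%N -> coarse n (lab L N x) = lab L n x.
Proof.
by move=> nN; apply/val_inj; rewrite /= labE inordK ?ltnS ?geq_minr// labE -minnA (minn_idPr nN).
Qed.

(** The indicators of the coarse labels are approximated by polynomials in the
    translates of [S], and the maps at hand almost commute with the evaluation
    of polynomials.  If two of them are close at the [S a] that occur, they are
    therefore close at these indicators, which means that the coarse labellings
    agree at most places. *)
Lemma separation (n : nat) (eta : R) : 0 < eta ->
  exists (eps : R) (K : nat) (F0 : {fset G}) (m0 : nat) (delta0 : R),
  [/\ 0 < eps, 0 < delta0 & forall N (F3 : {fset G}) d (sigma : G -> 'S_d) (q1 q2 : {ffun 'I_d -> 'I_N.+1}),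
    (n <= N)%N -> 1%g \in F3 -> (0 < d)%N -> almost_mult sigma F0 delta0 ->
    defect mu act L sigma F3 q1 <= delta0 -> defect mu act L sigma F3 q2 <= delta0 ->
    rUP mu act S sigma F0 m0 delta0 (psiq sigma F3 q1) ->
    rUP mu act S sigma F0 m0 delta0 (psiq sigma F3 q2) ->
    (forall a, (a < K)%N -> mean (fun k => `|psiq sigma F3 q1 (S a) k - psiq sigma F3 q2 (S a) k|) <= eps) ->
    mean (fun k => (coarse n (q1 k) != coarse n (q2 k))%:R) <= eta].
Proof.
move=> eta0.
pose z := eta / n.+1%:R / 16.
have z0 : 0 < z by rewrite !divr_gt0.
have [g [g01 ge1]] := label_polynomials act_pmp e_surj genP PL mS S1 genS n z0.
have [F0 [m0 [delta0 [delta00 H]]]] := eventually_all (fun j => eventually_pevd act_pmp mS S1 (g j) z0).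
have [Fa [K HK]] := admissible_large (flatten [seq g j | j <- enum 'I_n.+1]).
have HKg j p : p \in g j -> (size p.2 <= K)%N /\ admissible Fa K p.2.
  move=> pg; apply: HK; apply/flattenP; exists (g j) => //.
  by apply/mapP; exists j => //; rewrite mem_enum.
pose W := 1 + \sum_j weight (g j).
have W0 : 0 < W by rewrite ltr_pwDl// sumr_ge0// => j _; exact: weight_ge0.
have Ww j : weight (g j) <= W.
  rewrite /W (bigD1 j)//= addrCA lerDl addr_ge0// sumr_ge0// => i _; exact: weight_ge0.
have K0 : 0 < 1 + K%:R :> R by rewrite ltr_pwDl.
pose eps := z / W / (1 + K%:R).
have eps0 : 0 < eps by rewrite !divr_gt0.
exists eps, K, F0, m0, (Num.min delta0 (z / 4)); split => //.
  by rewrite lt_min delta00 divr_gt0.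
move=> N F3 d sigma q1 q2 nN oF3 d0 gs def1 def2 up1 up2 close.
have dd : Num.min delta0 (z / 4) <= delta0 by rewrite ge_min lexx.
have dz : Num.min delta0 (z / 4) <= z / 4 by rewrite ge_min lexx orbT.
have gs' := almost_mult_sub (fsubset_refl _) dd gs.
have {}H q : rUP mu act S sigma F0 m0 (Num.min delta0 (z / 4)) (psiq sigma F3 q) ->
    forall j, mean (fun k => `|psiq sigma F3 q (pev act S (g j)) k - pevd sigma (xi_of S (psiq sigma F3 q)) (g j) k|) <= z.
  by move=> up; apply: H => //; apply: rUP_sub up.
pose o := [` oF3]%fset.
pose ind (j : 'I_n.+1) (t : {ffun F3 -> 'I_N.+1}) : R := (coarse n (t o) == j)%:R.
have indE j (q : {ffun 'I_d -> 'I_N.+1}) k : ind j (named sigma F3 q k) = (coarse n (q ((sigma 1%g)^-1%g k)) == j)%:R.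
  by rewrite /ind ffunE.
have approx j (q : {ffun 'I_d -> 'I_N.+1}) : defect mu act L sigma F3 q <= Num.min delta0 (z / 4) ->
    mean (fun k => `|psiq sigma F3 q (pev act S (g j)) k - ind j (named sigma F3 q k)|) <= 2 * z.
  move=> def; apply: (@le_trans _ _ (z + 4 * Num.min delta0 (z / 4))); last by lra.
  apply: psiq_approx => //.
  - by move=> x; have /andP[p0 p1] := g01 j x; rewrite ger0_norm.
  - by move=> t; rewrite /ind normr_nat; case: (_ == _).
  apply: le_trans (ge1 j); rewrite le_eqVlt; apply/orP; left; apply/eqP.
  apply: eq_Ex => x; rewrite distrC /ind; congr (`|_%:R - _|).
  by rewrite ffunE /= invg1 (act1 act_pmp) coarse_lab.
have pevd_close j : mean (fun k => `|pevd sigma (xi_of S (psiq sigma F3 q1)) (g j) k -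
     pevd sigma (xi_of S (psiq sigma F3 q2)) (g j) k|) <= z.
  apply: (@le_trans _ _ (mean (fun k => \sum_(p <- g j) `|p.1| * \sum_(h <- p.2)
    `|psiq sigma F3 q1 (S h.2) ((sigma h.1)^-1%g k) - psiq sigma F3 q2 (S h.2) ((sigma h.1)^-1%g k)|))).
    apply: le_mean => k; rewrite /pevd -sumrB (le_trans (ler_norm_sum _ _ _))//.
    apply: ler_sum => p _; rewrite -mulrBr normrM ler_wpM2l//.
    have := @prod_dist R _ p.2 (fun h => xi_of S (psiq sigma F3 q1) h.2 ((sigma h.1)^-1%g k))
      (fun h => xi_of S (psiq sigma F3 q2) h.2 ((sigma h.1)^-1%g k)) 1 (lexx _).
    rewrite expr1n mul1r; apply=> h; apply: norm_xi => //; exact: psiq_positive.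
  rewrite mean_sum//; apply: (@le_trans _ _ (\sum_(p <- g j) `|p.1| * ((1 + K%:R) * eps))).
    rewrite big_seq_cond [leRHS]big_seq_cond; apply: ler_sum => p; rewrite andbT => /HKg[pK /allP pa].
    rewrite meanZ// ler_wpM2l// mean_sum// big_seq_cond.
    apply: (@le_trans _ _ (\sum_(h <- p.2 | (h \in p.2) && true) eps)).
      apply: ler_sum => h; rewrite andbT => /pa /andP[_ hK].
      rewrite (mean_perm ((sigma h.1)^-1%g) (fun k => `|psiq sigma F3 q1 (S h.2) k - psiq sigma F3 q2 (S h.2) k|)).
      exact: close.
    rewrite -big_seq_cond big_const_seq count_predT iter_addr_0 -[leLHS]mulr_natl.
    apply: ler_wpM2r; first exact: ltW.
    by rewrite addrC natr1 ler_nat ltnW// ltnS.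
  rewrite -mulr_suml -/(weight (g j)).
  have -> : (1 + K%:R) * eps = z / W by rewrite /eps mulrC divfK// gt_eqF.
  by rewrite mulrA ler_pdivrMr// mulrC ler_wpM2l// ltW.
have fin j : mean (fun k => `|ind j (named sigma F3 q1 k) - ind j (named sigma F3 q2 k)|) <= 7 * z.
  apply: (@le_trans _ _ (2 * z + (z + (z + (z + 2 * z))))); last by lra.
  apply: le_trans (le_mean_dist _ (psiq sigma F3 q1 (pev act S (g j))) _) _.
  apply: lerD; first by rewrite mean_distC; exact: approx.
  apply: le_trans (le_mean_dist _ (pevd sigma (xi_of S (psiq sigma F3 q1)) (g j)) _) _.
  apply: lerD; first exact: H.
  apply: le_trans (le_mean_dist _ (pevd sigma (xi_of S (psiq sigma F3 q2)) (g j)) _) _.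
  apply: lerD; first exact: pevd_close.
  apply: le_trans (le_mean_dist _ (psiq sigma F3 q2 (pev act S (g j))) _) _.
  apply: lerD; first by rewrite mean_distC; exact: H.
  exact: approx.
(* [sigma 1] is a permutation, but it need not be the identity *)
rewrite -(mean_perm ((sigma 1%g)^-1%g)).
apply: (@le_trans _ _ (mean (fun k => \sum_j `|ind j (named sigma F3 q1 k) - ind j (named sigma F3 q2 k)|))).
  apply: le_mean => k; under eq_bigr do rewrite !indE.
  set a := coarse n (q1 _); set b := coarse n (q2 _).
  case: eqP => ab; first by rewrite sumr_ge0.
  rewrite (bigD1 a)//= eqxx; have /negbTE -> : b != a by apply/eqP => /esym.
  by rewrite subr0 normr1 lerDl sumr_ge0.
rewrite mean_sum//; apply: (@le_trans _ _ (\sum_(j < n.+1) 7 * z)); first by apply: ler_sum => j _; exact: fin.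
rewrite sumr_const card_ord -[leLHS]mulr_natl.
rewrite (_ : n.+1%:R * (7 * z) = 7 / 16 * eta); first by lra.
rewrite /z; have : n.+1%:R != 0 :> R by rewrite pnatr_eq0.
by move: (n.+1%:R : R) => x x0; field.
Qed.

End Decode.

(** * Counting labellings *)

Section Counting.
Context (R : realType).

(** The weights [\prod_k w k (l k)] of all labellings add up to at most one. *)
Lemma weight_bound d (T : finType) (A : {set {ffun 'I_d -> T}}) (w : 'I_d -> T -> R) (c : R) :
  (forall k j, 0 <= w k j) -> (forall k, \sum_j w k j <= 1) ->
  (forall l : {ffun 'I_d -> T}, l \in A -> c <= \prod_k w k (l k)) -> #|A|%:R * c <= 1.
Proof.
move=> w0 w1 cA.
have : \prod_k \sum_j w k j <= 1.
  by apply: prodr_ile1 => k _; rewrite w1 andbT sumr_ge0.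
apply: le_trans; rewrite bigA_distr_bigA /= mulr_natl -sumr_const.
rewrite [leRHS](bigID (mem A)) /= -[leLHS]addr0 lerD//; first exact: ler_sum.
by apply: sumr_ge0 => l _; apply: prodr_ge0.
Qed.

Lemma weight_count d (T : finType) (A : {set {ffun 'I_d -> T}}) (w : 'I_d -> T -> R) (B : R) :
  (forall k j, 0 < w k j) -> (forall k, \sum_j w k j <= 1) ->
  (forall l : {ffun 'I_d -> T}, l \in A -> \sum_k - ln (w k (l k)) <= B) ->
  #|A|%:R <= expR B.
Proof.
move=> w0 w1 cA; rewrite -[leRHS]mul1r -ler_pdivrMr ?expR_gt0//.
rewrite -expRN; apply: (weight_bound (w := w)) => // [k j|l lA]; first exact: ltW.
have -> : \prod_k w k (l k) = expR (\sum_k ln (w k (l k))).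
  by rewrite expR_sum; apply: eq_bigr => k _; rewrite lnK ?posrE.
by rewrite ler_expR lerNl -sumrN; exact: cA.
Qed.

Lemma frac_le (a x : R) : 0 <= a -> 0 <= x -> a * (x / (1 + a)) <= x.
Proof.
by move=> a0 x0; rewrite mulrA ler_pdivrMr ?ltr_pwDl// mulrDr mulr1 mulrC lerDr.
Qed.

Definition ent (x : R) : R := - (x * ln x).

(** With [theta := 1 - exp (- kappa / 4)], a reference label is given the weight
    [1 - theta] in [counting], and each other label [theta / m.+1]; this
    is the proportion of wrong labels that costs at most [kappa / 4]. *)
Definition hamming_radius (kappa : R) (m : nat) : R :=
  kappa / 4 / (1 - ln ((1 - expR (- (kappa / 4))) / m.+1%:R)).

Lemma hamming_radius_gt0 kappa m : 0 < kappa -> 0 < hamming_radius kappa m.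
Proof.
move=> k0; have k4 : 0 < kappa / 4 by rewrite divr_gt0.
rewrite /hamming_radius divr_gt0// ltr_pwDl// oppr_ge0 ln_le0//.
by rewrite ler_pdivrMr ?ltr0n// mul1r (@le_trans _ _ 1) ?(ler_nat R 1)// gerBl expR_ge0.
Qed.

Section Weights.
Context (T T' : finType) (pi : T -> T') (D : pred T) (p : T -> R) (kappa : R).
Hypotheses (kappa0 : 0 < kappa) (piD : forall i j, pi i = pi j -> i != j -> D i)
  (p0 : forall j, 0 <= p j) (pD : \sum_(j | D j) p j <= 2^-1)
  (entD : \sum_(j | D j) ent (p j) <= kappa / 4).

Let M : R := #|T|%:R + 1.
Let M0 : 0 < M. Proof. by rewrite ltr_wpDl. Qed.
Let theta : R := 1 - expR (- (kappa / 4)).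
Let theta01 : 0 < theta < 1.
Proof.
by rewrite /theta subr_gt0 expR_lt1 oppr_lt0 divr_gt0//= ltrBlDr ltrDl expR_gt0.
Qed.
Let m1 : R := #|T'|.+1%:R.
Let m10 : 0 < m1. Proof. by rewrite ltr0n. Qed.

(** The weight of label [j] at a place is the product of [v], which pays for the
    coarse label and is cheap at the reference label, and of [w1], which pays for
    a label of [D] given its class.  Half of the uniform weight is mixed with [p]
    to keep [w1] away from zero. *)
Let w1 (j : T) : R := if D j then p j + 2^-1 / M else 1.
Let v (c0 c : T') : R := if c == c0 then 1 - theta else theta / m1.

Let w1_gt0 j : 0 < w1 j.
Proof. by rewrite /w1; case: ifP => // _; rewrite ltr_wpDl// divr_gt0. Qed.

Let v_gt0 c0 c : 0 < v c0 c.
Proof.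
by have /andP[t0 t1] := theta01; rewrite /v; case: ifP => _; rewrite ?subr_gt0// divr_gt0.
Qed.

Let sum_D : \sum_(j | D j) w1 j <= 1.
Proof.
rewrite (eq_bigr (fun j => p j + 2^-1 / M)); last by move=> j Dj; rewrite /w1 Dj.
rewrite big_split /= (le_trans (lerD pD (lexx _)))//.
rewrite sumr_const -[X in 2^-1 + X]mulr_natl.
have : #|[pred j | D j]|%:R <= M by rewrite /M ler_wpDr// ler_nat max_card.
move: (#|_|%:R : R) => c cM; have cM1 : c / M <= 1 by rewrite ler_pdivrMr// mul1r.
by rewrite mulrCA; lra.
Qed.

Let w1_le1 j : w1 j <= 1.
Proof.
have [Dj|nD] := boolP (D j); last by rewrite /w1 (negbTE nD).
apply: le_trans sum_D; rewrite (bigD1 j)//= lerDl sumr_ge0// => i _; exact: ltW.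
Qed.

Let sum_class c : \sum_(j | pi j == c) w1 j <= 1.
Proof.
have [/existsP[i /andP[/eqP ic nD]]|/existsPn H] := boolP [exists i, (pi i == c) && ~~ D i].
  rewrite (bigD1 i)/= ?ic// big1 ?addr0// => j /andP[/eqP jc ji].
  by case/negP: nD; apply: (piD (j := j)); rewrite 1?ic 1?jc// eq_sym.
apply: le_trans sum_D.
rewrite [leRHS](bigID (fun j => pi j == c)) /= -[leLHS]addr0 lerD//; last first.
  by apply: sumr_ge0 => j _; exact: ltW.
rewrite le_eqVlt; apply/orP; left; apply/eqP; apply: eq_bigl => j.
by have := H j; rewrite negb_and negbK; case: (pi j == c); case: (D j).
Qed.

Let sum_w c0 : \sum_j v c0 (pi j) * w1 j <= 1.
Proof.
have /andP[t0 t1] := theta01.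
rewrite (partition_big pi xpredT)//=; apply: (@le_trans _ _ (\sum_c v c0 c)).
  apply: ler_sum => c _.
  rewrite (eq_bigr (fun j => v c0 c * w1 j)); last by move=> j /eqP ->.
  rewrite -mulr_sumr; apply: ler_piMr; [exact/ltW/v_gt0|exact: sum_class].
rewrite (bigD1 c0)//= {1}/v eqxx.
apply: (@le_trans _ _ ((1 - theta) + \sum_(c : T') theta / m1)).
  rewrite lerD2l [leRHS](bigD1 c0)//= -[leLHS]add0r; apply: lerD; first by rewrite divr_ge0 ?ltW.
  by apply: ler_sum => c; rewrite /v => /negbTE ->.
rewrite sumr_const -[X in _ + X]mulr_natl.
have : #|T'|%:R <= m1 by rewrite ler_nat.
rewrite (_ : #|_| = #|T'|)//; move: (#|T'|%:R : R) => c cm.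
have : c / m1 * theta <= 1 * theta by apply: ler_wpM2r; [exact: ltW|by rewrite ler_pdivrMr// mul1r].
by rewrite mul1r => ct; rewrite -addrA gerDl addrC subr_le0 mulrCA mulrC.
Qed.

(** By [weight_count], it suffices that the mean of [- ln] of the weight along [l]
    is at most [kappa].  There are four contributions of [kappa / 4]: the coarse
    labels that agree with [l0], those that do not, the entropy carried by [D],
    and the deviation of the frequencies of the labels from [p]. *)
Lemma counting : exists2 delta : R, 0 < delta & forall d (A : {set {ffun 'I_d -> T}}) (l0 : 'I_d -> T'),
  (0 < d)%N -> (forall (l : {ffun 'I_d -> T}) j, l \in A -> mean (fun k => (l k == j)%:R) <= p j + delta) ->
  (forall l : {ffun 'I_d -> T}, l \in A -> mean (fun k => (pi (l k) != l0 k)%:R) <= hamming_radius kappa #|T'|) ->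
  #|A|%:R <= expR (kappa * d%:R).
Proof.
pose Dl : R := \sum_j - ln (w1 j).
have nln j : 0 <= - ln (w1 j) by rewrite oppr_ge0 ln_le0.
have Dl0 : 0 <= Dl by exact: sumr_ge0.
have Dl1 : 0 < 1 + Dl by rewrite ltr_pwDl.
have [t0 t1] := andP theta01.
have k40 : 0 < kappa / 4 by rewrite divr_gt0.
exists (kappa / 4 / (1 + Dl)); first by rewrite divr_gt0.
set delta := _ / _ => d A l0 d0 marg ham.
apply: (weight_count (w := fun k j => v (l0 k) (pi j) * w1 j)) => //.
  by move=> k j; exact: mulr_gt0.
move=> l lA.
pose B := - ln (theta / m1).
have B0 : 0 <= B.
  rewrite oppr_ge0 ln_le0// ler_pdivrMr// mul1r (le_trans (ltW t1))//.
  by rewrite (ler_nat R 1).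
have vE c0 c : - ln (v c0 c) <= kappa / 4 + B * (c != c0)%:R.
  rewrite /v; case: eqP => _; last by rewrite mulr1 lerDr ltW.
  by rewrite mulr0 addr0 /theta subKr expRK opprK.
have wE : \sum_k - ln (v (l0 k) (pi (l k)) * w1 (l k)) <=
   \sum_k (kappa / 4 + B * (pi (l k) != l0 k)%:R + \sum_(j | D j) - ln (w1 j) * (l k == j)%:R).
  apply: ler_sum => k _; rewrite lnM ?posrE// opprD; apply: lerD; first exact: vE.
  have [DL|nD] := boolP (D (l k)).
    rewrite (bigD1 (l k))//= eqxx mulr1 lerDl sumr_ge0// => j _; exact: mulr_ge0.
  rewrite {1}/w1 (negbTE nD) ln1 oppr0 sumr_ge0// => j _; exact: mulr_ge0.
apply: le_trans wE _.
have dr0 : 0 < d%:R :> R by rewrite ltr0n.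
rewrite -ler_pdivrMr// mulrC -/(mean _).
have -> : mean (fun k => kappa / 4 + B * (pi (l k) != l0 k)%:R + \sum_(j | D j) - ln (w1 j) * (l k == j)%:R)
  = kappa / 4 + B * mean (fun k => (pi (l k) != l0 k)%:R) + \sum_(j | D j) - ln (w1 j) * mean (fun k => (l k == j)%:R).
  rewrite !meanD mean_cst// meanZ; congr (_ + _).
  rewrite /mean exchange_big mulr_sumr; apply: eq_bigr => j _ /=.
  by rewrite -mulr_sumr mulrCA.
have h1 : B * mean (fun k => (pi (l k) != l0 k)%:R) <= kappa / 4.
  have B1 : 0 < 1 + B by rewrite ltr_pwDl.
  apply: (@le_trans _ _ (B * (kappa / 4 / (1 + B)))).
    apply: ler_wpM2l => //; have := ham _ lA.
    by rewrite /hamming_radius -/theta -/m1 /B.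
  by apply: frac_le => //; exact: ltW.
have h2 : \sum_(j | D j) - ln (w1 j) * mean (fun k => (l k == j)%:R) <= kappa / 4 + kappa / 4.
  apply: (@le_trans _ _ (\sum_(j | D j) (ent (p j) + - ln (w1 j) * delta))).
    apply: ler_sum => j Dj.
    apply: (@le_trans _ _ (- ln (w1 j) * (p j + delta))); first by rewrite ler_wpM2l// marg.
    rewrite mulrDr lerD2r /ent mulNr lerN2 mulrC.
    have [->|pj] := eqVneq (p j) 0; first by rewrite !mulr0.
    have pj0 : 0 < p j by rewrite lt_def pj p0.
    by apply: ler_wpM2r => //; rewrite ler_ln ?posrE// /w1 Dj lerDl divr_ge0// ltW.
  rewrite big_split /= lerD// -mulr_suml.
  apply: (@le_trans _ _ (Dl * delta)).
    apply: ler_wpM2r; first by rewrite divr_ge0 ?ltW.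
    by rewrite /Dl [leRHS](bigID D) /= lerDl sumr_ge0.
  by apply: frac_le => //; exact: ltW.
lra.
Qed.

End Weights.

Section Tails.
Context (p : nat -> R).
Hypotheses (p0 : forall n, 0 <= p n) (p1 : forall n, p n <= 1)
  (psum : (fun M => \sum_(k < M) p k) @ \oo --> (1 : R))
  (H : R) (entH : forall M, \sum_(k < M) ent (p k) <= H).

Lemma ent_ge0 n : 0 <= ent (p n).
Proof. by rewrite /ent -mulrN mulr_ge0// oppr_ge0 ln_le0. Qed.

Let psum_nd : nondecreasing_seq (fun M => \sum_(k < M) p k).
Proof.
by apply/nondecreasing_seqP => n; rewrite big_ord_recr /= lerDl.
Qed.

Let esum_nd : nondecreasing_seq (fun M => \sum_(k < M) ent (p k)).
Proof.
by apply/nondecreasing_seqP => n; rewrite big_ord_recr /= lerDl ent_ge0.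
Qed.

Definition tail (n : nat) : R := 1 - \sum_(k < n) p k.

Lemma tail_ge0 n : 0 <= tail n.
Proof.
rewrite /tail subr_ge0 -(cvg_lim _ psum)//; apply: nondecreasing_cvgn_le => //.
by apply/cvg_ex; exists 1.
Qed.

(** Merging atoms does not increase entropy: [- ln] of the total mass is at most
    [- ln (p k)] for each of them. *)
Lemma ent_tail n (c : R) : (forall M, \sum_(n <= k < M) ent (p k) <= c) -> ent (tail n) <= c.
Proof.
move=> Hc; set t := tail n.
have c0 : 0 <= c by apply: le_trans (Hc n); rewrite big_geq.
have t0 : 0 <= t := tail_ge0 n.
have pt k : (n <= k)%N -> p k <= t.
  move=> nk; rewrite /t /tail lerBrDr.
  apply: (@le_trans _ _ (\sum_(j < k.+1) p j)); last by have := tail_ge0 k.+1; rewrite /tail subr_ge0.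
  by rewrite [leRHS]big_ord_recr /= addrC; apply: lerD => //; exact: psum_nd.
have psn : (fun M => - ln t * (\sum_(k < M) p k - \sum_(k < n) p k)) @ \oo --> - ln t * t.
  by apply: cvgMr; apply: cvgB psum _; exact: cvg_cst.
rewrite /ent mulrC -mulNr -(cvg_lim _ psn)//; apply: limr_le; first by apply/cvg_ex; eexists; exact: psn.
exists n => // M /= nM; apply: le_trans (Hc M).
have -> : \sum_(k < M) p k - \sum_(k < n) p k = \sum_(n <= k < M) p k.
  by rewrite -!(big_mkord xpredT p) (big_cat_nat _ nM)//= [X in X - _]addrC addrK.
rewrite mulr_sumr.
rewrite big_nat_cond [leRHS]big_nat_cond; apply: ler_sum => k /andP[/andP[nk kM] _].
have [->|pk] := eqVneq (p k) 0; first by rewrite /ent mulr0 mul0r oppr0.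
have pk0 : 0 < p k by rewrite lt_def pk p0.
rewrite /ent -mulrN mulrC ler_wpM2l// lerN2 ler_ln ?posrE ?pt//.
exact: lt_le_trans (pt _ nk).
Qed.

Lemma small_tails (c : R) : 0 < c -> exists n0, forall n, (n0 <= n)%N ->
  tail n <= c /\ forall M, \sum_(n <= k < M) ent (p k) <= c.
Proof.
move=> c0.
have tail0 : \forall n \near \oo, tail n <= c.
  have := psum => /cvgrPdist_le /(_ c c0); apply: filterS => n.
  by rewrite ler_norml => /andP[_]; rewrite /tail.
have ec : cvgn (fun M => \sum_(k < M) ent (p k)).
  by apply: nondecreasing_is_cvgn => //; exists H => _ [M _ <-]; exact: entH.
set l := limn (fun M => \sum_(k < M) ent (p k)).
have enear : \forall n \near \oo, l - \sum_(k < n) ent (p k) <= c.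
  have := ec => /cvgrPdist_le /(_ c c0); apply: filterS => n.
  by rewrite ler_norml => /andP[].
have [n0 _ n0P] := filterI tail0 enear.
exists n0 => n nn0; have [tn en] := n0P n nn0; split => // M.
have [nM|Mn] := leqP n M; last by rewrite big_geq ?ltW// ltnW.
have : \sum_(k < M) ent (p k) <= l by exact: nondecreasing_cvgn_le.
rewrite -!(big_mkord xpredT (fun k => ent (p k))) in en *.
rewrite (big_cat_nat _ nM)//=; move: en; move: (\sum_(0 <= k < n) _) (\sum_(n <= k < M) _) => a b.
lra.
Qed.

End Tails.
End Counting.

(** * Upper limits of rates, and labellings under coarsening *)

Section Rates.
Context (R : realType).
Local Open Scope ereal_scope.
Implicit Types u v : nat -> \bar R.

Definition rate (d : nat) (a : \bar R) : \bar R := (d%:R^-1)%:E * lne a.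

Lemma lee_lne0 (a b : \bar R) : 0 <= a -> a <= b -> lne a <= lne b.
Proof.
by move=> a0 ab; rewrite lee_lne// in_itv /= leey andbT// (le_trans a0).
Qed.

Lemma rate_le d (a b : \bar R) (kappa : R) : 0 <= a -> 0 <= b -> (0 <= kappa)%R ->
  ((0 < d)%N -> a <= b * (expR (kappa * d%:R))%:E) -> rate d a <= rate d b + kappa%:E.
Proof.
move=> a0 b0 k0; case: d => [_|d /(_ isT) ab].
  by rewrite /rate invr0 !mul0e add0e lee_fin.
have dinv : (0 <= d.+1%:R^-1 :> R)%R by rewrite invr_ge0.
have ek : 0 < (expR (kappa * d.+1%:R))%:E by rewrite lte_fin expR_gt0.
have : lne a <= lne b + (kappa * d.+1%:R)%:E.
  apply: le_trans (lee_lne0 a0 ab) _.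
  have [->|bn0] := eqVneq b 0; first by rewrite mul0e (le0_lneNy (lexx _)) leNye.
  rewrite lneM; first by rewrite lne_EFin ?expR_gt0// expRK.
  - by rewrite in_itv /= leey andbT lt_def bn0.
  - by rewrite in_itv /= leey andbT.
move=> H; rewrite /rate.
apply: (le_trans (lee_wpmul2l _ H)); first by rewrite lee_fin.
rewrite muleDr ?fin_num_adde_defl//; apply: leeD => //; rewrite -EFinM lee_fin mulrCA mulVf ?mulr1//.
Qed.

Lemma limn_esup_le u v (c : R) : (\forall i \near \oo, u i <= v i + c%:E) ->
  limn_esup u <= limn_esup v + c%:E.
Proof.
move=> uv; rewrite -leeBlDr//; apply: le_ereal_inf_tmp => _ [A nA <-].
rewrite leeBlDr//.
apply: (@le_trans _ _ (ereal_sup (u @` (A `&` [set i | u i <= v i + c%:E])))).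
  apply: ereal_inf_lbound; exists (A `&` [set i | u i <= v i + c%:E]) => //.
  exact: filterI.
apply: ge_ereal_sup => _ [i [Ai ui] <-]; apply: le_trans ui _.
by rewrite leeD2r//; apply: ereal_sup_ubound; exists i.
Qed.

(** The upper limit is at most [u n + c] for every late [n], hence at most the
    lower limit plus [c]. *)
Lemma cvg_almost_nonincreasing u :
  (forall c : R, (0 < c)%R -> exists n0, forall n N, (n0 <= n)%N -> (n <= N)%N ->
     u N <= u n + c%:E) -> cvgn u.
Proof.
move=> H.
have es := @is_cvg_esups _ u; have ei := @is_cvg_einfs _ u.
have le : limn (esups u) <= limn (einfs u).
  apply/lee_addgt0Pr => c c0; have [n0 Hn] := H _ c0.
  rewrite -leeBlDr//; apply: lime_ge => //; exists n0 => // n nn0.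
  apply: le_ereal_inf_tmp => _ [k nk <-]; rewrite leeBlDr//.
  apply: lime_le => //; exists k => // m /= km.
  apply: ge_ereal_sup => _ [N /= mN <-].
  by apply: Hn; [exact: leq_trans nk|exact: leq_trans mN].
apply/cvg_ex; exists (limn (einfs u)).
apply: (@squeeze_cvge _ _ _ _ (einfs u) _ (esups u)).
- apply: nearW => n; apply/andP; split.
    by apply: ereal_inf_lbound; exists n => //=.
  by apply: ereal_sup_ubound; exists n => //=.
- exact: ei.
rewrite (_ : limn (einfs u) = limn (esups u))//; apply/eqP; rewrite eq_le le andbT.
apply: lee_lim => //; apply: nearW => n.
apply: (@le_trans _ _ (u n)).
  by apply: ereal_inf_lbound; exists n => //=.
by apply: ereal_sup_ubound; exists n => //=.
Qed.

End Rates.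

Section Finite.
Context (R : realType).

Lemma fiber_bound (T U : finType) (f : T -> U) (A : {set T}) (B : {set U}) (C : R) :
  (forall x, x \in A -> f x \in B) ->
  (forall y, y \in B -> #|[set x in A | f x == y]%SET|%:R <= C) -> #|A|%:R <= #|B|%:R * C.
Proof.
move=> fAB H; rewrite -sum1_card (partition_big f (mem B))//= natr_sum.
rewrite mulr_natl -sumr_const; apply: ler_sum => y yB.
by apply: le_trans (H _ yB); rewrite -sum1dep_card.
Qed.

Lemma push_sum (T U : finType) (f : T -> U) (a : T -> R) :
  \sum_u `|\sum_t (f t == u)%:R * a t| <= \sum_t `|a t|.
Proof.
apply: (@le_trans _ _ (\sum_u \sum_t (f t == u)%:R * `|a t|)).
  apply: ler_sum => u _; apply: (le_trans (ler_norm_sum _ _ _)).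
  by apply: ler_sum => t _; rewrite normrM normr_nat.
rewrite exchange_big; apply: ler_sum => t _ /=.
by rewrite (bigD1 (f t))//= eqxx mul1r big1 ?addr0// => u; rewrite eq_sym => /negbTE ->; rewrite mul0r.
Qed.

End Finite.

Section Labellings.
Context (R : realType) (G : groupType) (dX : measure_display)
  (X : measurableType dX) (mu : probability X R) (act : G -> X -> X).
Hypothesis act_pmp : pmp_action mu act.
Context (P : nat -> set X) (genP : generating_partition mu act P).
Context (L : X -> nat) (PL : forall n x, P n x <-> L x = n).
Local Notation Ex := (Ex mu).

Lemma prob_push (T U : finType) (nm : X -> T) (f : T -> U) u : mlab nm ->
  prob mu (fun x => f (nm x)) u = \sum_t (f t == u)%:R * prob mu nm t.
Proof.
move=> mnm; have := Ex_lab mu (fun t => (f t == u)%:R) mnm (bdd_cst X (1 : R)).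
rewrite (_ : Ex _ = prob mu (fun x => f (nm x)) u); last by apply: eq_Ex => x; rewrite mul1r.
by move=> ->; apply: eq_bigr => t _; congr (_ * _); apply: eq_Ex => x; rewrite mul1r.
Qed.

Lemma mean_push d (T U : finType) (nd : 'I_d -> T) (f : T -> U) u : (0 < d)%N ->
  mean (fun k => (f (nd k) == u)%:R : R) = \sum_t (f t == u)%:R * mean (fun k => (nd k == t)%:R).
Proof.
move=> d0; under eq_mean do rewrite (sum_ind (fun t => (f t == u)%:R)).
by rewrite mean_sum//; apply: eq_bigr => t _; rewrite meanZ.
Qed.

(** A function of the labels merges terms of the sum, which can only produce
    cancellations. *)
Lemma defect_push d (T U : finType) (f : T -> U) (nm : X -> T) (nd : 'I_d -> T) nm' nd' :
  (0 < d)%N -> mlab nm -> (forall x, nm' x = f (nm x)) -> (forall k, nd' k = f (nd k)) ->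
  \sum_u `|prob mu nm' u - mean (fun k => (nd' k == u)%:R)| <=
  \sum_t `|prob mu nm t - mean (fun k => (nd k == t)%:R)|.
Proof.
move=> d0 mnm /funext -> /funext ->; apply: le_trans (push_sum f _); rewrite le_eqVlt; apply/orP; left; apply/eqP.
apply: eq_bigr => u _; rewrite prob_push// mean_push// -sumrB; congr `|_|.
by apply: eq_bigr => t _; rewrite mulrBr.
Qed.

Definition labellings N (F : {fset G}) (delta : R) d (sigma : G -> 'S_d) : {set {ffun 'I_d -> 'I_N.+1}} :=
  [set q | defect mu act L sigma F q <= delta]%SET.

Lemma defect_sub N (F F' : {fset G}) d (sigma : G -> 'S_d) (q : {ffun 'I_d -> 'I_N.+1}) :
  (0 < d)%N -> (F `<=` F')%fset -> defect mu act L sigma F q <= defect mu act L sigma F' q.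
Proof.
move=> d0 FF.
pose f (t : {ffun F' -> 'I_N.+1}) : {ffun F -> 'I_N.+1} := [ffun s => t (fincl FF s)].
apply: (defect_push (f := f)) => //.
- exact: (mlab_name act_pmp genP PL (F := F') (N := N)).
- by move=> x; apply/ffunP => s; rewrite !ffunE.
- by move=> k; apply/ffunP => s; rewrite !ffunE.
Qed.

Lemma defect_coarse n N (F : {fset G}) d (sigma : G -> 'S_d) (q : {ffun 'I_d -> 'I_N.+1}) :
  (0 < d)%N -> (n <= N)%N ->
  defect mu act L sigma F [ffun k => coarse n (q k)] <= defect mu act L sigma F q.
Proof.
move=> d0 nN.
pose f (t : {ffun F -> 'I_N.+1}) : {ffun F -> 'I_n.+1} := [ffun s => coarse n (t s)].
apply: (defect_push (f := f)) => //.
- exact: (mlab_name act_pmp genP PL (F := F) (N := N)).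
- by move=> x; apply/ffunP => s; rewrite !ffunE coarse_lab.
- by move=> k; apply/ffunP => s; rewrite !ffunE.
Qed.

(** As [act] preserves [mu] and [sigma s] is a permutation, the statistics of one
    coordinate [s] of the names are those of the labels themselves. *)
Lemma marginal N (F : {fset G}) d (sigma : G -> 'S_d) (q : {ffun 'I_d -> 'I_N.+1}) j s :
  (0 < d)%N -> s \in F ->
  mean (fun k => (q k == j)%:R) <= prob mu (lab L N) j + defect mu act L sigma F q.
Proof.
move=> d0 sF; pose o := [` sF]%fset.
have : `|prob mu (lab L N) j - mean (fun k => (q k == j)%:R)| <= defect mu act L sigma F q.
  have := defect_push (f := fun t : {ffun F -> 'I_N.+1} => t o) (nm' := fun x => lab L N (act s^-1%g x))
    (nd' := fun k => q ((sigma s)^-1%g k)) d0 (mlab_name act_pmp genP PL (F := F) (N := N)).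
  move=> /(_ (named sigma F q)) H; apply: le_trans (H _ _); last 2 first.
  - by move=> x; rewrite ffunE.
  - by move=> k; rewrite ffunE.
  rewrite (bigD1 j)//= -[leLHS]addr0; apply: lerD; last by apply: sumr_ge0.
  rewrite (mean_perm ((sigma s)^-1%g) (fun k => (q k == j)%:R)).
  rewrite /prob (Ex_act act_pmp s^-1%g (f := fun x => (lab L N x == j)%:R))//.
  exact: (bdd_ind R (fun i => i == j) (mlab_lab genP PL (N:=N))).
by rewrite ler_norml => /andP[]; rewrite lerNl opprB lerBlDl.
Qed.

(** Equal to [fine (mu (P k))] by [atom_mu], in a form that [Ex] can work with. *)
Definition atom (k : nat) : R := Ex (fun x => (L x == k)%:R).

Let bL (b : nat -> bool) : bdd (fun x => (b (L x))%:R : R).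
Proof.
apply: bdd_bool.
rewrite (_ : [set x | b (L x)] = \bigcup_(k in [set k | b k]) P k).
  by apply: bigcup_measurable => k _; exact: (measurable_P genP).
apply/seteqP; split => x /=; first by move=> bx; exists (L x) => //; exact/PL.
by move=> [k /= bk /PL ->].
Qed.

Lemma atom_ge0 k : 0 <= atom k. Proof. exact: Ex_ge0. Qed.

Lemma atom_le1 k : atom k <= 1.
Proof.
by rewrite -(Ex_cst mu 1); apply: le_Ex; [exact: (bL (fun i => i == k))|exact: bdd_cst|move=> x; case: (_ == _)].
Qed.

Lemma Ex_lt M : Ex (fun x => (L x < M)%N%:R) = \sum_(k < M) atom k.
Proof.
rewrite -(@Ex_sum _ _ X mu 'I_M (index_enum _) xpredT (fun k x => (L x == k)%:R)).
apply: eq_Ex => x; have [LM|ML] := ltnP (L x) M.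
  rewrite (bigD1 (Ordinal LM))//= eqxx big1 ?addr0// => i /negbTE i_neq.
  by rewrite eq_sym -val_eqE /= in i_neq; rewrite i_neq.
  by rewrite big1// => i _; rewrite gtn_eqF// (leq_trans _ ML).
by move=> i _; exact: (bL (fun k => k == i)).
Qed.

Lemma atom_sum : (fun M => \sum_(k < M) atom k) @ \oo --> (1 : R).
Proof.
have H : Ex (fun x => `|(L x < M)%N%:R - 1|) @[M --> \oo] --> (0 : R).
  apply: (@Ex_cvg _ _ X mu (fun M x => (L x < M)%N%:R) (fun=> 1) 1).
  - by move=> M; have [] := bL (fun k => (k < M)%N).
  - exact: measurable_cst.
  - by move=> M x; rewrite normr_nat lern1 leq_b1.
  apply: aeW => x; apply/cvgrPdist_le => c c0.
  by exists (L x).+1 => // M /= LM; rewrite LM subrr normr0 ltW.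
have -> : (fun M => \sum_(k < M) atom k) = (fun M => 1 - Ex (fun x => `|(L x < M)%N%:R - 1|)).
  apply/funext => M; rewrite -Ex_lt -[X in X - _](Ex_cst mu 1) -ExB; last 2 first.
  - exact: bdd_cst.
  - by apply: bdd_norm; apply: bddB; [exact: (bL (fun k => (k < M)%N))|exact: bdd_cst].
  apply: eq_Ex => x; case: (_ < _)%N; first by rewrite subrr normr0 subr0.
  by rewrite sub0r normrN normr1 subrr.
by rewrite -[X in _ --> X]subr0; apply: cvgB => //; exact: cvg_cst.
Qed.

Lemma prob_lab N (j : 'I_N.+1) :
  prob mu (lab L N) j = if (j < N)%N then atom j else tail atom N.
Proof.
have [jN|Nj] := ltnP j N.
  apply: eq_Ex => x; rewrite -val_eqE /= labE; congr (_%:R); congr nat_of_bool.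
  by apply/eqP/eqP; lia.
rewrite /tail -Ex_lt -[X in X - _](Ex_cst mu 1) -ExB; last 2 first.
- exact: bdd_cst.
- exact: (bL (fun k => (k < N)%N)).
apply: eq_Ex => x; rewrite -val_eqE /= labE.
have -> : nat_of_ord j = N by apply/eqP; rewrite eqn_leq Nj -ltnS ltn_ord.
rewrite /minn; case: ltnP => LN; first by rewrite ltn_eqF// subrr.
by rewrite eqxx subr0.
Qed.

Lemma sum_tail n N (f : R -> R) : (n <= N)%N ->
  \sum_(j < N.+1 | (n <= j)%N) f (prob mu (lab L N) j) =
  \sum_(n <= k < N) f (atom k) + f (tail atom N).
Proof.
move=> nN; rewrite big_mkcond big_ord_recr /= nN prob_lab /= ltnn; congr (_ + _).
rewrite big_geq_mkord -big_mkcond; apply: eq_bigr => i _.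
by rewrite prob_lab /= ltn_ord.
Qed.

Lemma tail_mass n N : (n <= N)%N ->
  \sum_(j < N.+1 | (n <= j)%N) prob mu (lab L N) j = tail atom n.
Proof.
move=> nN; rewrite (sum_tail id nN) /tail -!(big_mkord xpredT atom).
rewrite (@big_cat_nat _ _ _ n 0 N)//=; lra.
Qed.

Lemma atom_mu k : atom k = fine (mu (P k)).
Proof.
rewrite /atom /Ex (_ : (fun _ => _) = \1_(P k)).
  by rewrite /Rintegral integral_indic ?setIT//; exact: (measurable_P genP).
apply/funext => x; rewrite indicE; congr (_%:R); congr nat_of_bool.
by apply/eqP/idP; rewrite in_setE => /PL.
Qed.

Lemma ent_atom_bound : (partition_entropy mu P < +oo)%E ->
  exists H, forall M, \sum_(k < M) ent (atom k) <= H.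
Proof.
move=> Hoo.
have E : partition_entropy mu P = (\sum_(0 <= n <oo) (ent (atom n))%:E)%E.
  by apply: eq_eseriesr => n _; rewrite /ent atom_mu.
have e0 n : (0 <= (ent (atom n))%:E)%E.
  by rewrite lee_fin; apply: (ent_ge0 atom_ge0 atom_le1).
exists (fine (partition_entropy mu P)) => M; rewrite -lee_fin fineK; last first.
  by rewrite ge0_fin_numE// E; apply: nneseries_ge0.
rewrite E -sumEFin -(big_mkord xpredT (fun k => (ent (atom k))%:E)).
exact: nneseries_lim_ge.
Qed.

Hypothesis Pent : (partition_entropy mu P < +oo)%E.

(** The finiteness of the entropy of [P] is used here: the labels from [n0] on, even
    after merging those from [N] on, have small mass and small entropy, so that
    [counting] applies with [D] the set of these labels. *)
Lemma count_close (kappa : R) : 0 < kappa -> exists n0, forall n N, (n0 <= n)%N -> (n <= N)%N ->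
  exists2 delta : R, 0 < delta & forall (F : {fset G}) d (sigma : G -> 'S_d)
    (A : {set {ffun 'I_d -> 'I_N.+1}}) (l0 : 'I_d -> 'I_n.+1),
    F != fset0 -> (0 < d)%N -> A \subset labellings N F delta sigma ->
    (forall l : {ffun 'I_d -> 'I_N.+1}, l \in A ->
       mean (fun k => (coarse n (l k) != l0 k)%:R) <= hamming_radius kappa n.+1) ->
    #|A|%:R <= expR (kappa * d%:R).
Proof.
move=> k0; have [H PH] := ent_atom_bound Pent.
pose c := Num.min 2^-1 (kappa / 8).
have c0 : 0 < c by rewrite lt_min !divr_gt0// invr_gt0 andbT.
have [n0 n0P] := small_tails atom_ge0 atom_le1 atom_sum PH c0.
exists n0 => n N nn0 nN.
have [tn en] := n0P n nn0; have [tN eN] := n0P N (leq_trans nn0 nN).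
have cd (i j : 'I_N.+1) : coarse n i = coarse n j -> i != j -> (n <= i)%N.
  move=> /(congr1 val); rewrite /= !inordK ?ltnS ?geq_minr//.
  by move=> H1; rewrite -val_eqE /=; lia.
have sD : \sum_(j < N.+1 | (n <= j)%N) prob mu (lab L N) j <= 2^-1.
  by rewrite tail_mass// (le_trans tn)// ge_min lexx.
have eD : \sum_(j < N.+1 | (n <= j)%N) ent (prob mu (lab L N) j) <= kappa / 4.
  rewrite sum_tail//; apply: (@le_trans _ _ (c + c)).
    apply: lerD; first exact: en.
    exact: (ent_tail atom_ge0 atom_sum).
  have : c <= kappa / 8 by rewrite ge_min lexx orbT.
  by move=> ck; rewrite (_ : kappa / 4 = kappa / 8 + kappa / 8); [exact: lerD|field].
have [delta delta0 HA] := counting k0 cd (fun j => prob_ge0 mu (lab L N) j) sD eD.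
exists delta => // F d sigma A l0 F0 d0 AF ham.
apply: (HA d A l0 d0); last by rewrite card_ord.
move=> l j lA; have /fset0Pn[s sF] := F0.
have := fintype.subsetP AF _ lA; rewrite inE => ld.
by apply: (le_trans (marginal sigma l j d0 sF)); rewrite lerD2l.
Qed.

(** The fibers of the coarsening consist of labellings with one and the same
    coarse part, so [count_close] bounds them. *)
Lemma card_coarse (kappa : R) : 0 < kappa -> exists n0, forall n N, (n0 <= n)%N -> (n <= N)%N ->
  forall delta : R, 0 < delta -> exists2 delta' : R, 0 < delta' & forall (F : {fset G}) d (sigma : G -> 'S_d),
    F != fset0 -> (0 < d)%N ->
    #|labellings N F delta' sigma|%:R <= #|labellings n F delta sigma|%:R * expR (kappa * d%:R).
Proof.
move=> k0; have [n0 H] := count_close k0.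
exists n0 => n N nn0 nN delta delta0.
have [delta' delta'0 {}H] := H n N nn0 nN.
exists (Num.min delta delta'); first by rewrite lt_min delta0.
move=> F d sigma F0 d0.
apply: (fiber_bound (f := fun q : {ffun 'I_d -> 'I_N.+1} => [ffun k => coarse n (q k)] : {ffun 'I_d -> 'I_n.+1})) => [q|l lA].
  rewrite !inE le_min => /andP[qd _].
  by apply: le_trans qd; exact: defect_coarse.
apply: (H F d sigma _ l) => //.
  by apply/fintype.subsetP => q; rewrite !inE le_min => /andP[/andP[_ ->]].
move=> q; rewrite inE => /andP[_ /eqP <-].
rewrite (eq_mean (g := fun=> 0)) ?mean_cst//; last by move=> k; rewrite ffunE eqxx.
by rewrite ltW// hamming_radius_gt0.
Qed.

End Labellings.

(** * Bowen's entropy in terms of labellings *)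

Section Bowen.
Context (R : realType) (G : groupType) (dX : measure_display)
  (X : measurableType dX) (mu : probability X R) (act : G -> X -> X).
Hypothesis act_pmp : pmp_action mu act.
Context (P : nat -> set X) (genP : generating_partition mu act P).
Context (L : X -> nat) (PL : forall n x, P n x <-> L x = n).
Local Notation Ex := (Ex mu).
Local Notation labellings := (labellings mu act L).

Lemma truncateE N (i : 'I_N.+1) : truncate_partition P i = [set x | lab L N x == i].
Proof.
apply/seteqP; split => x; rewrite /truncate_partition /= -val_eqE /= labE.
  case: eqP => [[iN]|iN]; last by move=> /PL ->; apply/eqP; have := ltn_ord i; lia.
  by move=> [k /= ik /PL Lx]; apply/eqP; lia.
move=> /eqP Li; case: eqP => [[iN]|iN].
  by exists (L x) => /=; [lia|apply/PL].
by apply/PL; have := ltn_ord i; lia.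
Qed.

Lemma mu_name N (F : {fset G}) (t : {ffun F -> 'I_N.+1}) :
  fine (mu (\bigcap_(s in [set: F]) (act (val s) @` truncate_partition P (t s)))) =
  prob mu (name act L F N) t.
Proof.
have mn := mlab_name act_pmp genP PL (F := F) (N := N).
rewrite (_ : \bigcap_(s in _) _ = [set x | name act L F N x == t]).
  rewrite /prob /Ex (_ : (fun _ => _) = \1_[set x | name act L F N x == t]).
    by rewrite /Rintegral integral_indic ?setIT//; exact: mn.
  apply/funext => x; rewrite indicE; congr (_%:R); congr nat_of_bool.
  by apply/idP/idP; rewrite in_setE.
apply/seteqP; split => x /=.
  move=> H; apply/eqP/ffunP => s; rewrite ffunE.
  have [y] := H s I; rewrite truncateE => /= /eqP <- <-.
  by rewrite -(actM act_pmp) mulVg (act1 act_pmp).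
move=> /eqP <- s _; exists (act (val s)^-1%g x).
  by rewrite truncateE /= ffunE.
by rewrite -(actM act_pmp) mulgV (act1 act_pmp).
Qed.

Definition classes N d (q : {ffun 'I_d -> 'I_N.+1}) : {ffun 'I_N.+1 -> {set 'I_d}} :=
  [ffun i => [set k | q k == i]%SET].

Lemma classes_inj N d : injective (@classes N d).
Proof.
move=> q1 q2 /ffunP H; apply/ffunP => k; have := H (q1 k); rewrite !ffunE => /setP /(_ k).
by rewrite !inE eqxx => /esym/eqP.
Qed.

Lemma ordered_partitionP N d (q : {ffun 'I_N.+1 -> {set 'I_d}}) :
  ordered_partition q = (q \in [set classes l | l : {ffun 'I_d -> 'I_N.+1}]%SET).
Proof.
apply/idP/imsetP => [/andP[/forallP disj /eqP cov]|[l _ ->]].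
  have /choice[l lP] : forall k : 'I_d, exists i, k \in q i.
    move=> k; have : k \in [set: 'I_d]%SET by rewrite inE.
    by rewrite -cov => /bigcupP[i _ ki]; exists i.
  exists (finfun l) => //; apply/ffunP => i; rewrite ffunE; apply/setP => k.
  rewrite !inE ffunE; apply/idP/eqP => [ki|<- //].
  apply/eqP; apply/negP => /negP li; have /forallP/(_ i)/implyP/(_ li) := disj (l k).
  by move/disjointFr => /(_ k (lP k)); rewrite ki.
apply/andP; split.
  apply/forallP => i; apply/forallP => j; apply/implyP => ij; rewrite !ffunE.
  rewrite -setI_eq0; apply/eqP/setP => k; rewrite !inE.
  by apply/negbTE/negP => /andP[/eqP -> /eqP ij']; rewrite ij' eqxx in ij.
apply/eqP/setP => k; rewrite inE; apply/bigcupP; exists (l k) => //.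
by rewrite ffunE inE.
Qed.

Lemma card_name N (F : {fset G}) d (sigma : G -> 'S_d) (q : {ffun 'I_d -> 'I_N.+1}) (t : {ffun F -> 'I_N.+1}) :
  #|(\bigcap_(s : F) (sigma (val s) @: classes q (t s)))%SET|%:R / d%:R =
  mean (fun k => (named sigma F q k == t)%:R) :> R.
Proof.
rewrite mean_card; congr (_%:R / _); apply: eq_card => k; rewrite inE.
apply/bigcapP/eqP => [H|<- s _].
  apply/ffunP => s; rewrite ffunE; have /imsetP[j] := H s isT.
  by rewrite ffunE inE => /eqP <- ->; rewrite permK.
by apply/imsetP; exists ((sigma (val s))^-1%g k); rewrite ?permKV// !ffunE inE.
Qed.

Lemma AP_card N (F : {fset G}) delta d (sigma : G -> 'S_d) :
  #|AP mu act (@truncate_partition _ X P N.+1) F delta sigma| = #|labellings N F delta sigma|.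
Proof.
rewrite -(card_imset _ (@classes_inj N d)); apply: eq_card => q; rewrite inE ordered_partitionP.
have E l : partition_defect mu act (@truncate_partition _ X P N.+1) F sigma (classes l) =
    defect mu act L sigma F l.
  by apply: eq_bigr => t _; rewrite mu_name card_name.
apply/andP/imsetP => [[/imsetP[l _ ->]]|[l]].
  by rewrite E => ld; exists l => //; rewrite inE.
by rewrite inE => ld ->; rewrite E ld imset_f.
Qed.

Context (d : nat -> nat) (sigma : forall i, G -> 'S_(d i)).

Definition bowen_rate N F : \bar R := ereal_inf [set
  limn_esup (fun i => rate (d i) (#|labellings N F delta (sigma i)|%:R : R)%:E)
  | delta in [set delta : R | 0 < delta]].

Lemma bowen_finiteE N F :
  bowen_finite mu act sigma (@truncate_partition _ X P N.+1) F = bowen_rate N F.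
Proof.
rewrite /bowen_finite /bowen_rate; congr ereal_inf; apply/seteqP; split => _ [delta d0 <-];
by exists delta => //; congr limn_esup; apply/funext => i; rewrite AP_card.
Qed.

Hypothesis Pent : (partition_entropy mu P < +oo)%E.

Lemma bowen_rate_coarse (kappa : R) : 0 < kappa -> exists n0, forall n N, (n0 <= n)%N -> (n <= N)%N ->
  forall F, F != fset0 -> (bowen_rate N F <= bowen_rate n F + kappa%:E)%E.
Proof.
move=> k0; have [n0 H] := card_coarse act_pmp genP PL Pent k0.
exists n0 => n N nn0 nN F F0; rewrite -leeBlDr//.
apply: le_ereal_inf_tmp => _ [delta delta0 <-]; rewrite leeBlDr//.
have [delta' delta'0 Hd] := H n N nn0 nN delta delta0.
apply: (@le_trans _ _ (limn_esup (fun i => rate (d i) (#|labellings N F delta' (sigma i)|%:R : R)%:E))).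
  by apply: ereal_inf_lbound; exists delta'.
apply: limn_esup_le; apply: nearW => i.
apply: rate_le; [by rewrite lee_fin|by rewrite lee_fin|exact: ltW|move=> d0].
by rewrite lee_fin; exact: Hd.
Qed.

(** [limn] has its meaning only along convergent sequences; finite entropy makes
    this one almost nonincreasing by [card_coarse]. *)
Lemma bowen_cvg F : F != fset0 ->
  cvgn (fun n => bowen_finite mu act sigma (@truncate_partition _ X P n) F).
Proof.
move=> F0; apply: cvg_almost_nonincreasing => c c0; have [n0 H] := bowen_rate_coarse c0.
exists n0.+1 => -[//|n] [//|N] nn0 nN; rewrite !bowen_finiteE; exact: H.
Qed.

Lemma bowen_ge (c : \bar R) : (forall F, F != fset0 -> exists N0, forall N, (N0 <= N)%N ->
    (c <= bowen_rate N F)%E) -> (c <= bowen_partition mu act sigma P)%E.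
Proof.
move=> H; apply: le_ereal_inf_tmp => _ [F /= F0 <-]; have [N0 HN] := H F F0.
apply: lime_ge; first exact: bowen_cvg.
by exists N0.+1 => // -[//|N] /= NN; rewrite bowen_finiteE; exact: HN.
Qed.

Lemma bowen_le (kappa : R) : 0 < kappa -> exists n0, forall N F, (n0 <= N)%N -> F != fset0 ->
  (bowen_partition mu act sigma P <= bowen_rate N F + kappa%:E)%E.
Proof.
move=> k0; have [n0 H] := bowen_rate_coarse k0; exists n0 => N F nN F0.
apply: (@le_trans _ _ (limn (fun n => bowen_finite mu act sigma (@truncate_partition _ X P n) F))).
  by apply: ereal_inf_lbound; exists F.
apply: lime_le; first exact: bowen_cvg.
exists N.+1 => // -[//|M] /= NM; rewrite bowen_finiteE; exact: H.
Qed.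

End Bowen.

(** * Complex-valued maps and their real parts *)

Section Norm2.
Context (R : realType) (d : nat).
Hypothesis d0 : (0 < d)%N.
Implicit Types w : 'I_d -> R.

Lemma norm2_real w : norm2 (fun k => real_complex R (w k)) = Num.sqrt (mean (fun k => w k ^+ 2)).
Proof.
rewrite /norm2 /mean; congr (Num.sqrt (_ * _)); apply: eq_bigr => k _.
by rewrite real_complexE normc_real real_normK ?num_real.
Qed.

Lemma mean_le_norm2 w : mean (fun k => `|w k|) <= norm2 (fun k => real_complex R (w k)).
Proof.
rewrite norm2_real; apply: mean_norm_le => //.
by rewrite sqr_sqrtr// mean_ge0// => k; exact: sqr_ge0.
Qed.

Lemma norm2_le_mean w : (forall k, `|w k| <= 2) ->
  norm2 (fun k => real_complex R (w k)) <= Num.sqrt (2 * mean (fun k => `|w k|)).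
Proof.
move=> w2; rewrite norm2_real ler_wsqrtr// -meanZ//; apply: le_mean => // k.
by rewrite -real_normK ?num_real// expr2 ler_wpM2r.
Qed.

Lemma norm2_lt w (delta : R) : 0 < delta -> (forall k, `|w k| <= 2) ->
  mean (fun k => `|w k|) < delta ^+ 2 / 2 -> norm2 (fun k => real_complex R (w k)) < delta.
Proof.
move=> delta0 w2 wd; apply: le_lt_trans (norm2_le_mean w2) _.
rewrite -[ltRHS]gtr0_norm// -sqrtr_sqr ltr_sqrt ?exprn_gt0//.
by rewrite mulrC -ltr_pdivlMr.
Qed.

End Norm2.

Section Conversion.
Context (R : realType) (G : groupType) (dX : measure_display)
  (X : measurableType dX) (mu : probability X R) (act : G -> X -> X).
Hypothesis act_pmp : pmp_action mu act.
Local Notation Re := (@complex.Re R).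
Local Notation Im := (@complex.Im R).
Local Notation Ex := (Ex mu).
Local Notation cR := (real_complex R).

Section Real.
Context (d : nat) (phi : (X -> R[i]) -> 'I_d -> R[i]).
Hypothesis phiP : unital_positive_map mu phi.

Definition real_part (f : X -> R) (k : 'I_d) : R := Re (phi (cplx f) k).

Lemma phi_lin c f g : Linfty mu f -> Linfty mu g ->
  phi (fun x => c * f x + g x) = (fun k => c * phi f k + phi g k).
Proof. by case: phiP => _ + _ _; exact. Qed.

(** [M + f] is nonnegative for some constant [M], hence so is its image, which is
    thus real. *)
Lemma phi_real f k : bdd f -> phi (cplx f) k = cR (real_part f k).
Proof.
move=> bf; have [mf [M fM]] := bf.
have b1 := bdd_cplx mu (bdd_cst X (1 : R)).
have := phi_lin (cR M) b1 (bdd_cplx mu bf).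
have -> : (fun x => cR M * cplx (fun=> 1) x + cplx f x) = cplx (fun x => M + f x).
  by apply/funext => x; rewrite /cplx -rmorphM -rmorphD mulr1.
case: phiP => _ _ phi1 phi0.
have -> : phi (cplx (fun=> 1)) = fun=> 1.
  by rewrite -phi1; congr phi.
move=> E; have : 0 <= phi (cplx (fun x => M + f x)) k.
  apply: phi0; first by apply: bdd_cplx; apply: bddD => //; exact: bdd_cst.
  apply: aeW => x; rewrite /cplx lecE /= eqxx /=.
  by have := fM x; rewrite ler_norml => /andP[+ _]; rewrite -subr_ge0 opprK addrC.
rewrite E lecE ImD mulr1 /= add0r => /andP[/eqP Im0 _].
by apply: complex_eqP.
Qed.

Lemma phi_ae f g : measurable_fun setT f -> bdd g -> {ae mu, forall x, f x = g x} ->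
  phi (cplx f) = phi (cplx g).
Proof.
move=> mf bg fg; case: phiP => H _ _ _.
have cfg : {ae mu, forall x, cplx f x = cplx g x} by apply: filterS fg => x; rewrite /cplx => ->.
apply: H => //; last exact: bdd_cplx.
apply: (Linfty_ae (bdd_cplx mu bg)) => //.
  exact: measurable_cst.
by apply: filterS cfg => x ->.
Qed.

Lemma real_part_positive : real_positive real_part.
Proof.
split.
- move=> c f g bf bg k; rewrite /real_part.
  have -> : cplx (fun x => c * f x + g x) = (fun x => cR c * cplx f x + cplx g x).
    by apply/funext => x; rewrite /cplx -rmorphM -rmorphD.
  rewrite (phi_lin _ (bdd_cplx mu bf) (bdd_cplx mu bg)) ReD ReM /= mul0r subr0//.
- move=> k; rewrite /real_part (_ : cplx _ = fun=> 1)//.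
  by case: phiP => _ _ -> _.
- move=> f bf f0 k; have : 0 <= phi (cplx f) k.
    case: phiP => _ _ _; apply; first exact: bdd_cplx.
    by apply: aeW => x; rewrite /cplx lecE /= eqxx /=.
  by rewrite lecE => /andP[].
Qed.

End Real.

Section Complexify.
Context (d : nat) (psi : (X -> R) -> 'I_d -> R).
Hypothesis psiP : real_positive psi.
Hypothesis psi_ae : forall f g, measurable_fun setT f -> bdd g ->
  {ae mu, forall x, f x = g x} -> psi f = psi g.

Definition complexify (z : X -> R[i]) (k : 'I_d) : R[i] :=
  Complex (psi (Re \o z) k) (psi (Im \o z) k).

Lemma complexify_real f : complexify (cplx f) = fun k => cR (psi f k).
Proof.
by apply/funext => k; rewrite /complexify real_complexE; congr Complex; exact: (psi_cst psiP).
Qed.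

Lemma complexify_bdd z f g : Linfty mu z -> bdd f -> bdd g ->
  {ae mu, forall x, z x = Complex (f x) (g x)} ->
  complexify z = fun k => Complex (psi f k) (psi g k).
Proof.
move=> /Linfty_meas[mr mi] bf bg zfg; apply/funext => k; rewrite /complexify.
rewrite (psi_ae mr bf); last by apply: filterS zfg => x /= ->.
by rewrite (psi_ae mi bg)//; apply: filterS zfg => x /= ->.
Qed.

(** Elements of [Linfty] are only essentially bounded, so that each identity is
    checked on bounded representatives. *)
Lemma complexify_positive : unital_positive_map mu complexify.
Proof.
split.
- move=> z w Lz Lw zw; have [f [g [bf bg wfg]]] := Linfty_bdd Lw.
  rewrite (complexify_bdd Lw bf bg wfg); apply: complexify_bdd => //.
  by apply: filterS2 zw wfg => x ->.
- move=> c z w Lz Lw.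
  have [f [g [bf bg zfg]]] := Linfty_bdd Lz; have [f' [g' [bf' bg' wfg]]] := Linfty_bdd Lw.
  have [mz1 mz2] := Linfty_meas Lz; have [mw1 mw2] := Linfty_meas Lw.
  rewrite (complexify_bdd Lz bf bg zfg) (complexify_bdd Lw bf' bg' wfg).
  pose F x := Re c * f x + (- Im c * g x + f' x).
  pose H x := Re c * g x + (Im c * f x + g' x).
  have bF : bdd F by apply: bddD; [exact: bddZ|apply: bddD => //; exact: bddZ].
  have bH : bdd H by apply: bddD; [exact: bddZ|apply: bddD => //; exact: bddZ].
  have E : {ae mu, forall x, c * z x + w x = Complex (F x) (H x)}.
    apply: filterS2 zfg wfg => x -> ->.
    by apply: complex_eqP; rewrite ?ReD ?ImD ?ReM ?ImM /= /F /H; ring.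
  rewrite (complexify_bdd (f := F) (g := H))//.
    apply/funext => k; apply: complex_eqP; rewrite ?ReD ?ImD ?ReM ?ImM /= /F /H.
      by rewrite !(psi_lin psiP)//; [ring|apply: bddD => //; exact: bddZ].
    by rewrite !(psi_lin psiP)//; [ring|apply: bddD => //; exact: bddZ].
  apply: (Linfty_ae (bdd_Linfty mu bF bH)).
  - rewrite (_ : _ \o _ = fun x => Re c * Re (z x) + (- Im c * Im (z x) + Re (w x))).
      by do ?[apply: measurable_funD => //|apply: measurable_funM => //|exact: measurable_cst].
    by apply/funext => x; rewrite /= ReD ReM; ring.
  - rewrite (_ : _ \o _ = fun x => Re c * Im (z x) + (Im c * Re (z x) + Im (w x))).
      by do ?[apply: measurable_funD => //|apply: measurable_funM => //|exact: measurable_cst].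
    by apply/funext => x; rewrite /= ImD ImM; ring.
  by apply: filterS E => x ->.
- rewrite (_ : (fun=> 1) = cplx (fun=> 1 : R))// complexify_real.
  by apply/funext => k; case: psiP => _ -> _.
- move=> z Lz z0 k; have [f [g [bf bg zfg]]] := Linfty_bdd Lz.
  have E : {ae mu, forall x, z x = Complex `|f x| 0}.
    apply: filterS2 z0 zfg => x + zx; rewrite zx lecE /= => /andP[/eqP g0 f0].
    by rewrite g0 ger0_norm.
  rewrite (complexify_bdd Lz (bdd_norm bf) (bdd_cst X (0 : R)) E).
  rewrite lecE /= (psi_cst psiP) eqxx /=; case: psiP => _ _; apply; first exact: bdd_norm.
  by move=> x; exact: normr_ge0.
Qed.

End Complexify.

Section Sequences.
Context (S : nat -> X -> R) (SP : unit_ball_sequence mu S).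

(** A representative of [S n] that is bounded by one everywhere. *)
Definition clipped n x : R := clip 1 (S n x).
Local Notation S' := clipped.

Lemma measurable_S n : measurable_fun setT (S n).
Proof. by have [/LfunP[]] := SP n. Qed.

Lemma measurable_clipped n : measurable_fun setT (S' n).
Proof. by apply: measurable_maxr => //; apply: measurable_minr => //; exact: measurable_S. Qed.

Lemma clipped1 n x : `|S' n x| <= 1. Proof. exact: norm_clip. Qed.

Let bS' n : bdd (S' n). Proof. exact: (bdd_S measurable_clipped clipped1). Qed.

Lemma clipped_ae n : {ae mu, forall x, S n x = S' n x}.
Proof.
have [_ /Lnorm_le1 H] := SP n; apply: filterS H => x Sx; apply/eqP.
by rewrite -subr_eq0 -normr_le0 (le_trans (clip_dist _ _))// subrr normr0.
Qed.

Lemma clipped_ae_act n s : {ae mu, forall x, S n (act s x) = S' n (act s x)}.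
Proof. exact: (ae_act act_pmp s (clipped_ae n)). Qed.

Lemma clipped_generating : dynamically_generating mu act (range (fun n => cplx (S n))) ->
  dynamically_generating mu act (range (fun n => cplx (S' n))).
Proof.
move=> H A vA iA SA; apply: H => // _ [n _ <-].
have [A1 Aae _ _] := vA; have AS : A (cplx (S' n)) by apply: SA; exists n.
have E : {ae mu, forall x, cplx (S' n) x = cplx (S n) x}.
  by apply: filterS (clipped_ae n) => x; rewrite /cplx => ->.
apply: (Aae _ _ AS) => //.
apply: (Linfty_ae (A1 _ AS)) => //; first exact: measurable_S.
exact: measurable_cst.
Qed.

Lemma translate_productE j (s : 'I_j -> G) (a : 'I_j -> nat) :
  translate_product act S s a = cplx (mev act S [seq (s l, a l) | l <- enum 'I_j]).
Proof.
apply/funext => x; rewrite /translate_product /cplx /mev big_map big_enum /= rmorph_prod.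
by [].
Qed.

Lemma measurable_mev l : measurable_fun setT (mev act S l).
Proof.
elim: l => [|p l IH].
  by rewrite (_ : mev _ _ _ = fun=> 1) ?measurable_cst//; apply/funext => x; rewrite /mev big_nil.
rewrite (_ : mev _ _ _ = fun x => S p.2 (act p.1^-1%g x) * mev act S l x).
  apply: measurable_funM => //; apply: (measurableT_comp (measurable_S _)).
  exact: (measurable_act act_pmp).
by apply/funext => x; rewrite /mev big_cons.
Qed.

Lemma mev_clipped l : {ae mu, forall x, mev act S l x = mev act S' l x}.
Proof.
elim: l => [|p l IH]; first by apply: aeW => x; rewrite /mev !big_nil.
apply: filterS2 (clipped_ae_act p.2 p.1^-1%g) IH => x E1 E2.
by rewrite /mev !big_cons -/(mev act S l x) -/(mev act S' l x) E1 E2.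
Qed.

Let bmev l : bdd (mev act S' l).
Proof. exact: (bdd_mev act_pmp measurable_clipped clipped1). Qed.

Lemma phi_mev d (phi : (X -> R[i]) -> 'I_d -> R[i]) l : unital_positive_map mu phi ->
  phi (cplx (mev act S l)) = fun k => cR (real_part phi (mev act S' l) k).
Proof.
move=> phiP; rewrite (phi_ae phiP (measurable_mev l) (bmev l) (mev_clipped l)).
by apply/funext => k; rewrite phi_real.
Qed.

Lemma phi_S d (phi : (X -> R[i]) -> 'I_d -> R[i]) n : unital_positive_map mu phi ->
  phi (cplx (S n)) = fun k => cR (real_part phi (S' n) k).
Proof.
move=> phiP; rewrite (phi_ae phiP (measurable_S n) (bS' n) (clipped_ae n)).
by apply/funext => k; rewrite phi_real.
Qed.

Lemma phi_alpha d (phi : (X -> R[i]) -> 'I_d -> R[i]) n s : unital_positive_map mu phi ->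
  phi (alpha act s (cplx (S n))) = fun k => cR (real_part phi (fun x => S' n (act s^-1%g x)) k).
Proof.
move=> phiP; rewrite (_ : alpha _ _ _ = cplx (fun x => S n (act s^-1%g x)))//.
rewrite (phi_ae phiP _ _ (clipped_ae_act n s^-1%g)); last 2 first.
- by apply: (measurableT_comp (measurable_S n)); exact: (measurable_act act_pmp).
- exact: (bdd_act act_pmp).
by apply/funext => k; rewrite phi_real//; exact: (bdd_act act_pmp).
Qed.

Lemma cintegral_mev l : cintegral mu (cplx (mev act S l)) = cR (Ex (mev act S' l)).
Proof.
rewrite /cintegral real_complexE /cplx /=; congr Complex.
  by apply: Rint_ae; [exact: measurable_mev|exact: bmev|exact: mev_clipped].
exact: (Ex_cst mu 0).
Qed.

Lemma zeta_real d (w : 'I_d -> R) : zeta (fun k => cR (w k)) = cR (mean w).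
Proof.
rewrite /zeta /mean rmorphM rmorph_sum fmorphV; congr (_^-1 * _).
by rewrite rmorph_nat.
Qed.

Lemma normc_realB (a b : R) : Normc.normc (cR a - cR b) = `|a - b|.
Proof. by rewrite -rmorphB; exact: normc_real. Qed.

Lemma UP_rUP (F : {fset G}) m delta d (sigma : G -> 'S_d) phi : (0 < d)%N ->
  UP mu act S F m delta sigma phi -> rUP mu act S' sigma F m delta (real_part phi).
Proof.
move=> d0 [phiP H1 H2 H3]; split; first exact: real_part_positive.
- move=> l lm /allP la.
  pose s (j : 'I_(size l)) := (tnth (in_tuple l) j).1.
  pose a (j : 'I_(size l)) := (tnth (in_tuple l) j).2.
  have lE : [seq (s j, a j) | j <- enum 'I_(size l)] = l.
    rewrite -[RHS](map_tnth_enum (in_tuple l)); apply: eq_map => j.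
    by rewrite /s /a -surjective_pairing.
  have sF j : s j \in F by have /andP[] := la _ (mem_tnth j (in_tuple l)).
  have am j : (a j < m)%N by have /andP[] := la _ (mem_tnth j (in_tuple l)).
  have := H1 _ s a lm sF am; rewrite translate_productE lE phi_mev//.
  apply: le_lt_trans.
  have -> : (fun k => cR (real_part phi (mev act S' l) k) - \prod_(j < size l) phi (alpha act (s j) (cplx (S (a j)))) k)
    = fun k => cR (real_part phi (mev act S' l) k - \prod_(p <- l) real_part phi (fun x => S' p.2 (act p.1^-1%g x)) k).
    apply/funext => k; rewrite rmorphB rmorph_prod /=; congr (_ - _); rewrite [RHS]big_tnth.
    by apply: eq_bigr => j _; rewrite phi_alpha.
  exact: mean_le_norm2.
- move=> l lm /allP la.
  pose s (j : 'I_(size l)) := (tnth (in_tuple l) j).1.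
  pose a (j : 'I_(size l)) := (tnth (in_tuple l) j).2.
  have lE : [seq (s j, a j) | j <- enum 'I_(size l)] = l.
    rewrite -[RHS](map_tnth_enum (in_tuple l)); apply: eq_map => j.
    by rewrite /s /a -surjective_pairing.
  have : products act S F m (cplx (mev act S l)).
    exists (size l), s, a; split => //; last by rewrite translate_productE lE.
      by move=> j; have /andP[] := la _ (mem_tnth j (in_tuple l)).
    by move=> j; have /andP[] := la _ (mem_tnth j (in_tuple l)).
  by move=> /H2; rewrite phi_mev// zeta_real cintegral_mev normc_realB.
- move=> s n sF nm; have := H3 s n sF nm; rewrite phi_alpha// phi_S//.
  apply: le_lt_trans; rewrite /perm_shift.
  under [X in norm2 X]eq_fun do rewrite -rmorphB.
  exact: mean_le_norm2.
Qed.

Lemma rUP_UP (F : {fset G}) m delta d (sigma : G -> 'S_d) psi : (0 < d)%N -> 0 < delta ->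
  (forall f g, measurable_fun setT f -> bdd g -> {ae mu, forall x, f x = g x} -> psi f = psi g) ->
  rUP mu act S' sigma F m (Num.min delta (delta ^+ 2 / 2)) psi ->
  UP mu act S F m delta sigma (complexify psi).
Proof.
move=> d0 delta0 psi_ae [psiP H1 H2 H3].
have cP := complexify_positive psiP psi_ae.
have rE f : real_part (complexify psi) f = psi f.
  by apply/funext => k; rewrite /real_part complexify_real.
have lt2 x : x < Num.min delta (delta ^+ 2 / 2) -> x < delta ^+ 2 / 2.
  by rewrite lt_min => /andP[].
have lt1 x : x < Num.min delta (delta ^+ 2 / 2) -> x < delta.
  by rewrite lt_min => /andP[].
have le2 (u v : R) : `|u| <= 1 -> `|v| <= 1 -> `|u - v| <= 2.
  by move=> u1 v1; rewrite (le_trans (ler_normB _ _))// -[2]/(1 + 1) lerD.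
have n1 f k : bdd f -> (forall x, `|f x| <= 1) -> `|psi f k| <= 1 by move=> bf f1; exact: norm_psi.
have nm l k : `|psi (mev act S' l) k| <= 1.
  by apply: n1 => // x; exact: (mev_le1 _ clipped1).
have na n s k : `|psi (fun x => S' n (act s x)) k| <= 1.
  by apply: n1; [exact: (bdd_act act_pmp)|move=> x; exact: clipped1].
split => //.
- move=> j s a jm sF am; rewrite translate_productE phi_mev// rE.
  set l := [seq _ | _ <- _].
  have -> : (fun k => cR (psi (mev act S' l) k) - \prod_(i < j) complexify psi (alpha act (s i) (cplx (S (a i)))) k)
    = fun k => cR (psi (mev act S' l) k - \prod_(p <- l) psi (fun x => S' p.2 (act p.1^-1%g x)) k).
    apply/funext => k; rewrite rmorphB rmorph_prod /l big_map big_enum /=; congr (_ - _).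
    by apply: eq_bigr => i _; rewrite phi_alpha// rE.
  apply: norm2_lt => //.
    move=> k; apply: le2 => //; rewrite normr_prod; apply: prodr_ile1 => p _.
    by rewrite normr_ge0 na.
  apply: lt2; apply: H1; first by rewrite size_map size_enum_ord.
  by apply/allP => _ /mapP[i _ ->] /=; rewrite sF am.
- move=> _ [j [s [a [jm sF am ->]]]]; rewrite translate_productE phi_mev// rE.
  rewrite zeta_real cintegral_mev normc_realB; apply: lt1.
  apply: H2; first by rewrite size_map size_enum_ord.
  by apply/allP => _ /mapP[i _ ->] /=; rewrite sF am.
- move=> s n sF nm'; rewrite phi_alpha// phi_S// !rE /perm_shift.
  under [X in norm2 X]eq_fun do rewrite -rmorphB.
  apply: norm2_lt => //; last by apply: lt2; exact: H3.
  by move=> k; apply: le2 => //; apply: n1 => // x; exact: clipped1.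
Qed.

End Sequences.
End Conversion.

(** * Separated sets, distances, and the sofic approximation *)

Section Separated.
Context (R : realType).

Lemma separated_card_le (T : Type) (U : finType) (eps : R) (Y : set T)
    (rho : T -> T -> \bar R) (B : {set U}) (Q : T -> U -> Prop) :
  (forall y, Y y -> exists2 u, u \in B & Q y u) ->
  (forall y y' u, Y y -> Y y' -> Q y u -> Q y' u -> (rho y y' <= eps%:E)%E) ->
  (separated_card eps Y rho <= (#|B|%:R)%:E)%E.
Proof.
move=> YB Qrho; apply: ge_ereal_sup => _ [n [y [Yy sep]] <-].
have /choice[u uP] : forall i, exists u, u \in B /\ Q (y i) u.
  by move=> i; have [u uB Qu] := YB _ (Yy i); exists u.
have u_inj : injective u.
  move=> i j uij; apply/eqP; apply: contraT => /sep; rewrite ltNge => /negP[].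
  by apply: (Qrho _ _ (u i)) => //; [exact: (uP i).2|rewrite uij; exact: (uP j).2].
rewrite lee_fin ler_nat -[leqLHS]card_ord -(card_imset _ u_inj) subset_leq_card//.
by apply/fintype.subsetP => _ /imsetP[i _ ->]; exact: (uP i).1.
Qed.

Lemma separated_card_ge (T : Type) (U : finType) (eps : R) (Y : set T)
    (rho : T -> T -> \bar R) (E : {set U}) (g : U -> T) :
  (forall u, u \in E -> Y (g u)) ->
  (forall u v, u \in E -> v \in E -> u != v -> (eps%:E < rho (g u) (g v))%E) ->
  ((#|E|%:R)%:E <= separated_card eps Y rho)%E.
Proof.
move=> EY sep; apply: ereal_sup_ubound; exists #|E| => //.
exists (fun i => g (enum_val i)); split => [i|i j ij]; first exact/EY/enum_valP.
apply: sep; try exact: enum_valP.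
by apply: contra_neq ij => /enum_val_inj.
Qed.

Lemma separated_card_ge0 (T : Type) (eps : R) (Y : set T) (rho : T -> T -> \bar R) :
  (0 <= separated_card eps Y rho)%E.
Proof.
apply: ereal_sup_ubound; exists 0%N => //.
have y : 'I_0 -> T by case.
by exists y; split => [[]|[]].
Qed.

(** A separated subset that is maximal for inclusion is a net. *)
Lemma maximal_separated (U : finType) (A : {set U}) (close : rel U) :
  reflexive close -> symmetric close -> exists E : {set U}, [/\ E \subset A,
    forall x y, x \in E -> y \in E -> x != y -> ~~ close x y &
    forall x, x \in A -> exists2 y, y \in E & close x y].
Proof.
move=> crefl csym.
pose p (E : {set U}) := (E \subset A) &&
  [forall x in E, forall y in E, (x != y) ==> ~~ close x y].
have p0 : p finset.set0.
  by rewrite /p finset.sub0set; apply/forallP => x; rewrite inE.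
have [E /maxsetP[/andP[EA sepE] maxE]] := ex_maxset (ex_intro _ finset.set0 p0).
have sE x y : x \in E -> y \in E -> x != y -> ~~ close x y.
  by move=> xE yE; have /forallP/(_ x)/implyP/(_ xE)/forallP/(_ y)/implyP/(_ yE)/implyP := sepE.
exists E; split => // x xA.
apply/exists_inP; apply: contraT => /exists_inPn far.
have xE : x \in E.
  rewrite -(maxE (x |: E)%SET); first by rewrite !inE eqxx.
    apply/andP; split.
      by apply/fintype.subsetP => y; rewrite !inE => /orP[/eqP ->//|/(fintype.subsetP EA)].
    apply/forall_inP => y yE; apply/forall_inP => z zE; apply/implyP => yz.
    move: yE zE; rewrite !inE => /orP[/eqP yx|yE] /orP[/eqP zx|zE].
    - by rewrite yx zx eqxx in yz.
    - by rewrite yx; exact: far.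
    - by rewrite zx csym; exact: far.
    - exact: sE.
  by apply/fintype.subsetP => y yE; rewrite !inE yE orbT.
by have := far _ xE; rewrite crefl.
Qed.

End Separated.

Section Distances.
Context (R : realType) (G : groupType) (dX : measure_display)
  (X : measurableType dX) (mu : probability X R) (act : G -> X -> X).
Hypothesis act_pmp : pmp_action mu act.
Context (S : nat -> X -> R) (SP : unit_ball_sequence mu S).
Local Notation S' := (clipped S).
Context (d : nat) (d0 : (0 < d)%N).
Context (phi phi' : (X -> R[i]) -> 'I_d -> R[i])
  (phiP : unital_positive_map mu phi) (phiP' : unital_positive_map mu phi').

Let w n (k : 'I_d) : R := real_part phi (S' n) k - real_part phi' (S' n) k.

Let bS' n : bdd (S' n). Proof. exact: (bdd_S (measurable_clipped SP) (clipped1 S)). Qed.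

Let w2 n k : `|w n k| <= 2.
Proof.
rewrite (le_trans (ler_normB _ _))// -[2]/(1 + 1) lerD//.
  by apply: (norm_psi (real_part_positive phiP)) => // x; exact: clipped1.
by apply: (norm_psi (real_part_positive phiP')) => // x; exact: clipped1.
Qed.

Lemma rhoE : rhoS S phi phi' =
  (\sum_(0 <= n <oo) (2^-1 ^+ n.+1 * norm2 (fun k => real_complex R (w n k)))%:E)%E.
Proof.
apply: eq_eseriesr => n _; congr (_ * _)%:E; congr norm2; apply/funext => k.
by rewrite !(phi_S SP)// -rmorphB.
Qed.

Let norm_ge0 n : 0 <= norm2 (fun k => real_complex R (w n k)).
Proof. exact: sqrtr_ge0. Qed.

Lemma rho_ge a : ((2^-1 ^+ a.+1 * mean (fun k => `|w a k|))%:E <= rhoS S phi phi')%E.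
Proof.
have t0 n : (0 <= (2^-1 ^+ n.+1 * norm2 (fun k => real_complex R (w n k)))%:E)%E.
  by rewrite lee_fin mulr_ge0// exprn_ge0// invr_ge0.
rewrite rhoE; apply: (@le_trans _ _ (\sum_(0 <= n < a.+1)
  (2^-1 ^+ n.+1 * norm2 (fun k => real_complex R (w n k)))%:E)%E); last exact: nneseries_lim_ge.
rewrite big_nat_recr//= -[leLHS]add0e leeD//; first exact: sume_ge0.
by rewrite lee_fin ler_wpM2l ?exprn_ge0 ?invr_ge0//; exact: mean_le_norm2.
Qed.

Lemma sum_half M : \sum_(0 <= n < M) 2^-1 ^+ n.+1 = 1 - 2^-1 ^+ M :> R.
Proof.
elim: M => [|M IH]; first by rewrite big_geq// expr0 subrr.
by rewrite big_nat_recr//= IH exprS; lra.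
Qed.

(** The first [K] terms are weighted averages of norms at most [t]; the other norms
    are at most [2], with weights that add up to [2^-1 ^+ K]. *)
Lemma rho_le (t : R) K : 0 <= t -> (forall a, (a < K)%N -> 2 * mean (fun k => `|w a k|) <= t ^+ 2) ->
  (rhoS S phi phi' <= (t + 2 * 2^-1 ^+ K)%:E)%E.
Proof.
move=> t0 wt; rewrite rhoE.
have h0 n : 0 <= 2^-1 ^+ n :> R by rewrite exprn_ge0// invr_ge0.
apply: lime_le.
  by apply: is_cvg_nneseries => n _ _; rewrite lee_fin mulr_ge0.
exists K => // M /= KM; rewrite sumEFin lee_fin.
have nt n : (n < K)%N -> norm2 (fun k => real_complex R (w n k)) <= t.
  move=> nK; apply: le_trans (norm2_le_mean (w2 n)) _.
  by rewrite -[leRHS]ger0_norm// -sqrtr_sqr ler_wsqrtr// wt.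
have n2 n : norm2 (fun k => real_complex R (w n k)) <= 2.
  apply: le_trans (norm2_le_mean (w2 n)) _.
  rewrite -[leRHS]ger0_norm// -sqrtr_sqr ler_wsqrtr// expr2 ler_wpM2l//.
  by rewrite -(mean_cst d0 2); apply: le_mean => // k.
rewrite (@big_cat_nat _ _ _ K)//=; apply: lerD.
  apply: (@le_trans _ _ (\sum_(0 <= n < K) 2^-1 ^+ n.+1 * t)).
    by rewrite !big_mkord; apply: ler_sum => n _; rewrite ler_wpM2l// nt.
  by rewrite -mulr_suml sum_half ler_piMl// gerBl.
apply: (@le_trans _ _ (\sum_(K <= n < M) 2^-1 ^+ n.+1 * 2)).
  by apply: ler_sum => n _; rewrite ler_wpM2l.
rewrite -mulr_suml mulrC ler_wpM2l//.
have := sum_half M; rewrite (@big_cat_nat _ _ _ K)//= sum_half.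
by move: (h0 M); move: (2^-1 ^+ M) (2^-1 ^+ K) (\sum_(_ <= _ < _) _) => x y z; lra.
Qed.

End Distances.

Section AlmostMultiplicative.
Context (R : realType) (G : groupType) (d : nat -> nat) (sigma : forall i, G -> 'S_(d i)).
Hypothesis sigmaP : sofic_approximation R sigma.

Lemma near_all (T : eqType) (s : seq T) (Q : T -> nat -> Prop) :
  (forall x, \forall i \near \oo, Q x i) -> \forall i \near \oo, forall x, x \in s -> Q x i.
Proof.
move=> H; elim: s => [|x s IH]; first by apply: nearW.
apply: filterS2 (H x) IH => i Hx IHi y; rewrite inE => /orP[/eqP -> //|].
exact: IHi.
Qed.

Lemma near_pos : \forall i \near \oo, (0 < d i)%N.
Proof. by case: sigmaP => /cvgnyPgt /(_ 0%N). Qed.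

Lemma near_almost_mult (F : {fset G}) (delta : R) : 0 < delta ->
  \forall i \near \oo, (0 < d i)%N /\ almost_mult (sigma i) F delta.
Proof.
move=> delta0; have [_ mult _] := sigmaP.
have H : \forall i \near \oo, forall s, s \in enum_fset F -> forall t, t \in enum_fset F ->
    1 - #|[set k : 'I_(d i) | sigma i (s * t)%g k == sigma i s (sigma i t k)]%SET|%:R / (d i)%:R <= delta.
  apply: near_all => s; apply: near_all => t.
  have := mult s t => /cvgrPdist_le /(_ _ delta0); apply: filterS => i.
  by apply: le_trans; exact: ler_norm.
apply: filterS2 near_pos H => i di H; split => // s t sF tF.
apply: le_trans (H s sF t tF); rewrite -mean_card// -[X in _ <= X - _](mean_cst di 1) -meanB//.
rewrite -(mean_perm (sigma i (s * t)%g)); apply: le_mean => // k; rewrite permK.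
have [E|nE] := eqVneq (sigma i (s * t)%g k) (sigma i s (sigma i t k)).
  by rewrite E !permK eqxx subrr.
by rewrite subr0 lern1 leq_b1.
Qed.

End AlmostMultiplicative.

(** * Comparison of the two entropies *)

Section Equality.
Context (R : realType) (G : groupType) (dX : measure_display)
  (X : measurableType dX) (mu : probability X R) (act : G -> X -> X).
Hypothesis act_pmp : pmp_action mu act.
Context (e : nat -> G) (e_surj : forall s, exists n, e n = s).
Context (P : nat -> set X) (genP : generating_partition mu act P).
Hypothesis Pent : (partition_entropy mu P < +oo)%E.
Context (L : X -> nat) (PL : forall n x, P n x <-> L x = n).
Context (S : nat -> X -> R) (SP : unit_ball_sequence mu S)
  (genS : dynamically_generating mu act (range (fun n => cplx (S n)))).
Context (d : nat -> nat) (sigma : forall i, G -> 'S_(d i))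
  (sigmaP : sofic_approximation R sigma).
Local Notation Ex := (Ex mu).
Local Notation labellings := (labellings mu act L).
Local Notation S' := (clipped S).
Let mS' := measurable_clipped SP.
Let S1' := clipped1 S.
Let genS' := clipped_generating SP genS.
Let bS' n : bdd (S' n). Proof. exact: (bdd_S mS' S1'). Qed.

Lemma half_small (x : R) : 0 < x -> exists K, 2^-1 ^+ K < x.
Proof.
move=> x0; have : (fun K => 2^-1 ^+ K : R) @ \oo --> (0 : R).
  by apply: cvg_expr; rewrite ger0_norm ?invr_ge0// invf_lt1// (ltr_nat R 1 2).
by move=> /cvgrPdist_lt/(_ x x0)[K _ /(_ K (leqnn K))]; rewrite sub0r normrN ger0_norm ?exprn_ge0 ?invr_ge0//; exists K.
Qed.

Lemma approx_prefix (K : nat) (c : R) : 0 < c -> exists (F0 : {fset G}) (N0 : nat),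
  forall (F : {fset G}) N, (F0 `<=` F)%fset -> (N0 <= N)%N ->
  exists cs : 'I_K -> {ffun F -> 'I_N.+1} -> R, (forall a t, `|cs a t| <= 1) /\
    forall a : 'I_K, Ex (fun x => `|S' a x - cs a (name act L F N x)|) <= c.
Proof.
move=> c0.
have /choice[FN FNP] : forall a : 'I_K, exists FN : {fset G} * nat, forall (F : {fset G}) N,
    (FN.1 `<=` F)%fset -> (FN.2 <= N)%N ->
    exists cs : {ffun F -> 'I_N.+1} -> R, (forall t, `|cs t| <= 1) /\
      Ex (fun x => `|S' a x - cs (name act L F N x)|) < c.
  move=> a; have [F0 [N0 H]] := name_approx act_pmp e_surj genP PL (bS' a) (S1' a) ler01 c0.
  by exists (F0, N0).
exists (\big[fsetU/fset0]_(a < K) (FN a).1), (\max_(a < K) (FN a).2) => F N FF NN.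
have /choice[cs csP] : forall a : 'I_K, exists cs : {ffun F -> 'I_N.+1} -> R,
    (forall t, `|cs t| <= 1) /\ Ex (fun x => `|S' a x - cs (name act L F N x)|) < c.
  move=> a; apply: FNP.
    by apply: fsubset_trans FF; rewrite (bigD1 a)//= fsubsetUl.
  by apply: leq_trans NN; exact: (@leq_bigmax _ (fun a : 'I_K => (FN a).2)).
by exists cs; split => [a|a]; have [H1 H2] := csP a => //; exact: ltW.
Qed.

(** Two maps that [encode_rUP] sends to the same labelling are within [2 * c] of
    each other at each of the first [K] functions, hence not separated. *)
Lemma UP_separated_le (eps : R) : 0 < eps -> forall F : {fset G}, exists N0, forall N, (N0 <= N)%N ->
  forall delta : R, 0 < delta -> exists (F' : {fset G}) (m : nat) (delta' : R),
  [/\ F' != fset0, (0 < m)%N, 0 < delta' & forall i (tau : G -> 'S_i), (0 < i)%N -> almost_mult tau F' delta' ->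
    (separated_card eps (UP mu act S F' m delta' tau) (@rhoS R dX X S i)
       <= (#|labellings N F delta tau|%:R)%:E)%E].
Proof.
move=> eps0 F; have e4 : 0 < eps / 4 by rewrite divr_gt0.
have [K Keps] := half_small e4.
pose t := eps / 2.
have t0 : 0 < t by rewrite divr_gt0.
pose c := t ^+ 2 / 4.
have c0 : 0 < c by rewrite divr_gt0// exprn_gt0.
have c32 : 0 < c ^+ 2 / 32 by rewrite divr_gt0// exprn_gt0.
have [F0 [N0 H]] := approx_prefix K c32.
exists N0 => N NN delta delta0; pose F1 := (F `|` F0)%fset.
have [cs [cs1 csP]] := H F1 N (fsubsetUr _ _) NN.
have [Fe [m [delta' [delta'0 Henc]]]] :=
  encode_rUP act_pmp e_surj genP PL mS' S1' genS' c0 delta0 cs1 csP.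
exists (1%g |` Fe)%fset, m.+1, delta'; split => //.
  by apply/fset0Pn; exists 1%g; rewrite !inE eqxx.
move=> i tau i0 /(almost_mult_sub (fsubsetUr _ _) (lexx _)) gt.
apply: (separated_card_le (Q := fun phi q => forall a : 'I_K,
  mean (fun k => `|real_part phi (S' a) k - cs a (named tau F1 q k)|) <= c)).
- move=> phi /(UP_rUP act_pmp SP i0) /(rUP_sub (fsubsetUr _ _) (leqnSn m) (lexx _)) /(Henc _ _ _ i0 gt) [q [qd qP]].
  exists q => //; rewrite inE; apply: le_trans qd.
  by apply: (defect_sub act_pmp genP PL) => //; exact: fsubsetUl.
move=> phi phi' q [phiP _ _ _] [phiP' _ _ _] Hq Hq'.
apply: le_trans (rho_le SP i0 phiP phiP' (t := t) (K := K) (ltW t0) _) _.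
  move=> a aK; pose a' := Ordinal aK.
  have : mean (fun k => `|real_part phi (S' a) k - real_part phi' (S' a) k|) <= c + c.
    apply: le_trans (le_mean_dist _ (fun k => cs a' (named tau F1 q k)) _) _.
    by apply: lerD; [exact: (Hq a')|rewrite mean_distC; exact: (Hq' a')].
  by rewrite /c; move: (mean _) (t ^+ 2) => x y; lra.
by rewrite lee_fin /t; move: Keps; move: (2^-1 ^+ K) => x; lra.
Qed.

Definition UP_rate (eps : R) F m delta : \bar R := limn_esup (fun i => rate (d i)
  (separated_card eps (UP mu act S F m delta (sigma i)) (@rhoS R dX X S (d i)))).

Definition level_entropy (eps : R) : \bar R := ereal_inf [set ereal_inf [set ereal_inf [set
    UP_rate eps F m delta
    | delta in [set delta : R | 0 < delta]]
    | m in [set m : nat | (0 < m)%N]]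
    | F in [set F : {fset G} | F != fset0]].

Lemma level_entropy_le eps F m delta : F != fset0 -> (0 < m)%N -> 0 < delta ->
  (level_entropy eps <= UP_rate eps F m delta)%E.
Proof.
move=> F0 m0 delta0.
apply: le_trans (ereal_inf_lbound _) _; first by exists F.
apply: le_trans (ereal_inf_lbound _) _; first by exists m.
by apply: ereal_inf_lbound; exists delta.
Qed.

Lemma level_entropy_ge eps c : (forall F m delta, F != fset0 -> (0 < m)%N -> 0 < delta ->
  (c <= UP_rate eps F m delta)%E) -> (c <= level_entropy eps)%E.
Proof.
move=> H; do 3 (apply: le_ereal_inf_tmp => _ [? /= ? <-]); exact: H.
Qed.

Lemma sequence_entropyE : sequence_entropy mu act sigma S =
  ereal_sup [set level_entropy eps | eps in [set eps : R | 0 < eps]].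
Proof. by []. Qed.

Lemma entropy_le_bowen :
  (sequence_entropy mu act sigma S <= bowen_partition mu act sigma P)%E.
Proof.
rewrite sequence_entropyE; apply: ge_ereal_sup => _ [eps /= eps0 <-].
apply: (bowen_ge act_pmp genP PL Pent) => F F0.
have [N0 H] := UP_separated_le eps0 F; exists N0 => N NN.
apply: le_ereal_inf_tmp => _ [delta /= delta0 <-].
have [F' [m [delta' [F'0 m0 delta'0 HF]]]] := H N NN delta delta0.
apply: le_trans (level_entropy_le eps F'0 m0 delta'0) _.
rewrite -[leRHS]adde0; apply: limn_esup_le.
have := near_almost_mult sigmaP F' delta'0; apply: filterS => i [di gi].
apply: rate_le; [exact: separated_card_ge0|by rewrite lee_fin|by []|move=> _].
by rewrite mul0r expR0 mule1; exact: HF.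
Qed.

(** In a maximal set [E] of labellings with pairwise different coarse parts, up to
    the radius of [count_close], distinct labellings give separated maps by
    [separation].  Every other labelling is near an element of [E], and
    [count_close] bounds how many are near the same one. *)
Lemma UP_separated_ge (kappa : R) : 0 < kappa -> exists2 eps : R, 0 < eps &
  forall (F : {fset G}) m (delta : R), 0 < delta -> forall n1, exists (N : nat) (F3 : {fset G}) (delta3 : R)
    (Fg : {fset G}) (deltag : R), [/\ (n1 <= N)%N, F3 != fset0, 0 < delta3, 0 < deltag &
  forall i (tau : G -> 'S_i), (0 < i)%N -> almost_mult tau Fg deltag ->
    ((#|labellings N F3 delta3 tau|%:R)%:E <=
      separated_card eps (UP mu act S F m delta tau) (@rhoS R dX X S i) * (expR (kappa * i%:R))%:E)%E].
Proof.
move=> k0; have [n H] := count_close act_pmp genP PL Pent k0.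
have eta0 := hamming_radius_gt0 n.+1 k0.
have [eps [K [F0 [m0 [delta0 [eps0 delta00 Hsep]]]]]] := separation act_pmp e_surj genP PL mS' S1' genS' n eta0.
have hK : 0 < 2^-1 ^+ K :> R by rewrite exprn_gt0// invr_gt0.
(* in [rhoS] each of the first [K] functions has weight at least [2^-1 ^+ K] *)
exists (2^-1 ^+ K * eps); first by rewrite mulr_gt0.
move=> F m delta delta_gt0 n1.
pose delta' := Num.min (Num.min delta (delta ^+ 2 / 2)) delta0.
have delta'0 : 0 < delta' by rewrite !lt_min delta_gt0 delta00 divr_gt0// exprn_gt0.
have [F3 [N0 [oF3 Hdec]]] := decode_rUP act_pmp e_surj genP PL mS' S1' (F `|` F0)%fset (maxn m m0) delta'0.
pose N := maxn n1 (maxn n N0).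
have nN : (n <= N)%N by rewrite /N !leq_max leqnn ?orbT.
have n1N : (n1 <= N)%N by rewrite /N !leq_max leqnn ?orbT.
have N0N : (N0 <= N)%N by rewrite /N !leq_max leqnn ?orbT.
have [Fg [delta3 [delta30 {}Hdec]]] := Hdec N N0N.
have [delta4 delta40 Hcount] := H n N (leqnn n) nN.
pose delta5 := Num.min (Num.min delta3 delta4) delta0.
have d53 : delta5 <= delta3 by rewrite /delta5 !ge_min lexx.
have d54 : delta5 <= delta4 by rewrite /delta5 !ge_min lexx orbT.
have d50 : delta5 <= delta0 by rewrite /delta5 !ge_min lexx orbT.
exists N, F3, delta5, (Fg `|` F0)%fset, (Num.min delta3 delta0); split => //.
- by apply/fset0Pn; exists 1%g.
- by rewrite !lt_min delta30 delta40.
- by rewrite lt_min delta30.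
move=> i tau i0 gt.
have gt3 : almost_mult tau Fg delta3.
  by apply: almost_mult_sub gt; [exact: fsubsetUl|rewrite ge_min lexx].
have gt0 : almost_mult tau F0 delta0.
  by apply: almost_mult_sub gt; [exact: fsubsetUr|rewrite ge_min lexx orbT].
pose A := labellings N F3 delta5 tau.
pose close (q q' : {ffun 'I_i -> 'I_N.+1}) :=
  mean (fun k => (coarse n (q k) != coarse n (q' k))%:R) <= hamming_radius kappa n.+1.
have crefl : reflexive close.
  move=> q; rewrite /close; under eq_mean do rewrite eqxx.
  by rewrite mean_cst// ltW.
have csym : symmetric close.
  by move=> q q'; rewrite /close; congr (_ <= _); apply: eq_mean => k; rewrite eq_sym.
have [E [EA Esep Ecov]] := maximal_separated A crefl csym.
have AD q : q \in A -> defect mu act L tau F3 q <= delta5 by rewrite inE.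
have up q : q \in A -> rUP mu act S' tau (F `|` F0)%fset (maxn m m0) delta' (psiq mu act L tau F3 q).
  by move=> qA; apply: Hdec => //; exact: le_trans (AD q qA) d53.
have upUP q : q \in A -> UP mu act S F m delta tau (complexify (psiq mu act L tau F3 q)).
  move=> qA; apply: (rUP_UP act_pmp SP) => //.
    by move=> f g mf bg fg; exact: (psiq_ae act_pmp genP PL).
  apply: rUP_sub (up q qA); [exact: fsubsetUl|exact: leq_maxl|].
  by rewrite /delta' ge_min lexx.
have rpE q f : real_part (complexify (psiq mu act L tau F3 q)) f = psiq mu act L tau F3 q f.
  apply/funext => k; rewrite /real_part complexify_real//.
  exact: (psiq_positive act_pmp genP PL).
have Ele : ((#|E|%:R)%:E <= separated_card (2^-1 ^+ K * eps) (UP mu act S F m delta tau) (@rhoS R dX X S i))%E.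
  apply: (separated_card_ge (g := fun q => complexify (psiq mu act L tau F3 q))).
    by move=> q /(fintype.subsetP EA); exact: upUP.
  move=> q q' qE q'E qq'.
  have qA := fintype.subsetP EA _ qE; have q'A := fintype.subsetP EA _ q'E.
  have [phiP _ _ _] := upUP q qA; have [phiP' _ _ _] := upUP q' q'A.
  have : exists2 a, (a < K)%N & eps < mean (fun k => `|psiq mu act L tau F3 q (S' a) k - psiq mu act L tau F3 q' (S' a) k|).
    apply: contrapT => Hno; have /negP := Esep q q' qE q'E qq'; apply.
    have rs q0 : q0 \in A -> rUP mu act S' tau F0 m0 delta0 (psiq mu act L tau F3 q0).
      move=> q0A; apply: rUP_sub (up q0 q0A); [exact: fsubsetUr|exact: leq_maxr|].
      by rewrite /delta' ge_min lexx orbT.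
    apply: (Hsep N F3 i tau q q') => //; try exact: rs.
    - exact: le_trans (AD q qA) d50.
    - exact: le_trans (AD q' q'A) d50.
    move=> a aK; rewrite leNgt; apply/negP => epsa; apply: Hno; exists a => //.
  move=> [a aK epsa]; apply: lt_le_trans (rho_ge SP i0 phiP phiP' a).
  rewrite !rpE lte_fin; apply: (@lt_le_trans _ _ (2^-1 ^+ K * mean (fun k =>
    `|psiq mu act L tau F3 q (S' a) k - psiq mu act L tau F3 q' (S' a) k|))).
    by rewrite ltr_pM2l.
  apply: ler_wpM2r; first exact: mean_ge0.
  by apply: ler_wiXn2l => //; rewrite ?invr_ge0// invf_le1// (ler_nat R 1 2).
have ek : (0 <= (expR (kappa * i%:R))%:E)%E by rewrite lee_fin expR_ge0.
apply: le_trans (lee_wpmul2r ek Ele); rewrite -EFinM lee_fin.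
have /choice[f fP] : forall q, exists q', q \in A -> q' \in E /\ close q q'.
  move=> q; have [qA|qA] := boolP (q \in A); last by exists q.
  by have [q' q'E cq] := Ecov q qA; exists q'.
apply: (fiber_bound (f := f)) => [q qA|q' q'E]; first exact: (fP q qA).1.
apply: (Hcount F3 i tau _ (fun k => coarse n (q' k))) => //.
- by apply/fset0Pn; exists 1%g.
- apply/fintype.subsetP => q; rewrite inE => /andP[qA _].
  by rewrite inE; exact: le_trans (AD q qA) d54.
by move=> q; rewrite inE => /andP[qA /eqP <-]; exact: (fP q qA).2.
Qed.

Lemma bowen_le_entropy :
  (bowen_partition mu act sigma P <= sequence_entropy mu act sigma S)%E.
Proof.
apply/lee_addgt0Pr => c c0; have k0 : 0 < c / 2 by rewrite divr_gt0.
have [n1 Hb] := bowen_le act_pmp genP PL sigma Pent k0.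
have [eps eps0 H] := UP_separated_ge k0.
rewrite -leeBlDr//; apply: (@le_trans _ _ (level_entropy eps)); last first.
  by rewrite sequence_entropyE; apply: ereal_sup_ubound; exists eps.
apply: level_entropy_ge => F m delta F0 m0 delta0; rewrite leeBlDr//.
have [N [F3 [delta3 [Fg [deltag [n1N F30 delta30 deltag0 HN]]]]]] := H F m delta delta0 n1.
apply: le_trans (Hb N F3 n1N F30) _.
have -> : c%:E = ((c / 2)%:E + (c / 2)%:E)%E by rewrite -EFinD; congr EFin; field.
rewrite addeA; apply: leeD => //.
apply: (@le_trans _ _ (limn_esup (fun i => rate (d i) (#|labellings N F3 delta3 (sigma i)|%:R)%:E))).
  by apply: ereal_inf_lbound; exists delta3.
apply: limn_esup_le.
have := near_almost_mult sigmaP Fg deltag0; apply: filterS => i [di gi].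
apply: rate_le; [by rewrite lee_fin|exact: separated_card_ge0|exact: ltW|move=> _].
exact: HN.
Qed.

Lemma entropy_eq : sequence_entropy mu act sigma S = bowen_partition mu act sigma P.
Proof. by apply/eqP; rewrite eq_le entropy_le_bowen bowen_le_entropy. Qed.

End Equality.

Lemma countable_surj (G : groupType) : countable [set: G] -> exists e : nat -> G, forall s, exists n, e n = s.
Proof.
move=> /countable_injP[f f_inj].
exists (fun n => xget 1%g [set s | f s = n]) => s; exists (f s).
apply: f_inj; try exact: mem_set.
exact: (@xgetPex _ 1%g [set t | f t = f s] (ex_intro _ s erefl)).
Qed.

Lemma partition_label (dX : measure_display) (X : measurableType dX) (P : nat -> set X) : measurable_partition P ->
  exists L : X -> nat, forall n x, P n x <-> L x = n.
Proof.
move=> [_ /trivIsetP triv cov].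
have /choice[L LP] : forall x, exists n, P n x.
  by move=> x; have : [set: X] x by []; rewrite -cov => -[n _ Pnx]; exists n.
exists L => n x; split => [Pnx|<-//].
apply/eqP; apply: contraT => Ln; have := triv _ _ I I Ln.
by move=> /seteqP[/(_ x (conj (LP x) Pnx))].
Qed.

Lemma indicator_generating (R : realType) (G : groupType) (dX : measure_display)
    (X : measurableType dX) (mu : probability X R) (act : G -> X -> X) (P : nat -> set X) : generating_partition mu act P ->
  generating_sequence mu act (fun n => \1_(P n)).
Proof.
move=> [[mP _ _] gP]; split => // n; split.
  apply: bdd_Lfun; split; first exact: measurable_indic.
  by exists 1 => x; rewrite indicE normr_nat lern1 leq_b1.
by apply/Lnorm_le1; apply: aeW => x; rewrite indicE normr_nat lern1 leq_b1.
Qed.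

Theorem theorem3p6 (R : realType) (G : groupType)
    (dX : measure_display) (X : measurableType dX) (mu : probability X R)
    (act : G -> X -> X)
    (d : nat -> nat) (sigma : forall i : nat, G -> 'S_(d i))
    (G_countable : countable [set: G])
    (G_sofic : sofic R G)
    (X_standard : standard_borel R X)
    (act_pmp : pmp_action mu act)
    (sigma_sofic : sofic_approximation R sigma)
    (generating : exists P : nat -> set X,
       generating_partition mu act P /\ (partition_entropy mu P < +oo)%E) :
  exists v : \bar R,
    is_measure_entropy mu act sigma v /\ is_bowen_entropy mu act sigma v.
Proof.
have [e e_surj] := countable_surj G_countable.
have [P0 [genP0 entP0]] := generating.
have key P S : generating_partition mu act P -> (partition_entropy mu P < +oo)%E ->
    generating_sequence mu act S -> sequence_entropy mu act sigma S = bowen_partition mu act sigma P.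
  move=> genP entP [SP genS]; have [L PL] := partition_label genP.1.
  exact: (entropy_eq act_pmp e_surj genP entP PL SP genS sigma_sofic).
have S0 := indicator_generating genP0.
exists (bowen_partition mu act sigma P0); split; split.
- by exists (fun n => \1_(P0 n)).
- by move=> S gS; exact: key.
- exact: generating.
- by move=> P gP eP; rewrite -(key P _ gP eP S0) (key P0 _ genP0 entP0 S0).
Qed.
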